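(* Let $d,s,t,\nu$ be positive integers, let $\{\boldsymbol n=\boldsymbol n(n)\}_n$ be a sequence of positive $d$-indices tending to $\infty$, and, for every $n$, let $\Omega_{1,n},\ldots,\Omega_{\nu,n}$ be subsets of $[0,1]^d$ such that $\Omega_{i,n}\xrightarrow{\mathrm{w.r.t.}\,\boldsymbol n}\Omega_i$ for every $i=1,\ldots,\nu$, where $\Omega_1,\ldots,\Omega_\nu\subseteq[0,1]^d$ are regular. Let $\kappa:[0,1]^d\times[-\pi,\pi]^d\to\mathbb C^{s\times t}$ be measurable and let $\{A_n\}_n$ be a sequence of matrices with $A_n$ of size $N(\boldsymbol n)s\times N(\boldsymbol n)t$ and $\{A_n\}_n\sim_{\rm GLT}\kappa$. Then $$\Bigl\{\mathrm{blockdiag}_{\Omega_{1,n},\ldots,\Omega_{\nu,n}}^{\boldsymbol n,s,t}(A_n)\Bigr\}_n\sim_{\rm GLT}\kappa(\boldsymbol x,\boldsymbol\theta)\sum_{i=1}^\nu\chi_{\Omega_i}(\boldsymbol x),$$ $$\Bigl\{\mathrm{blocktril}_{\Omega_{1,n},\ldots,\Omega_{\nu,n}}^{\boldsymbol n,s,t}(A_n)\Bigr\}_n\sim_{\rm GLT}\kappa(\boldsymbol x,\boldsymbol\theta)\sum_{1\le j\le i\le\nu}\chi_{\Omega_i\cap\Omega_j}(\boldsymbol x).$$ In particular, if $\sum_{i=1}^\nu\chi_{\Omega_i}=1$ a.e. on $[0,1]^d$ (which happens, for instance, if $\{\Omega_1,\ldots,\Omega_\nu\}$ is a partition of $[0,1]^d$),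 then $$\Bigl\{\mathrm{blockdiag}_{\Omega_{1,n},\ldots,\Omega_{\nu,n}}^{\boldsymbol n,s,t}(A_n)\Bigr\}_n\sim_{\rm GLT}\kappa,\qquad \Bigl\{\mathrm{blocktril}_{\Omega_{1,n},\ldots,\Omega_{\nu,n}}^{\boldsymbol n,s,t}(A_n)\Bigr\}_n\sim_{\rm GLT}\kappa.$$
   Context: **Multi-indices.** $\mathbb N=\{1,2,3,\ldots\}$. A $d$-index is a vector in $\mathbb Z^d$; it is positive if it lies in $\mathbb N^d$. $\mathbf 1=(1,\ldots,1)$. For $\boldsymbol n\in\mathbb N^d$, $N(\boldsymbol n)=n_1n_2\cdots n_d$. The range $\{\mathbf 1,\ldots,\boldsymbol n\}$ is $\{\boldsymbol i\in\mathbb Z^d:1\le i_k\le n_k\ \forall k\}$, ordered lexicographically. Vector operations are componentwise, e.g. $\boldsymbol i/\boldsymbol n=(i_1/n_1,\ldots,i_d/n_d)$. A matrix $A$ of size $N(\boldsymbol n)s\times N(\boldsymbol n)t$ is viewed as a block matrix $A=[A_{\boldsymbol i\boldsymbol j}]_{\boldsymbol i,\boldsymbol j=\mathbf 1}^{\boldsymbol n}$ with blocks $A_{\boldsymbol i\boldsymbol j}\in\mathbb C^{s\times t}$. For $\Omega\subseteq\mathbb R^d$, $\mathcal I_{\boldsymbol n}^\Omega=\{\boldsymbol i\in\{\mathbf 1,\ldots,\boldsymbol n\}:\boldsymbol i/\boldsymbol n\in\Omega\}$ and $N_{\boldsymbol n}^\Omega=|\mathcal I_{\boldsymbol n}^\Omega|$.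 A sequence $\{\boldsymbol n=\boldsymbol n(n)\}_n$ of positive $d$-indices tends to $\infty$ if $\min(\boldsymbol n(n))\to\infty$ as $n\to\infty$; here $n$ varies in some infinite subset of $\mathbb N$. $\chi_\Omega$ is the characteristic function of $\Omega$, $I_s$ the $s\times s$ identity. All measure-theoretic terms refer to Lebesgue measure; matrix-valued functions are measurable, continuous a.e., in $L^1$, etc. if their components are. **Diagonal sampling matrices and block operators.** For $a:[0,1]^d\to\mathbb C^{s\times t}$, $D_{\boldsymbol n}(a)$ is the $N(\boldsymbol n)s\times N(\boldsymbol n)t$ block diagonal matrix with $(\boldsymbol i,\boldsymbol i)$ block $a(\boldsymbol i/\boldsymbol n)$, $\boldsymbol i=\mathbf 1,\ldots,\boldsymbol n$. For $\Omega_L,\Omega_R\subseteq[0,1]^d$ and $A\in\mathbb C^{N(\boldsymbol n)s\times N(\boldsymbol n)t}$, the zeroing operator is $Z_{\Omega_L,\Omega_R}^{\boldsymbol n,s,t}(A)=D_{\boldsymbol n}(\chi_{\Omega_L}I_s)\,A\,D_{\boldsymbol n}(\chi_{\Omega_R}I_t)$. For $\Omega_1,\ldots,\Omega_\nu\subseteq[0,1]^d$, $$\mathrm{blockdiag}_{\Omega_1,\ldots,\Omega_\nu}^{\boldsymbol n,s,t}(A)=\sum_{i=1}^\nu Z_{\Omega_i,\Omega_i}^{\boldsymbol n,s,t}(A),\qquad \mathrm{blocktril}_{\Omega_1,\ldots,\Omega_\nu}^{\boldsymbol n,s,t}(A)=\sum_{1\le j\le i\le\nu}Z_{\Omega_i,\Omega_j}^{\boldsymbol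 n,s,t}(A).$$ **Convergence of sets; regular sets.** $\Omega_n\xrightarrow{\mathrm{w.r.t.}\,\boldsymbol n}\Omega$ means $\lim_{n\to\infty}N_{\boldsymbol n}^{\Omega_n\triangle\Omega}/N(\boldsymbol n)=0$, where $\triangle$ is the symmetric difference. A set $\Omega\subset\mathbb R^d$ is regular if it is bounded and its boundary $\partial\Omega$ has zero Lebesgue measure in $\mathbb R^d$. A partition of $[0,1]^d$ is a family of pairwise disjoint sets whose union is $[0,1]^d$. **GLT sequences.** For $f:[-\pi,\pi]^d\to\mathbb C^{s\times t}$ in $L^1([-\pi,\pi]^d)$ with Fourier coefficients $f_{\boldsymbol k}=\frac1{(2\pi)^d}\int_{[-\pi,\pi]^d}f(\boldsymbol\theta)e^{-\mathrm i\,\boldsymbol k\cdot\boldsymbol\theta}d\boldsymbol\theta$, $\boldsymbol k\in\mathbb Z^d$, let $T_{\boldsymbol n}(f)=[f_{\boldsymbol i-\boldsymbol j}]_{\boldsymbol i,\boldsymbol j=\mathbf 1}^{\boldsymbol n}$. Let $A_n,B_{n,m}$ be matrices of size $d_n\times e_n$ with $d_n,e_n\to\infty$. We write $\{B_{n,m}\}_n\xrightarrow{\rm a.c.s.}\{A_n\}_n$ (approximating class of sequences) if for every $m$ there exists $n_m$ such that, for $n\ge n_m$, $A_n=B_{n,m}+R_{n,m}+N_{n,m}$ with $\mathrm{rank}(R_{n,m})\le c(m)\min(d_n,e_n)$ and $\|N_{n,m}\|\le\omega(m)$ (spectral norm), where $n_m,c(m),\omega(m)$ depend only on $m$ and $\lim_{m\to\infty}c(m)=\lim_{m\to\infty}\omega(m)=0$.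 Let $\{\boldsymbol n=\boldsymbol n(n)\}_n$ be positive $d$-indices tending to $\infty$, let $A_n$ have size $N(\boldsymbol n)s\times N(\boldsymbol n)t$, and let $\kappa:[0,1]^d\times[-\pi,\pi]^d\to\mathbb C^{s\times t}$ be measurable. Then $\{A_n\}_n\sim_{\rm GLT}\kappa$ ($\{A_n\}_n$ is a GLT sequence with symbol $\kappa$) means that there exist functions $a_{i,m}:[0,1]^d\to\mathbb C$ continuous a.e. and $f_{i,m}:[-\pi,\pi]^d\to\mathbb C^{s\times t}$ in $L^1([-\pi,\pi]^d)$, $i=1,\ldots,N_m$, such that $\sum_{i=1}^{N_m}a_{i,m}(\boldsymbol x)f_{i,m}(\boldsymbol\theta)\to\kappa(\boldsymbol x,\boldsymbol\theta)$ a.e. on $[0,1]^d\times[-\pi,\pi]^d$ as $m\to\infty$ and $\bigl\{\sum_{i=1}^{N_m}D_{\boldsymbol n}(a_{i,m}I_s)T_{\boldsymbol n}(f_{i,m})\bigr\}_n\xrightarrow{\rm a.c.s.}\{A_n\}_n$. *)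

(* Defs.v *)
From HB Require Import structures.
From mathcomp Require Import all_boot all_order all_algebra.
From mathcomp Require Import complex mxtens.
From mathcomp Require Import all_classical all_reals all_analysis.

Set Implicit Arguments.
Unset Strict Implicit.
Unset Printing Implicit Defensive.

Import Order.TTheory GRing.Theory Num.Theory.
Import numFieldNormedType.Exports.

Local Open Scope classical_set_scope.
Local Open Scope ring_scope.

(* Lebesgue measure on [R^d]: outer measure by countable covers by half-open
   boxes, restricted to its Caratheodory measurable sets.  The sigma-algebra is
   the complete Lebesgue one, not the Borel one. *)

Section lebesgue_measure_rV.
Context {R : realType} {d : nat}.
Local Open Scope ereal_scope.

Definition rV_box (ab : 'rV[R]_d * 'rV[R]_d) : set 'rV[R]_d :=
  [set x | forall k, (ab.1 ord0 k < x ord0 k <= ab.2 ord0 k)%R].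

Definition rV_box_volume (ab : 'rV[R]_d * 'rV[R]_d) : R :=
  (\prod_k Num.max 0 (ab.2 ord0 k - ab.1 ord0 k))%R.

(* Index sets [DF.1] are allowed to be finite or empty: in dimension 0 there is
   no empty box with which to complete a finite family. *)
Definition rV_box_cover (A : set 'rV[R]_d) :
    set (set nat * (nat -> 'rV[R]_d * 'rV[R]_d)) :=
  [set DF | A `<=` \bigcup_(k in DF.1) rV_box (DF.2 k)].

Definition lebesgue_outer (A : set 'rV[R]_d) : \bar R :=
  ereal_inf [set \esum_(k in DF.1) (rV_box_volume (DF.2 k))%:E |
             DF in rV_box_cover A].

Let vol_ge0 ab : 0 <= (rV_box_volume ab)%:E.
Proof. by rewrite lee_fin; apply: prodr_ge0 => k _; rewrite le_max lexx. Qed.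

Let lebesgue_outer_ge0 A : 0 <= lebesgue_outer A.
Proof. by apply: le_ereal_inf_tmp => _ [DF _ <-]; exact: esum_ge0. Qed.

Let lebesgue_outer0 : lebesgue_outer set0 = 0.
Proof.
apply/eqP; rewrite eq_le lebesgue_outer_ge0 andbT.
by apply: ereal_inf_lbound; exists (set0, fun=> (0%R, 0%R)); rewrite //= esum_set0.
Qed.

Let le_lebesgue_outer :
  {homo lebesgue_outer : A B / A `<=` B >-> A <= B}.
Proof.
move=> A B AB; apply: ereal_inf_le_tmp => _ [DF BDF <-]; exists DF => //.
exact: subset_trans BDF.
Qed.

Let lebesgue_outer_sigma_subadditive : sigma_subadditive lebesgue_outer.
Proof.
move=> A; have [[i ioo]|] := pselect (exists i, lebesgue_outer (A i) = +oo).
  rewrite (eseries_pinfty _ _ ioo) ?leey// => n _.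
  by rewrite -ltNye (lt_le_trans _ (lebesgue_outer_ge0 _)).
rewrite -forallNE => Aoo.
suff add2e (e : {posnum R}) : lebesgue_outer (\bigcup_n A n) <=
    \sum_(i <oo) lebesgue_outer (A i) + e%:num%:E.
  by apply/lee_addgt0Pr => _/posnumP[].
rewrite (le_trans _ (epsilon_trick _ _ _))//.
pose P n (G : set nat * (nat -> 'rV[R]_d * 'rV[R]_d)) := rV_box_cover (A n) G /\
  \esum_(k in G.1) (rV_box_volume (G.2 k))%:E <=
  lebesgue_outer (A n) + (e%:num / (2 ^ n.+1)%:R)%:E.
have [G PG] : {G & forall n, P n (G n)}.
  apply: (@choice _ _ P) => n; rewrite /P /lebesgue_outer.
  set S := (X in ereal_inf X).
  have Sfin : ereal_inf S \is a fin_num.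
    rewrite ge0_fin_numE; last exact: lebesgue_outer_ge0.
    by rewrite ltey; apply/eqP/Aoo.
  have en1 : (0 < e%:num / (2 ^ n.+1)%:R)%R by [].
  have [_ [DF cDF <-] lt_DF] := lb_ereal_inf_adherent en1 Sfin.
  by exists DF; split => //; exact: ltW.
have /card_esym/ppcard_eqP[f] := card_nat2.
pose D := [set: nat] `*`` (fun n => (G n).1).
pose b (p : nat * nat) := (G p.1).2 p.2.
apply: (@le_trans _ _ (\esum_(p in D) (rV_box_volume (b p))%:E)).
  apply: ereal_inf_lbound; exists (f @^-1` D, b \o f) => /=.
    move=> x [n _ Anx]; have [k Dk bk] := (PG n).1 _ Anx.
    by exists (f^-1%FUN (n, k)); rewrite /= invK ?inE.
  apply/esym/(@reindex_esum R nat (nat * nat)%type _ _ f).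
  split => [//|x y _ _|p Dp].
    by apply: (@inj _ _ setT f); rewrite inE.
  by exists (f^-1%FUN p); rewrite /= invK ?inE.
rewrite /D /b -(esum_esum (a := fun n k => (rV_box_volume ((G n).2 k))%:E))//.
rewrite -nneseries_esumT; last by move=> n; exact: esum_ge0.
apply: lee_nneseries => n _; first by move=> _; exact: esum_ge0.
exact: (PG n).2.
Qed.

HB.instance Definition _ := isOuterMeasure.Build R 'rV[R]_d lebesgue_outer
  lebesgue_outer0 lebesgue_outer_ge0 le_lebesgue_outer
  lebesgue_outer_sigma_subadditive.

End lebesgue_measure_rV.

Notation lebesgue_rV R d := (caratheodory_type (@lebesgue_outer R d)).

Section lebesgue_measure_rV_measure.
Context (R : realType) (d : nat).

Definition lebesgue_mu : set (lebesgue_rV R d) -> \bar R := @lebesgue_outer R d.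

Let lebesgue_mu0 : lebesgue_mu set0 = 0%E.
Proof. exact: outer_measure0. Qed.

Let lebesgue_mu_ge0 A : (0 <= lebesgue_mu A)%E.
Proof. exact: outer_measure_ge0. Qed.

Let lebesgue_mu_semi_sigma_additive : semi_sigma_additive lebesgue_mu.
Proof. exact: caratheodory_measure_sigma_additive. Qed.

HB.instance Definition _ := isMeasure.Build _ _ _ lebesgue_mu
  lebesgue_mu0 lebesgue_mu_ge0 lebesgue_mu_semi_sigma_additive.

End lebesgue_measure_rV_measure.

Section domains.
Context {R : realType}.

Definition unit_cube d : set 'rV[R]_d :=
  [set x | forall k, 0 <= x ord0 k <= 1].

Definition freq_cube d : set 'rV[R]_d :=
  [set theta | forall k, - pi <= theta ord0 k <= pi].

Definition symbol_dom d : set 'rV[R]_(d + d) :=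
  [set z | unit_cube (lsubmx z) /\ freq_cube (rsubmx z)].

(* Topological boundary of null measure; [lebesgue_mu] is applied to an
   arbitrary set, where it is the outer measure. *)
Definition regular_set d (Om : set 'rV[R]_d) : Prop :=
  bounded_set Om /\ lebesgue_mu (closure Om `\` Om°) = 0%E.

End domains.
Arguments unit_cube {R} d.
Arguments freq_cube {R} d.
Arguments symbol_dom {R} d.

(* Functions on a subset of [R^d] are total functions of which only the values on
   that subset matter.  [R[i]^o] is [R[i]] with the topology of its norm. *)

Section complex_functions.
Context {R : realType} {d : nat}.
Implicit Types (D : set 'rV[R]_d) (f : 'rV[R]_d -> R[i]).

Definition cmeasurable D f : Prop :=
  measurable_fun (D : set (lebesgue_rV R d)) (fun x => complex.Re (f x) : R) /\
  measurable_fun (D : set (lebesgue_rV R d)) (fun x => complex.Im (f x) : R).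

Definition cintegrable D f : Prop :=
  (@lebesgue_mu R d).-integrable D (fun x => (complex.Re (f x))%:E) /\
  (@lebesgue_mu R d).-integrable D (fun x => (complex.Im (f x))%:E).

Definition cintegral D f : R[i] :=
  Complex (Rintegral (@lebesgue_mu R d) D (fun x => complex.Re (f x)))
          (Rintegral (@lebesgue_mu R d) D (fun x => complex.Im (f x))).

(* continuity at almost every point of [D], relatively to [D] *)
Definition continuous_ae D f : Prop :=
  {ae @lebesgue_mu R d, forall x : 'rV[R]_d, D x ->
     (f y : R[i]^o) @[y --> within D (nbhs x)] --> (f x : R[i]^o)}.

End complex_functions.

Definition expi {R : realType} (x : R) : R[i] := Complex (cos x) (sin x).

Section multi_indices.
Context {d : nat}.
Implicit Types n : 'I_d -> nat.

Definition msize n : nat := (\prod_(k < d) n k)%N.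

(* The (0-based) [r]-th element of {1,...,n} in lexicographic order: mixed radix
   expansion of [r], the last component varying fastest. *)
Definition mindex n (r : 'I_(msize n)) (k : 'I_d) : nat :=
  ((r %/ \prod_(l < d | (k < l)%N) n l) %% n k).+1.

(* The initial value does not affect the minimum when [d > 0]. *)
Definition mindex_min n : nat :=
  (\big[minn/(\max_(k < d) n k)]_(k < d) n k)%N.

Definition grid_point {R : realType} n (r : 'I_(msize n)) : 'rV[R]_d :=
  \row_k ((mindex r k)%:R / (n k)%:R).

Definition grid_count {R : realType} n (Om : set 'rV[R]_d) : nat :=
  #|[pred r : 'I_(msize n) | (grid_point r : 'rV[R]_d) \in Om]|.

End multi_indices.

(* Row [i * s + u] and column [j * t + v] hold the [(u, v)] entry of the
   [(i, j)] block. *)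
Definition block_matrix {C : Type} (N s t : nat) (B : 'I_N -> 'I_N -> 'M[C]_(s, t)) :
    'M[C]_(N * s, N * t) :=
  \matrix_(p, q) B (mxtens_unindex p).1 (mxtens_unindex q).1
                   (mxtens_unindex p).2 (mxtens_unindex q).2.

Section sampling_toeplitz.
Context {R : realType} {d s t : nat}.
Implicit Types n : 'I_d -> nat.

Definition diag_sampling n (a : 'rV[R]_d -> 'M[R[i]]_(s, t)) :
    'M[R[i]]_(msize n * s, msize n * t) :=
  block_matrix (fun i j => if i == j then a (grid_point i) else 0).

Definition fourier_coef (f : 'rV[R]_d -> 'M[R[i]]_(s, t)) (k : 'I_d -> int) :
    'M[R[i]]_(s, t) :=
  \matrix_(u, v) (real_complex R ((2 * pi) ^- d) *
    cintegral (freq_cube d) (fun theta =>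
      f theta u v * expi (- \sum_(l < d) (k l)%:~R * theta ord0 l))).

Definition toeplitz n (f : 'rV[R]_d -> 'M[R[i]]_(s, t)) :
    'M[R[i]]_(msize n * s, msize n * t) :=
  block_matrix (fun i j =>
    fourier_coef f (fun l => (mindex i l)%:Z - (mindex j l)%:Z)).

End sampling_toeplitz.

Section block_operators.
Context {R : realType} {d : nat}.
Implicit Types n : 'I_d -> nat.

Definition zeroing n s t (OmL OmR : set 'rV[R]_d)
    (A : 'M[R[i]]_(msize n * s, msize n * t)) :=
  diag_sampling n (fun x => (\1_OmL x)%:M : 'M[R[i]]_s) *m A *m
  diag_sampling n (fun x => (\1_OmR x)%:M : 'M[R[i]]_t).

Definition blockdiag n s t nu (Om : 'I_nu -> set 'rV[R]_d)
    (A : 'M[R[i]]_(msize n * s, msize n * t)) :=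
  \sum_(i < nu) zeroing (Om i) (Om i) A.

Definition blocktril n s t nu (Om : 'I_nu -> set 'rV[R]_d)
    (A : 'M[R[i]]_(msize n * s, msize n * t)) :=
  \sum_(i < nu) \sum_(j < nu | (j <= i)%N) zeroing (Om i) (Om j) A.

End block_operators.

(* [J] is the infinite set of naturals in which the index of the sequences
   varies; values at indices outside [J] are irrelevant. *)

Definition mindex_to_infty {d : nat} (J : set nat) (nn : nat -> 'I_d -> nat) :
    Prop :=
  mindex_min (nn n) @[n --> within J \oo] --> \oo.

Definition set_cvg {R : realType} {d : nat} (J : set nat) (nn : nat -> 'I_d -> nat)
    (Omn : nat -> set 'rV[R]_d) (Om : set 'rV[R]_d) : Prop :=
  (grid_count (nn n) (Omn n `+` Om))%:R / (msize (nn n))%:R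
    @[n --> within J \oo] --> (0 : R).

Section acs.
Context {R : realType}.

Definition l2norm m (x : 'cV[R[i]]_m) : R :=
  Num.sqrt (\sum_(k < m) complex.Re `|x k ord0| ^+ 2).

Definition spectral_norm m p (A : 'M[R[i]]_(m, p)) : R :=
  sup [set l2norm (A *m x) | x in [set x : 'cV[R[i]]_p | l2norm x <= 1]].

Definition acs_cvg (J : set nat) (dd ee : nat -> nat)
    (B : forall m n : nat, 'M[R[i]]_(dd n, ee n))
    (A : forall n : nat, 'M[R[i]]_(dd n, ee n)) : Prop :=
  exists (n_ : nat -> nat) (c omega : nat -> R),
    [/\ c @ \oo --> (0 : R), omega @ \oo --> (0 : R) &
      forall m n, J n -> (n_ m <= n)%N ->
        exists Rk Nm : 'M[R[i]]_(dd n, ee n),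
          [/\ A n = B m n + Rk + Nm,
              (\rank Rk)%:R <= c m * (minn (dd n) (ee n))%:R &
              spectral_norm Nm <= omega m]].

End acs.

Section glt.
Context {R : realType} {d s t : nat}.

Definition measurable_symbol
    (kappa : 'rV[R]_d -> 'rV[R]_d -> 'M[R[i]]_(s, t)) : Prop :=
  forall u v, cmeasurable (symbol_dom d)
    (fun z : 'rV[R]_(d + d) => kappa (lsubmx z) (rsubmx z) u v).

Definition GLT (J : set nat) (nn : nat -> 'I_d -> nat)
    (A : forall n, 'M[R[i]]_(msize (nn n) * s, msize (nn n) * t))
    (kappa : 'rV[R]_d -> 'rV[R]_d -> 'M[R[i]]_(s, t)) : Prop :=
  measurable_symbol kappa /\
  exists (N_ : nat -> nat)
         (a : forall m, 'I_(N_ m) -> 'rV[R]_d -> R[i])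
         (f : forall m, 'I_(N_ m) -> 'rV[R]_d -> 'M[R[i]]_(s, t)),
    [/\ forall m i, continuous_ae (unit_cube d) (a m i),
        forall m i u v, cintegrable (freq_cube d) (fun theta => f m i theta u v),
        {ae @lebesgue_mu R (d + d), forall z : 'rV[R]_(d + d), symbol_dom d z ->
          forall u v,
          ((\sum_(i < N_ m) a m i (lsubmx z) *: f m i (rsubmx z)) u v : R[i]^o)
            @[m --> \oo] --> (kappa (lsubmx z) (rsubmx z) u v : R[i]^o)} &
        acs_cvg J
          (fun m n => \sum_(i < N_ m)
             diag_sampling (nn n) (fun x => (a m i x)%:M : 'M[R[i]]_s) *m
             toeplitz (nn n) (f m i))
          A].

End glt.

(* Main.v *)
Require Import Defs.
From HB Require Import structures.
From mathcomp Require Import all_boot all_order all_algebra.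
From mathcomp Require Import complex mxtens.
From mathcomp Require Import all_classical all_reals all_analysis.
From mathcomp Require Import measurable_realfun.
From mathcomp Require Import ring lra.

Set Implicit Arguments.
Unset Strict Implicit.
Unset Printing Implicit Defensive.

Import Order.TTheory GRing.Theory Num.Theory.
Import numFieldNormedType.Exports.
Import Normc.

Local Open Scope classical_set_scope.
Local Open Scope ring_scope.

(** Write D(a) for the diagonal sampling matrix of a, T(f) for the Toeplitz
    matrix of f, chi_i for the characteristic function of the i-th limit set,
    and N for the number of grid points.  By hypothesis A_n is close to
    B = sum_l D(a_l) T(f_l), up to a matrix of small rank plus a matrix of
    small norm.  The claim is that the sum, over a set of pairs (i, j), of the
    zeroed matrices Z_{i,j}(A_n) is close to D(h) B = sum_l D(h a_l) T(f_l),
    where h is the sum of the products chi_i chi_j.  The functions h a_l are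
    again continuous a.e. since the boundaries of the limit sets are null, and
    sum_l h a_l f_l tends to h kappa wherever sum_l a_l f_l tends to kappa, so
    the new approximants are legitimate ones ([GLT_zeroing_sum]).

    Three errors separate Z_{i,j}(A_n) from D(chi_i chi_j) B.
    - The error A_n - B of the given approximation is multiplied on both sides
      by contractions, which increases neither its rank nor its norm.
    - Replacing the n-th sets by their limits changes as many diagonal blocks
      as there are grid points in the symmetric differences: a matrix of rank
      o(N).
    - The factor D(chi_j) on the right has to be moved to the left of B, which
      costs D(a_l) times the commutator T(f_l) D(chi_j) - D(chi_j) T(f_l).

    The commutator is the heart of the matter.  Cutting T(f) into blocks by
    rows and columns of the symbol reduces it to scalar symbols, and taking
    positive and negative parts of the real and imaginary parts reduces it to
    a symbol r >= 0 ([near_comm_split_nneg]).  Write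
    r = min(r, M) + (r - M)^+.
    - For M large the second term has small integral.  Its Toeplitz matrix is
      positive semidefinite with trace proportional to N times that integral,
      hence has few eigenvalues above a given threshold: it is a matrix of
      small rank plus one of small norm ([stoeplitz_lowrank_split]).
    - The first term is square integrable.  Entry (x, y) of its commutator
      vanishes unless exactly one of the grid points x, y lies in the set, so
      that the squared Frobenius norm is the sum over all frequencies k of
      |f_k|^2 times the number of grid points that the shift by k carries
      across the boundary.  For each k this number is o(N), and the sum of
      |f_k|^2 converges by Bessel's inequality; therefore the sum is o(N)
      ([near_frob2_comm]), and a matrix with squared Frobenius norm o(N) is
      again a matrix of rank o(N) plus one of small norm.
    Bessel's inequality rests on the orthogonality of the characters, whose
    integrals vanish because a suitable translation changes their sign
    ([cintegral_character]).

    That few grid points come close to a null set is a compactness statement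
    ([near_sparse_bad]): if almost every point of the cube has a neighbourhood
    on which a property eventually holds, the bad points form a compact null
    set, which finitely many open boxes of small total volume cover.  Besides
    the boundary crossings, it yields that the a_l, which may be unbounded,
    are bounded at all but a small proportion of the grid points, so that the
    factor D(a_l) does no harm ([near_sdiag_comm_split]). *)

(** * Operator bounds and low-rank splittings *)

Section modulus.
Context {R : realType}.
Implicit Types z w : R[i].

Lemma normc_ge0 z : 0 <= normc z.
Proof. by case: z => a b /=; rewrite sqrtr_ge0. Qed.

Lemma sqr_normcC z : (normc z ^+ 2)%:C%C = z^* * z.
Proof. by rewrite mulrC -normCK rmorphXn. Qed.

Lemma normc_real (x : R) : normc x%:C%C = `|x|.
Proof. by rewrite /= expr0n addr0 sqrtr_sqr. Qed.

Lemma normc_conj z : normc z^* = normc z.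
Proof. by case: z => a b /=; rewrite sqrrN. Qed.

Lemma ge0_normcE z : 0 <= z -> z = (normc z)%:C%C.
Proof. by move=> z0; rewrite -[LHS]ger0_norm. Qed.

Lemma normc_sum I (r : seq I) (P : pred I) (F : I -> R[i]) :
  normc (\sum_(i <- r | P i) F i) <= \sum_(i <- r | P i) normc (F i).
Proof.
elim/big_rec2: _ => [|i y z _ h]; first by rewrite normc0.
by rewrite (le_trans (le_normcD _ _))// lerD2l.
Qed.

End modulus.

(** By induction on the list: the step is the inequality of the arithmetic and
    geometric means applied to [a i ^+ 2 * B] and [b i ^+ 2 * A]. *)
Lemma CauchySchwarz_sum {R : realDomainType} I (r : seq I) (a b : I -> R) :
  (\sum_(i <- r) a i * b i) ^+ 2 <=
  (\sum_(i <- r) a i ^+ 2) * (\sum_(i <- r) b i ^+ 2).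
Proof.
elim: r => [|i r IH]; first by rewrite !big_nil expr0n mulr0.
rewrite !big_cons; set A := \sum_(j <- r) a j ^+ 2 in IH *.
set B := \sum_(j <- r) b j ^+ 2 in IH *; set c := \sum_(j <- r) _ in IH *.
have A0 : 0 <= A by apply: sumr_ge0 => j _; exact: sqr_ge0.
have B0 : 0 <= B by apply: sumr_ge0 => j _; exact: sqr_ge0.
suff : 2 * (a i * b i * c) <= a i ^+ 2 * B + b i ^+ 2 * A by lra.
have [h|h] := leP (a i * b i * c) 0.
  by apply: (@le_trans _ _ 0); [lra|rewrite addr_ge0// mulr_ge0// sqr_ge0].
rewrite -(@ler_pXn2r _ 2%N)// ?nnegrE; last 2 first.
- by rewrite mulr_ge0// ltW.
- by rewrite addr_ge0// mulr_ge0// sqr_ge0.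
set x := a i; set y := b i.
apply: (@le_trans _ _ (4 * (x ^+ 2 * y ^+ 2 * (A * B)))).
  rewrite [leLHS](_ : _ = 4 * (x ^+ 2 * y ^+ 2 * c ^+ 2)); last by ring.
  by rewrite !ler_wpM2l// mulr_ge0// sqr_ge0.
rewrite -subr_ge0 [leRHS](_ : _ = (x ^+ 2 * B - y ^+ 2 * A) ^+ 2); last by ring.
exact: sqr_ge0.
Qed.

Section operator_bound.
Local Open Scope sesquilinear_scope.
Context {R : realType}.
Local Notation C := R[i].

Definition sqnorm m (x : 'cV[C]_m) : R := \sum_k normc (x k 0) ^+ 2.

Lemma sqnorm_ge0 m (x : 'cV[C]_m) : 0 <= sqnorm x.
Proof. by apply: sumr_ge0 => k _; exact: sqr_ge0. Qed.

Lemma l2normE m (x : 'cV[C]_m) : l2norm x = Num.sqrt (sqnorm x).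
Proof. by []. Qed.

Lemma sqr_l2norm m (x : 'cV[C]_m) : l2norm x ^+ 2 = sqnorm x.
Proof. by rewrite sqr_sqrtr// sqnorm_ge0. Qed.

Lemma l2norm_ge0 m (x : 'cV[C]_m) : 0 <= l2norm x.
Proof. exact: sqrtr_ge0. Qed.

Lemma l2norm0 m : l2norm (0 : 'cV[C]_m) = 0.
Proof.
by rewrite /l2norm big1 ?sqrtr0// => k _; rewrite mxE normr0 /= expr0n.
Qed.

Lemma le_l2norm m n (c : R) (x : 'cV[C]_m) (y : 'cV[C]_n) : 0 <= c ->
  (l2norm x <= c * l2norm y) = (sqnorm x <= c ^+ 2 * sqnorm y).
Proof.
move=> c0; rewrite -(@ler_pXn2r _ 2%N)// ?nnegrE ?l2norm_ge0//.
  by rewrite exprMn !sqr_l2norm.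
by rewrite mulr_ge0// l2norm_ge0.
Qed.

Lemma sqnormC m (x : 'cV[C]_m) : (sqnorm x)%:C%C = (x ^t* *m x) 0 0.
Proof.
rewrite mxE /sqnorm raddf_sum; apply: eq_bigr => k _.
by rewrite !mxE -sqr_normcC.
Qed.

Lemma sqnormZ m (a : C) (x : 'cV[C]_m) : sqnorm (a *: x) = normc a ^+ 2 * sqnorm x.
Proof.
by rewrite /sqnorm mulr_sumr; apply: eq_bigr => k _; rewrite mxE normcM exprMn.
Qed.

Lemma l2normZ m (a : R) (x : 'cV[C]_m) : 0 <= a ->
  l2norm (a%:C%C *: x) = a * l2norm x.
Proof.
move=> a0; rewrite l2normE sqnormZ normc_real sqrtrM ?sqr_ge0// sqrtr_sqr.
by rewrite normr_id ger0_norm.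
Qed.

Lemma l2normD m (x y : 'cV[C]_m) : l2norm (x + y) <= l2norm x + l2norm y.
Proof.
rewrite -(@ler_pXn2r _ 2%N)// ?nnegrE ?addr_ge0 ?l2norm_ge0//.
rewrite sqr_l2norm sqrrD !sqr_l2norm.
apply: (@le_trans _ _ (\sum_k (normc (x k 0) + normc (y k 0)) ^+ 2)).
  apply: ler_sum => k _; rewrite mxE ler_pXn2r ?nnegrE ?addr_ge0 ?normc_ge0//.
  exact: le_normcD.
under eq_bigr do rewrite sqrrD.
rewrite !big_split /= lerD2r lerD2l -mulr2n lerMn2r /=.
rewrite -(@ler_pXn2r _ 2%N)// ?nnegrE; last 2 first.
- by apply: sumr_ge0 => k _; rewrite mulr_ge0 ?normc_ge0.
- by rewrite mulr_ge0 ?l2norm_ge0.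
by rewrite exprMn !sqr_l2norm; exact: CauchySchwarz_sum.
Qed.

(** A bound on the spectral norm in quantified form: unlike the supremum
    defining the norm, it composes and adds without a boundedness argument. *)
Definition opbound (c : R) m n (A : 'M[C]_(m, n)) :=
  forall x, l2norm (A *m x) <= c * l2norm x.

Definition frob2 m n (A : 'M[C]_(m, n)) : R := \sum_i \sum_j normc (A i j) ^+ 2.

Lemma frob2_ge0 m n (A : 'M[C]_(m, n)) : 0 <= frob2 A.
Proof. by apply: sumr_ge0 => i _; apply: sumr_ge0 => j _; exact: sqr_ge0. Qed.

Lemma sqnorm_mul_le m n (A : 'M[C]_(m, n)) x :
  sqnorm (A *m x) <= frob2 A * sqnorm x.
Proof.
rewrite /sqnorm /frob2 mulr_suml; apply: ler_sum => i _; rewrite mxE.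
apply: le_trans (CauchySchwarz_sum _ _ _).
rewrite ler_pXn2r ?nnegrE ?normc_ge0//; last first.
  by apply: sumr_ge0 => k _; rewrite mulr_ge0 ?normc_ge0.
by apply: (le_trans (normc_sum _ _ _)); apply: ler_sum => k _; rewrite normcM.
Qed.

Lemma opbound_frob2 m n (A : 'M[C]_(m, n)) : opbound (Num.sqrt (frob2 A)) A.
Proof.
move=> x; rewrite le_l2norm ?sqrtr_ge0// sqr_sqrtr ?frob2_ge0//.
exact: sqnorm_mul_le.
Qed.

(** The set whose supremum is the spectral norm is bounded, since the Frobenius
    norm bounds it; homogeneity then extends the bound from the unit ball to all
    vectors. *)
Lemma spectral_normP m n (A : 'M[C]_(m, n)) : opbound (spectral_norm A) A.
Proof.
move=> x; pose S := [set l2norm (A *m y) | y in [set y | l2norm y <= 1]].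
have ubS : has_ubound S.
  exists (Num.sqrt (frob2 A)) => _ [y /= y1 <-].
  by rewrite (le_trans (opbound_frob2 A y))// ler_piMr// sqrtr_ge0.
have [x0|x0] := eqVneq (l2norm x) 0.
  by rewrite x0 mulr0 (le_trans (opbound_frob2 A x))// x0 mulr0.
have xp : 0 < l2norm x by rewrite lt_neqAle eq_sym x0 l2norm_ge0.
rewrite -ler_pdivrMr// mulrC -l2normZ ?invr_ge0 ?l2norm_ge0//.
rewrite scalemxAr; apply: (@ub_le_sup _ S) => //=; eexists; last reflexivity.
by rewrite /= l2normZ ?invr_ge0 ?l2norm_ge0// mulVf.
Qed.

Lemma spectral_norm_ge0 m n (A : 'M[C]_(m, n)) : 0 <= spectral_norm A.
Proof.
apply: ub_le_sup; last by exists 0; rewrite /= ?mulmx0 l2norm0.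
exists (Num.sqrt (frob2 A)) => _ [y /= y1 <-].
by rewrite (le_trans (opbound_frob2 A y))// ler_piMr// sqrtr_ge0.
Qed.

Lemma opbound_spectral_norm (c : R) m n (A : 'M[C]_(m, n)) :
  0 <= c -> opbound c A -> spectral_norm A <= c.
Proof.
move=> c0 Ac; apply: ge_sup; first by exists 0, 0; rewrite /= ?mulmx0 l2norm0.
by move=> _ [x /= x1 <-]; rewrite (le_trans (Ac x))// ler_piMr.
Qed.

Lemma opbound_le c c' m n (A : 'M[C]_(m, n)) :
  c <= c' -> opbound c A -> opbound c' A.
Proof. by move=> cc' Ac x; rewrite (le_trans (Ac x))// ler_wpM2r// l2norm_ge0. Qed.

Lemma opboundD c c' m n (A B : 'M[C]_(m, n)) :
  opbound c A -> opbound c' B -> opbound (c + c') (A + B).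
Proof.
by move=> Ac Bc x; rewrite mulmxDl mulrDl (le_trans (l2normD _ _))// lerD.
Qed.

Lemma opbound0 m n : opbound 0 (0 : 'M[C]_(m, n)).
Proof. by move=> x; rewrite mul0mx l2norm0 mul0r. Qed.

Lemma opboundM c c' m n p (A : 'M[C]_(m, n)) (B : 'M[C]_(n, p)) :
  0 <= c -> opbound c A -> opbound c' B -> opbound (c * c') (A *m B).
Proof.
move=> c0 Ac Bc x; rewrite -mulmxA (le_trans (Ac _))// -mulrA ler_wpM2l//.
Qed.

Lemma opbound_diag c n (v : 'rV[C]_n) : 0 <= c ->
  (forall k, normc (v 0 k) <= c) -> opbound c (diag_mx v).
Proof.
move=> c0 vc x; rewrite le_l2norm// /sqnorm mulr_sumr; apply: ler_sum => k _.
rewrite mul_diag_mx mxE normcM exprMn ler_wpM2r ?sqr_ge0//.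
by rewrite ler_pXn2r ?nnegrE ?normc_ge0.
Qed.

Lemma rank_diag_mx n (v : 'rV[C]_n) :
  (\rank (diag_mx v) <= #|[pred k | v 0%R k != 0%R]|)%N.
Proof.
have -> : diag_mx v = \sum_(k | v 0 k != 0) v 0 k *: delta_mx k k.
  apply/matrixP => i j; rewrite !mxE summxE (bigID (pred1 i)) /=.
  rewrite [X in _ + X]big1 ?addr0; last first.
    by move=> k /andP[_ /negPf ki]; rewrite !mxE [i == k]eq_sym ki mulr0.
  have [vi|vi] := eqVneq (v 0 i) 0.
    by rewrite vi mul0rn big1// => k /andP[vk /eqP ki]; rewrite ki vi eqxx in vk.
  rewrite (eq_bigl (pred1 i)) ?big_pred1_eq; last first.
    by move=> k /=; have [->|] := eqVneq k i; rewrite ?vi ?andbF.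
  by rewrite !mxE eqxx /= eq_sym; case: eqP; rewrite ?mulr1n ?mulr1 ?mulr0n ?mulr0.
rewrite -sum1_card; elim/big_rec2: _ => [|k r A _ h]; first by rewrite mxrank0.
rewrite (leq_trans (mxrank_add _ _))// leq_add// (leq_trans (mxrank_scale _ _))//.
by rewrite mxrank_delta.
Qed.

End operator_bound.

Section spectral_cut.
Local Open Scope sesquilinear_scope.
Context {R : realType}.
Local Notation C := R[i].

Lemma trmxCM m n p (A : 'M[C]_(m, n)) (B : 'M[C]_(n, p)) :
  (A *m B)^t* = B^t* *m A^t*.
Proof. by rewrite trmx_mul map_mxM. Qed.

Lemma sqnorm_unitary n (U : 'M[C]_n) x : U^t* *m U = 1%:M ->
  sqnorm (U *m x) = sqnorm x.
Proof.
move=> UU; apply: complexI; rewrite !sqnormC trmxCM mulmxA.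
by rewrite -(mulmxA (x^t*)) UU mulmx1.
Qed.

Lemma opbound_unitary n (U : 'M[C]_n) : U^t* *m U = 1%:M -> opbound 1 U.
Proof. by move=> UU x; rewrite mul1r !l2normE sqnorm_unitary. Qed.

(** Take for [P] the spectral projection onto the eigenvalues above [e].  There
    are at most [\tr H / e] of them, as the eigenvalues are nonnegative and add up
    to the trace, and on the complementary subspace [H] is bounded by [e], both
    as an operator and as a quadratic form. *)
Lemma psd_spectral_cut n (H : 'M[C]_n) (e : R) : 0 < e ->
  H^t* = H -> (forall x : 'cV[C]_n, 0 <= (x^t* *m H *m x) 0 0) ->
  exists P : 'M[C]_n,
    [/\ (\rank P)%:R * e <= normc (\tr H), opbound e (H *m (1%:M - P)) &
        forall x, let y := (1%:M - P) *m x in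
        normc ((y^t* *m H *m y) 0 0) <= e * sqnorm x].
Proof.
move=> e0 Hh Hpos.
have /orthomx_spectralP : H \is normalmx by apply/normalmxP; rewrite Hh.
set U := spectralmx H; set d := spectral_diag H.
have Uu : U \is unitarymx by exact: spectral_unitarymx.
rewrite invmx_unitary// => HE.
have UU : U *m U^t* = 1%:M by exact/unitarymxP.
have UU' : U^t* *m U = 1%:M by rewrite -invmx_unitary// mulVmx// unitarymx_unit.
have d0 i : 0 <= d 0 i.
  have := Hpos (U^t* *m delta_mx i 0); rewrite trmxCM trmxCK HE.
  rewrite !mulmxA -(mulmxA _ U (U^t*)) UU mulmx1 -(mulmxA _ U (U^t*)) UU mulmx1.
  rewrite trmx_delta map_delta_mx -rowE row_diag_mx -scalemxAl mul_delta_mx.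
  by rewrite !mxE !eqxx mulr1.
(* The projection onto the eigenvectors with eigenvalue above [e]. *)
pose v : 'rV[C]_n := \row_i (e < normc (d 0 i))%R%:R.
pose P := U^t* *m diag_mx v *m U.
have PE : 1%:M - P = U^t* *m diag_mx (const_mx 1 - v) *m U.
  by rewrite linearB /= mulmxBr mulmxBl diag_const_mx mulmx1 UU'.
have vd i : normc (d 0 i) * normc ((const_mx 1 - v) 0 i) ^+ 2 <= e.
  rewrite !mxE; case: ltP => h; first by rewrite subrr normc0 expr0n mulr0 ltW.
  by rewrite subr0 normc1 expr1n mulr1.
have v1 i : normc ((const_mx 1 - v) 0 i) <= 1.
  rewrite !mxE; case: ltP => h; first by rewrite subrr normc0.
  by rewrite subr0 normc1.
exists P; split.
- have rP : (\rank P <= #|[pred i | (e < normc (d 0%R i))%R]|)%N.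
    rewrite /P (leq_trans (mxrankM_maxl _ _))// (leq_trans (mxrankM_maxr _ _))//.
    rewrite (leq_trans (rank_diag_mx _))// subset_leq_card//.
    by apply/fintype.subsetP => i; rewrite !inE mxE; case: ltP => //; rewrite eqxx.
  apply: (@le_trans _ _ (#|[pred i | e < normc (d 0 i)]|%:R * e)).
    by rewrite ler_pM2r// ler_nat.
  have -> : \tr H = (\sum_i normc (d 0 i))%:C%C.
    rewrite HE mxtrace_mulC mulmxA UU mul1mx mxtrace_diag raddf_sum.
    by apply: eq_bigr => i _; exact: ge0_normcE.
  rewrite normc_real ger0_norm; last by apply: sumr_ge0 => i _; exact: normc_ge0.
  rewrite mulrC mulr_natr -sumr_const [leRHS](bigID [pred i | e < normc (d 0 i)])/=.
  rewrite ler_wpDr ?sumr_ge0// ?ler_sum// => i; first by rewrite normc_ge0.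
  by rewrite inE => /ltW.
- have -> : H *m (1%:M - P) = U^t* *m (diag_mx d *m diag_mx (const_mx 1 - v)) *m U.
    by rewrite PE {1}HE !mulmxA -(mulmxA _ U (U^t*)) UU mulmx1.
  rewrite mulmx_diag -[e]mulr1 -[e * 1]mul1r.
  rewrite mulrA; apply: opboundM; rewrite ?mul1r ?ltW//; last exact: opbound_unitary.
  rewrite -[e]mul1r; apply: opboundM => //.
    by apply: opbound_unitary; rewrite trmxCK.
  apply: opbound_diag => [|i]; first exact: ltW.
  rewrite !mxE normcM; case: ltP => h; first by rewrite subrr normc0 mulr0 ltW.
  by rewrite subr0 normc1 mulr1.
- move=> x /=; set y := (1%:M - P) *m x; pose z := diag_mx (const_mx 1 - v) *m (U *m x).
  have yE : y = U^t* *m z by rewrite /y PE !mulmxA.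
  have -> : y^t* *m H *m y = z^t* *m diag_mx d *m z.
    rewrite yE HE trmxCM trmxCK !mulmxA -(mulmxA _ U (U^t*)) UU mulmx1.
    by rewrite -(mulmxA _ U (U^t*)) UU mulmx1.
  rewrite mxE; apply: (le_trans (normc_sum _ _ _)).
  rewrite -(sqnorm_unitary x UU') /sqnorm mulr_sumr; apply: ler_sum => k _.
  rewrite mul_mx_diag /z mul_diag_mx !mxE -/(v) !normcM normc_conj normcM.
  have := vd k; rewrite !mxE.
  move: (normc (1 - _)) => a; move: (normc (d 0 k)) => b.
  move: (normc (\sum_j _)) => w vdk.
  rewrite [leLHS](_ : _ = (b * a ^+ 2) * w ^+ 2); last by ring.
  by rewrite ler_wpM2r// sqr_ge0.
Qed.

(** The two error terms that approximating classes of sequences allow. *)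
Definition lowrank_split (r e : R) m n (M : 'M[C]_(m, n)) :=
  exists Rk Nm : 'M[C]_(m, n),
    [/\ M = Rk + Nm, (\rank Rk)%:R <= r & opbound e Nm].

Lemma psd_lowrank_split n (H : 'M[C]_n) (e : R) : 0 < e ->
  H^t* = H -> (forall x : 'cV[C]_n, 0 <= (x^t* *m H *m x) 0 0) ->
  lowrank_split (normc (\tr H) / e) e H.
Proof.
move=> e0 Hh Hpos; have [P [rP HP _]] := psd_spectral_cut e0 Hh Hpos.
exists (H *m P), (H *m (1%:M - P)); split => //.
  by rewrite mulmxBr mulmx1 addrC subrK.
rewrite ler_pdivlMr// (le_trans _ rP)// ler_pM2r// ler_nat.
exact: mxrankM_maxr.
Qed.

(** The spectral cut of [A^t* *m A], whose trace is the squared Frobenius norm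
    and whose quadratic form is the squared norm of the image under [A]. *)
Lemma frob2_lowrank_split m n (A : 'M[C]_(m, n)) (e : R) : 0 < e ->
  lowrank_split (frob2 A / e ^+ 2) e A.
Proof.
move=> e0; pose H := A^t* *m A.
have Hh : H^t* = H by rewrite /H trmxCM trmxCK.
have HA (x : 'cV[C]_n) : (x^t* *m H *m x) 0 0 = (sqnorm (A *m x))%:C%C.
  by rewrite sqnormC trmxCM !mulmxA.
have Hpos (x : 'cV[C]_n) : 0 <= (x^t* *m H *m x) 0 0.
  by rewrite HA ler0c sqnorm_ge0.
have [P [rP _ HP]] := psd_spectral_cut (exprn_gt0 2 e0) Hh Hpos.
exists (A *m P), (A *m (1%:M - P)); split.
- by rewrite mulmxBr mulmx1 addrC subrK.
- rewrite ler_pdivlMr ?exprn_gt0//.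
  have -> : frob2 A = normc (\tr H).
    have -> : \tr H = (frob2 A)%:C%C.
      rewrite /frob2 /mxtrace exchange_big raddf_sum; apply: eq_bigr => i _.
      rewrite mxE raddf_sum; apply: eq_bigr => j _.
      by rewrite !mxE -sqr_normcC.
    by rewrite normc_real ger0_norm// frob2_ge0.
  by rewrite (le_trans _ rP)// ler_pM2r ?exprn_gt0// ler_nat mxrankM_maxr.
- move=> x; rewrite le_l2norm ?(ltW e0)//.
  have := HP x; rewrite /= HA normc_real ger0_norm ?sqnorm_ge0//.
  by rewrite mulmxA.
Qed.

Lemma lowrank_split_le r r' e e' m n (A : 'M[C]_(m, n)) :
  r <= r' -> e <= e' -> lowrank_split r e A -> lowrank_split r' e' A.
Proof.
move=> rr ee [X [Y [-> Xr Ye]]]; exists X, Y; split => //.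
  exact: le_trans rr.
exact: opbound_le ee _.
Qed.

Lemma lowrank_splitD r r' e e' m n (A B : 'M[C]_(m, n)) :
  lowrank_split r e A -> lowrank_split r' e' B ->
  lowrank_split (r + r') (e + e') (A + B).
Proof.
move=> [X [Y [-> Xr Ye]]] [X' [Y' [-> Xr' Ye']]].
exists (X + X'), (Y + Y'); split; first by rewrite addrACA.
  by rewrite (le_trans _ (lerD Xr Xr'))// -natrD ler_nat mxrank_add.
exact: opboundD.
Qed.

Lemma lowrank_split_sum I (s : seq I) (Q : pred I) r e m n
    (F : I -> 'M[C]_(m, n)) :
  (forall i, Q i -> lowrank_split r e (F i)) ->
  lowrank_split (r *+ count Q s) (e *+ count Q s) (\sum_(i <- s | Q i) F i).
Proof.
move=> QF; elim: s => [|i s IH].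
  rewrite big_nil !mulr0n; exists 0, 0; rewrite addr0 mxrank0.
  by split => //; exact: opbound0.
rewrite big_cons /=; case: ifPn => [Qi|_]; last by rewrite add0n.
by rewrite !mulrSr ![_ *+ _ + _]addrC; apply: lowrank_splitD => //; exact: QF.
Qed.

Lemma lowrank_splitM r e c c' m n p q (A : 'M[C]_(m, n)) (B : 'M[C]_(n, p))
    (D : 'M[C]_(p, q)) : 0 <= c -> 0 <= e -> opbound c A -> opbound c' D ->
  lowrank_split r e B -> lowrank_split r (c * e * c') (A *m B *m D).
Proof.
move=> c0 e0 Ac Dc [X [Y [-> Xr Ye]]].
exists (A *m X *m D), (A *m Y *m D); split.
- by rewrite mulmxDr mulmxDl.
- rewrite (le_trans _ Xr)// ler_nat (leq_trans (mxrankM_maxl _ _))//.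
  exact: mxrankM_maxr.
- by apply: opboundM => //; [rewrite mulr_ge0|exact: opboundM].
Qed.

Lemma lowrank_splitMl r e c m n p (A : 'M[C]_(m, n)) (B : 'M[C]_(n, p)) :
  0 <= c -> opbound c A ->
  lowrank_split r e B -> lowrank_split r (c * e) (A *m B).
Proof.
move=> c0 Ac [X [Y [-> Xr Ye]]].
exists (A *m X), (A *m Y); split; first by rewrite mulmxDr.
- by rewrite (le_trans _ Xr)// ler_nat mxrankM_maxr.
- exact: opboundM.
Qed.

Lemma lowrank_splitZ r e (a : C) m n (A : 'M[C]_(m, n)) :
  lowrank_split r e A -> lowrank_split r (normc a * e) (a *: A).
Proof.
move=> [X [Y [-> Xr Ye]]]; exists (a *: X), (a *: Y); split.
- by rewrite scalerDr.
- by rewrite (le_trans _ Xr)// ler_nat mxrank_scale.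
- move=> x; rewrite -scalemxAl l2normE sqnormZ sqrtrM ?sqr_ge0// sqrtr_sqr.
  by rewrite ger0_norm ?normc_ge0// -mulrA ler_wpM2l ?normc_ge0//; exact: Ye.
Qed.

Lemma lowrank_splitZ1 r e (a : C) m n (A : 'M[C]_(m, n)) : normc a = 1 ->
  lowrank_split r e A -> lowrank_split r e (a *: A).
Proof. by move=> a1 /(lowrank_splitZ a); rewrite a1 mul1r. Qed.

Lemma lowrank_split_rank m n (A : 'M[C]_(m, n)) : lowrank_split (\rank A)%:R 0 A.
Proof. by exists A, 0; rewrite addr0; split => //; exact: opbound0. Qed.

End spectral_cut.

(** * Lebesgue measure on row vectors *)

Section lebesgue_rV_theory.
Context {R : realType} {d : nat}.
Local Notation mu := (@lebesgue_mu R d).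
Local Notation outer := (@lebesgue_outer R d).
Implicit Types (ab : 'rV[R]_d * 'rV[R]_d) (x : 'rV[R]_d) (l : 'I_d).

(** The half-open boxes make the two halves of a box cut by a hyperplane boxes of
    the same kind, so that cutting preserves volumes exactly. *)
Definition box_below l (c : R) ab : 'rV[R]_d * 'rV[R]_d :=
  (ab.1, \row_k (if k == l then Num.min (ab.2 ord0 k) c else ab.2 ord0 k)).

Definition box_above l (c : R) ab : 'rV[R]_d * 'rV[R]_d :=
  (\row_k (if k == l then Num.max (ab.1 ord0 k) c else ab.1 ord0 k), ab.2).

Lemma rV_box_belowE l c ab :
  rV_box (box_below l c ab) = rV_box ab `&` [set x | x ord0 l <= c].
Proof.
apply/seteqP; split=> x /= => [h|[h1 h2] k].
  split=> [k|].
    by have := h k; rewrite /= mxE; case: eqP => // _; rewrite le_min andbA => /andP[].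
  by have := h l; rewrite /= mxE eqxx le_min => /andP[_ /andP[]].
by have := h1 k; rewrite mxE; case: eqP => [->|//]; rewrite le_min h2 andbT.
Qed.

Lemma rV_box_aboveE l c ab :
  rV_box (box_above l c ab) = rV_box ab `&` ~` [set x | x ord0 l <= c].
Proof.
apply/seteqP; split=> x /= => [h|[h1 /negP]].
  split=> [k|].
    have := h k; rewrite /= mxE; case: eqP => // _.
    by rewrite gt_max -andbA => /andP[-> /andP[]].
  by apply/negP; have := h l; rewrite /= mxE eqxx gt_max -ltNge => /andP[/andP[]].
rewrite -ltNge => h2 k.
by have := h1 k; rewrite mxE; case: eqP => [->|//]; rewrite gt_max h2 andbT.
Qed.

Lemma itv_length_split (a b c : R) :
  Num.max 0 (Num.min b c - a) + Num.max 0 (b - Num.max a c) = Num.max 0 (b - a).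
Proof.
have [bc|cb] := leP b c; have [ac|ca] := leP a c.
- have -> : Num.max 0 (b - c) = 0 by apply/max_idPl; lra.
  by rewrite addr0.
- have -> : Num.max 0 (b - a) = 0 by apply/max_idPl; lra.
  by rewrite addr0.
- have -> : Num.max 0 (c - a) = c - a by apply/max_idPr; lra.
  have -> : Num.max 0 (b - c) = b - c by apply/max_idPr; lra.
  have -> : Num.max 0 (b - a) = b - a by apply/max_idPr; lra.
  by lra.
- have -> : Num.max 0 (c - a) = 0 by apply/max_idPl; lra.
  by rewrite add0r.
Qed.

Lemma rV_box_volume_split l c ab :
  rV_box_volume (box_below l c ab) + rV_box_volume (box_above l c ab) =
  rV_box_volume ab.
Proof.
rewrite /rV_box_volume (bigD1 l)//= [X in _ + X](bigD1 l)//= [RHS](bigD1 l)//=.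
rewrite !mxE !eqxx -[in RHS](itv_length_split _ _ c) mulrDl.
by congr (_ * _ + _ * _); apply: eq_bigr => k /negPf kl; rewrite !mxE kl.
Qed.

Lemma rV_box_volume_ge0 ab : 0 <= rV_box_volume ab.
Proof. by apply: prodr_ge0 => k _; rewrite le_max lexx. Qed.

Lemma le_lebesgue_outer_cover (A : set 'rV[R]_d) (D : set nat) F :
  A `<=` \bigcup_(k in D) rV_box (F k) ->
  (outer A <= \esum_(k in D) (rV_box_volume (F k))%:E)%E.
Proof. by move=> AF; apply: ereal_inf_lbound; exists (D, F). Qed.

(** Any box cover of [X] is cut by the hyperplane into covers of the two parts
    of [X] with the same total volume, which is the Caratheodory criterion. *)
Lemma measurable_halfspace l (c : R) :
  measurable ([set x | x ord0 l <= c] : set (lebesgue_rV R d)).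
Proof.
apply: le_caratheodory_measurable => X.
apply: le_ereal_inf_tmp => _ [[D F] /= XF <-].
have -> : \esum_(k in D) (rV_box_volume (F k))%:E =
  (\esum_(k in D) (rV_box_volume (box_below l c (F k)))%:E +
   \esum_(k in D) (rV_box_volume (box_above l c (F k)))%:E)%E.
  rewrite -esumD; last 2 first.
  - by move=> k _; rewrite lee_fin rV_box_volume_ge0.
  - by move=> k _; rewrite lee_fin rV_box_volume_ge0.
  by apply: eq_esum => k _; rewrite -EFinD rV_box_volume_split.
apply: leeD; apply: le_lebesgue_outer_cover => x [/XF[k Dk Fk] xc].
  by exists k => //; rewrite rV_box_belowE.
by exists k => //; rewrite rV_box_aboveE.
Qed.

(** What makes the cubes and the characters measurable; the sigma-algebra, defined by
    the Caratheodory criterion, offers no generators to argue with. *)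
Lemma measurable_coord l :
  measurable_fun setT (fun x : lebesgue_rV R d => (x : 'rV[R]_d) ord0 l).
Proof.
apply: (measurability (@measurable_realfun.RGenOInfty.G R)); first exact: measurable_realfun.RGenOInfty.measurableE.
move=> _ [_ [c ->] <-]; rewrite setTI.
have -> : (fun x : lebesgue_rV R d => (x : 'rV[R]_d) ord0 l) @^-1` `]c, +oo[%classic =
          ~` [set x | x ord0 l <= c].
  by apply/seteqP; split=> x /=; rewrite in_itv/= andbT ltNge => /negP.
exact/measurableC/measurable_halfspace.
Qed.

Lemma measurable_rV_box ab : measurable (rV_box ab : set (lebesgue_rV R d)).
Proof.
have -> : rV_box ab = \bigcap_(k in [set: 'I_d])
    ([set x | x ord0 k <= ab.2 ord0 k] `&` ~` [set x | x ord0 k <= ab.1 ord0 k]).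
  apply/seteqP; split=> x /= h k.
    by move=> _; have /andP[h1 h2] := h k; split => //=; apply/negP; rewrite -ltNge.
  by have [/= -> /negP] := h k I; rewrite -ltNge => ->.
apply: fin_bigcap_measurable => [|k _]; first exact: finite_finset.
by apply: measurableI; [|apply: measurableC]; exact: measurable_halfspace.
Qed.

Lemma lebesgue_outer_rV_box ab : (outer (rV_box ab) <= (rV_box_volume ab)%:E)%E.
Proof.
rewrite -[leRHS](@esum_set1 _ _ 0%N (fun=> (rV_box_volume ab)%:E)); last first.
  by rewrite lee_fin rV_box_volume_ge0.
by apply: le_lebesgue_outer_cover => x xab; exists 0%N.
Qed.

(** For a null set the Caratheodory criterion reduces to monotonicity: the measure is
    complete. *)
Lemma outer0_measurable (A : set 'rV[R]_d) : outer A = 0%E ->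
  measurable (A : set (lebesgue_rV R d)).
Proof.
move=> A0; apply: le_caratheodory_measurable => X.
rewrite [X in (X + _)%E](_ : _ = 0%E) ?add0e.
  by apply: le_outer_measure; apply: subIsetl.
apply/eqP; rewrite eq_le outer_measure_ge0 andbT -A0.
by apply: le_outer_measure; apply: subIsetr.
Qed.

Lemma negligible_outer0 (A : set 'rV[R]_d) : mu.-negligible A <-> outer A = 0%E.
Proof.
split=> [[B [mB B0 AB]]|A0]; last by exists A; split => //; exact: outer0_measurable.
apply/eqP; rewrite eq_le outer_measure_ge0 andbT -B0.
exact: le_outer_measure.
Qed.

End lebesgue_rV_theory.

Section translation.
Context {R : realType} {d : nat}.
Local Notation mu := (@lebesgue_mu R d).
Local Notation outer := (@lebesgue_outer R d).

(** Translating a box cover preserves its volumes; one inequality suffices, as the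
    opposite translation gives the other. *)
Lemma lebesgue_outer_translate (h : 'rV[R]_d) (A : set 'rV[R]_d) :
  outer ((fun x => x + h) @^-1` A) = outer A.
Proof.
suff le (h' : 'rV[R]_d) (B : set 'rV[R]_d) : (outer ((fun x => x + h')%R @^-1` B) <= outer B)%E.
  apply/eqP; rewrite eq_le le /=.
  rewrite [X in (outer X <= _)%E](_ : A =
    (fun x => x + - h)%R @^-1` ((fun x => x + h)%R @^-1` A)) ?le//.
  by apply/seteqP; split => x /=; rewrite subrK.
apply: le_ereal_inf_tmp => _ [[D F] /= BF <-].
pose G k := ((F k).1 - h', (F k).2 - h').
rewrite (eq_esum (b := fun k => (rV_box_volume (G k))%:E)); last first.
  move=> k _; congr (_%:E); apply: eq_bigr => l _.
  by rewrite !mxE opprD opprK addrACA addNr addr0.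
apply: le_lebesgue_outer_cover => x /= /BF[k Dk Fk]; exists k => // l.
by have := Fk l; rewrite !mxE ltrBlDr lerBrDr.
Qed.

Lemma measurable_translate (h : 'rV[R]_d) :
  measurable_fun setT ((fun x => x + h) : lebesgue_rV R d -> lebesgue_rV R d).
Proof.
move=> _ Y mY; rewrite setTI.
suff : caratheodory_measurable outer ((fun x => x + h) @^-1` Y) by [].
have {}mY : caratheodory_measurable outer Y by [].
move=> X.
have XE : X = (fun x => x + h) @^-1` ((fun x => x + - h) @^-1` X).
  by apply/seteqP; split => x /=; rewrite addrK.
rewrite {1}XE [LHS]lebesgue_outer_translate (mY ((fun x => x + - h) @^-1` X)).
congr (_ + _)%E; rewrite -[LHS](lebesgue_outer_translate h) preimage_setI.
  by rewrite -XE.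
by rewrite -XE preimage_setC.
Qed.

Lemma integral_translate (h : 'rV[R]_d) (D : set (lebesgue_rV R d))
    (f : lebesgue_rV R d -> \bar R) :
  measurable D -> measurable_fun setT f ->
  mu.-integrable ((fun x : lebesgue_rV R d => (x : 'rV[R]_d) + h)%R @^-1` D)
    (fun x => f ((x : 'rV[R]_d) + h)%R) ->
  (\int[mu]_(x in D) f x =
   \int[mu]_(x in (fun x : lebesgue_rV R d => (x : 'rV[R]_d) + h)%R @^-1` D)
     f ((x : 'rV[R]_d) + h)%R)%E.
Proof.
move=> mD mf fi; rewrite -(integral_pushforward (measurable_translate h) mf fi mD).
apply: eq_measure_integral => [|A mA AD]; first exact: measurable_translate.
by rewrite /pushforward -[LHS](lebesgue_outer_translate h).
Qed.

End translation.

Section null_sets.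
Context {R : realType}.

Lemma outer_eq0 d (A : set 'rV[R]_d) :
  (forall e : R, 0 < e -> (lebesgue_outer A <= e%:E)%E) -> lebesgue_outer A = 0%E.
Proof.
move=> h; apply/eqP; rewrite eq_le outer_measure_ge0 andbT.
by apply/lee_addgt0Pr => e e0; rewrite add0e; exact: h.
Qed.

(** A bounded piece of a hyperplane fits into boxes of arbitrarily small thickness. *)
Lemma outer_hyperplane0 d (l : 'I_d) (c : R) ab (A : set 'rV[R]_d) :
  A `<=` rV_box ab -> (forall x, A x -> x ord0 l = c) -> lebesgue_outer A = 0%E.
Proof.
move=> Aab Ac; apply: outer_eq0 => e e0.
pose M := \prod_(k < d | k != l) Num.max 0 (ab.2 ord0 k - ab.1 ord0 k).
have M0 : 0 <= M by apply: prodr_ge0 => k _; rewrite le_max lexx.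
(* The thickness: [M] is the volume of the section of the box. *)
pose h := e / (M + 1); have h0 : 0 < h by rewrite divr_gt0// ltr_wpDl.
pose b := (\row_k (if k == l then c - h else ab.1 ord0 k),
           \row_k (if k == l then c else ab.2 ord0 k)) : 'rV[R]_d * 'rV[R]_d.
have -> : e%:E = (h * (M + 1))%:E by rewrite divfK// gt_eqF// ltr_wpDl.
apply: (@le_trans _ _ (lebesgue_outer (rV_box b))).
  apply: le_outer_measure => x Ax k /=; rewrite !mxE; case: eqP => [->|_].
    by rewrite Ac// lexx andbT ltrBlDr ltrDl.
  exact: Aab.
apply: (le_trans (lebesgue_outer_rV_box _)); rewrite lee_fin /rV_box_volume.
rewrite (bigD1 l)//= !mxE eqxx opprB addrC subrK; apply: ler_pM => //.
- by rewrite le_max lexx.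
- by apply: prodr_ge0 => k _; rewrite le_max lexx.
- by rewrite ge_max lexx ltW.
rewrite [leLHS](_ : _ = M); first by rewrite lerDl.
by apply: eq_bigr => k /negPf kl; rewrite !mxE kl.
Qed.

Lemma le_esumZ (D : set nat) (a : nat -> R) (K : R) : 0 <= K ->
  (forall k, 0 <= a k) ->
  (\esum_(k in D) (a k * K)%:E <= (\esum_(k in D) (a k)%:E) * K%:E)%E.
Proof.
move=> K0 a0; apply: ge_ereal_sup => _ [X XD <-].
rewrite (eq_fsbigr (fun k => ((a k)%:E * K%:E)%E)) => [|k _]; last first.
  by rewrite EFinM.
rewrite -ge0_mule_fsuml; last by move=> k; rewrite lee_fin.
rewrite lee_wpmul2r ?lee_fin//; apply: ereal_sup_ubound; exists X => //.
Qed.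

(** Multiplying all the boxes of a cover of [A] of small volume by one fixed box
    gives a cover of small volume again. *)
Lemma outer_prod0 d1 d2 (A : set 'rV[R]_d1) ab : lebesgue_outer A = 0%E ->
  lebesgue_outer [set z : 'rV[R]_(d1 + d2) | A (lsubmx z) /\
    rV_box ab (rsubmx z)] = 0%E.
Proof.
move=> A0; apply: outer_eq0 => e e0.
pose K := rV_box_volume ab; have K0 : 0 <= K by exact: rV_box_volume_ge0.
have h0 : 0 < e / (K + 1) by rewrite divr_gt0// ltr_wpDl.
have [|_ [[D F] /= AF <-]] := @lb_ereal_inf_adherent _
  [set \esum_(k in DF.1) (rV_box_volume (DF.2 k))%:E | DF in rV_box_cover A] _ h0.
  by rewrite [ereal_inf _]A0.
rewrite [ereal_inf _]A0 add0e => Fe.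
pose G k := (row_mx (F k).1 ab.1, row_mx (F k).2 ab.2).
have GE k : rV_box_volume (G k) = rV_box_volume (F k) * K.
  rewrite /rV_box_volume big_split_ord /=; congr (_ * _); apply: eq_bigr => l _.
    by rewrite !row_mxEl.
  by rewrite !row_mxEr.
apply: (@le_trans _ _ (\esum_(k in D) (rV_box_volume (G k))%:E)).
  apply: le_lebesgue_outer_cover => z [/= /AF[k Dk Fk] zab]; exists k => // l /=.
  case: (split_ordP l) => j ->.
    by rewrite !row_mxEl; have := Fk j; rewrite mxE.
  by rewrite !row_mxEr; have := zab j; rewrite mxE.
rewrite (eq_esum (b := fun k => (rV_box_volume (F k) * K)%:E)) => [|k _]; last first.
  by rewrite GE.
apply: (le_trans (le_esumZ _ K0 _)) => [k|]; first exact: rV_box_volume_ge0.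
apply: (@le_trans _ _ ((e / (K + 1))%:E * K%:E)%E).
  by rewrite lee_wpmul2r ?lee_fin// ltW.
rewrite -EFinM lee_fin mulrAC ler_pdivrMr ?ltr_wpDl// ler_wpM2l ?lerDl//.
exact: ltW.
Qed.

(** An open set is the countable union of the boxes with rational corners that it
    contains. *)
Lemma open_measurable_rV d (U : set 'rV[R]_d) : open U ->
  measurable (U : set (lebesgue_rV R d)).
Proof.
move=> oU.
pose q (p : 'rV[rat]_d * 'rV[rat]_d) : 'rV[R]_d * 'rV[R]_d :=
  (map_mx ratr p.1, map_mx ratr p.2).
pose V p := if pselect (rV_box (q p) `<=` U) then rV_box (q p) else set0.
have -> : U = \bigcup_p V p.
  apply/seteqP; split=> [x Ux|x [p _]]; last first.
    by rewrite /V; case: pselect => [h|_ //]; exact: h.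
  have /nbhs_ballP[e /= e0 xe] : nbhs x U by exact: open_nbhs_nbhs.
  have /(_ _)/cid-/all_sig[a aP] k : exists q : rat, ratr q \in `]x ord0 k - e, x ord0 k[.
    by apply: rat_in_itvoo; rewrite ltrBlDr ltrDl.
  have /(_ _)/cid-/all_sig[b bP] k : exists q : rat, ratr q \in `]x ord0 k, x ord0 k + e[.
    by apply: rat_in_itvoo; rewrite ltrDl.
  exists (\row_k a k, \row_k b k) => //; rewrite /V; case: pselect => [_|[]] k /=.
    rewrite !mxE; have := aP k; have := bP k; rewrite !in_itv /=.
    by move=> /andP[/ltW -> _] /andP[_ ->].
  move=> kP; apply: xe; split=> [//|i j]; rewrite ord1 /ball/=.
  have := aP j; have := bP j; rewrite !in_itv /= => /andP[_ bj] /andP[aj _].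
  have := kP j; rewrite !mxE => /andP[h1 h2].
  by rewrite ltr_distl; apply/andP; split; lra.
apply: countable_bigcupT_measurable => [|p]; first exact: countableP.
by rewrite /V; case: (pselect (rV_box (q p) `<=` U)) => ?; [exact: measurable_rV_box|exact: measurable0].
Qed.

End null_sets.

(** * Counting grid points *)

Section mixed_radix.
Context {d : nat}.
Implicit Types n : 'I_d -> nat.

Let radix n (k : nat) := (\prod_(l < d | (k <= l)%N) n l)%N.

Let radixS n (k : 'I_d) : radix n k = (n k * radix n k.+1)%N.
Proof.
rewrite /radix (bigD1 k)//=; congr muln; apply: eq_bigl => l.
by rewrite ltn_neqAle andbC eq_sym -val_eqE.
Qed.

(** Two numbers with the same mixed radix digits agree modulo the product of the
    last [j] radices, by induction on [j], hence modulo the product of all of them,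
    which exceeds both. *)
Lemma mindex_inj n (r r' : 'I_(msize n)) :
  (forall k, mindex r k = mindex r' k) -> r = r'.
Proof.
move=> rr'; apply/val_inj => /=.
suff h j : (j <= d)%N -> (r = r' %[mod radix n (d - j)])%N.
  have := h d (leqnn _); rewrite subnn.
  have -> : radix n 0 = msize n by apply: eq_bigl => l.
  by rewrite !modn_small.
elim: j => [|j IH] jd.
  by rewrite subn0 /radix big1 ?modn1// => l; rewrite leqNgt ltn_ord.
have kd : (d - j.+1 < d)%N by rewrite ltn_subrL (leq_trans _ jd).
pose k := Ordinal kd; have := IH (ltnW jd).
have -> : (d - j = k.+1)%N by rewrite /= subnSK.
rewrite -[(d - j.+1)%N]/(nat_of_ord k) radixS => rr'q.
have := rr' k => -[]; rewrite !modn_divl -/(radix n k.+1) => rr'k.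
rewrite (divn_eq (r %% _) (radix n k.+1)) rr'k modn_dvdm ?dvdn_mull//.
rewrite rr'q -(modn_dvdm _ (dvdn_mull (n k) (dvdnn (radix n k.+1)))).
by rewrite -divn_eq.
Qed.

Lemma mindex_range n (r : 'I_(msize n)) k : (0 < mindex r k <= n k)%N.
Proof.
rewrite /mindex /= ltn_mod lt0n; apply/negP => /eqP nk0.
by case: r => r; rewrite /msize (bigD1 k)//= nk0 mul0n.
Qed.

(** Multi-indices embed the rank [r] into a product, of which a condition on each
    component cuts out a product subset. *)
Lemma card_mindex_le n (P : 'I_d -> pred nat) :
  (#|[pred r : 'I_(msize n) | [forall k, P k (mindex r k)]]| <=
   \prod_k count (P k) (iota 1 (n k)))%N.
Proof.
pose M := (\max_k n k)%N.
have nM k : (n k <= M)%N by exact: (leq_bigmax k).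
pose f (r : 'I_(msize n)) : {ffun 'I_d -> 'I_M.+1} :=
  [ffun k => inord (mindex r k)].
have fE r k : f r k = mindex r k :> nat.
  rewrite ffunE inordK// ltnS (leq_trans _ (nM k))//.
  by have /andP[] := mindex_range r k.
have f_inj : injective f.
  by move=> r r' /ffunP ff; apply: mindex_inj => k; rewrite -!fE ff.
pose F k : pred 'I_M.+1 := [pred i : 'I_M.+1 | (0 < i <= n k)%N && P k i].
rewrite -(fintype.card_image f_inj) (@leq_trans #|family F|)//.
  apply: subset_leq_card; apply/fintype.subsetP => _ /fintype.imageP[r /forallP Pr ->].
  by apply/familyP => k; rewrite !inE fE Pr mindex_range.
rewrite card_family foldrE big_map big_enum /= leq_prod// => k _.
rewrite -size_filter cardE -(size_map val) uniq_leq_size//.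
  by rewrite map_inj_uniq ?enum_uniq//; exact: val_inj.
move=> _ /mapP[i + ->]; rewrite mem_enum inE => /andP[/andP[i0 ni] Pi].
by rewrite mem_filter Pi mem_iota i0 add1n ltnS.
Qed.

Lemma mindex_min_le n k : (mindex_min n <= n k)%N.
Proof.
rewrite /mindex_min; move: (\max_k n k)%N => m.
have : k \in index_enum 'I_d by rewrite mem_index_enum.
elim: (index_enum _) => // l s IH; rewrite inE big_cons => /orP[/eqP <-|/IH h].
  exact: geq_minl.
exact: leq_trans (geq_minr _ _) h.
Qed.

End mixed_radix.

Section grid.
Context {R : realType} {d : nat}.
Variables (J : set nat) (nn : nat -> 'I_d -> nat).
Hypothesis nn_infty : mindex_to_infty J nn.

Lemma near_nn_ge (M : nat) :
  \forall n \near within J \oo, forall k, (M <= nn n k)%N.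
Proof.
have : \forall m \near \oo, (M <= m)%N by exists M.
move=> /nn_infty h.
have {h} : \forall n \near within J \oo, (M <= mindex_min (nn n))%N by exact: h.
by apply: filterS => n Mn k; exact: leq_trans Mn (mindex_min_le _ _).
Qed.

Lemma near_nn_inv (e : R) : 0 < e ->
  \forall n \near within J \oo, forall k, (0 < nn n k)%N /\ (nn n k)%:R^-1 <= e.
Proof.
move=> e0; apply: filterS (near_nn_ge (Num.truncn e^-1).+1) => n h k.
have n0 : (0 < nn n k)%N by exact: leq_trans (h k).
split => //; rewrite -[e]invrK lef_pV2 ?posrE ?invr_gt0 ?ltr0n//.
by rewrite (le_trans (ltW (truncnS_gt _)))// ler_nat h.
Qed.

Lemma grid_point_cube n (r : 'I_(msize n)) : unit_cube d (grid_point r : 'rV[R]_d).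
Proof.
move=> k; rewrite mxE divr_ge0//= ler_pdivrMr ?mul1r ?ler_nat ?ltr0n.
  by have /andP[] := mindex_range r k.
by have /andP[] := mindex_range r k; exact: leq_trans.
Qed.

Lemma le_grid_count n (A B : set 'rV[R]_d) : A `&` unit_cube d `<=` B ->
  (grid_count n A <= grid_count n B)%N.
Proof.
move=> AB; apply: subset_leq_card; apply/fintype.subsetP => r; rewrite !inE => Ar.
by apply: AB; split => //; exact: grid_point_cube.
Qed.

Lemma grid_count_cover n (U : set 'rV[R]_d) (s : seq nat) (O : nat -> set 'rV[R]_d) :
  U `<=` [set x | exists2 k, k \in s & O k x] ->
  (grid_count n U <= \sum_(k <- s) grid_count n (O k))%N.
Proof.
elim: s U => [|k s IH] U UO.
  rewrite big_nil leqn0; apply/eqP/eq_card0 => r; rewrite !inE; apply/negP.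
  by rewrite inE => /UO[].
rewrite big_cons (@leq_trans (grid_count n (O k) + grid_count n (U `\` O k)))//.
  rewrite -cardUI; apply: (leq_trans _ (leq_addr _ _)).
  apply: subset_leq_card; apply/fintype.subsetP => r; rewrite !inE => Ur.
  apply/orP.
  by have [?|?] := pselect (O k (grid_point r)); [left|right]; rewrite inE.
rewrite leq_add2l; apply: IH => x [/UO[j]].
by rewrite inE => /orP[/eqP ->//|js Oj _]; exists j.
Qed.

(** The integers in an open interval lie between the least and the greatest of
    them, whose difference is at most the length. *)
Lemma count_itv_le (a b : R) (m : nat) :
  (count (fun i => a < i%:R < b)%R (iota 1 m))%:R <= Num.max 0 (b - a) + 1.
Proof.
rewrite -size_filter; set s := (X in (size X)%:R).
have s_uniq : uniq s by rewrite filter_uniq// iota_uniq.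
have sP i : i \in s -> a < i%:R < b by rewrite mem_filter => /andP[].
have [exs|s0] := pselect (exists i, i \in s); last first.
  have -> : s = [::] by case: (s) s0 => // x ? []; exists x; rewrite inE eqxx.
  by rewrite addr_ge0// le_max lexx.
have bs i : i \in s -> (i <= m)%N.
  by rewrite mem_filter mem_iota add1n ltnS => /and3P[].
have [j js jmin] := ex_minnP exs; have [k ks kmax] := ex_maxnP exs bs.
have : (size s <= size (iota j (k - j).+1))%N.
  apply: uniq_leq_size => // i si; rewrite mem_iota jmin//= addnS ltnS.
  by rewrite subnKC ?kmax// jmin.
rewrite size_iota -(@ler_nat R) => /le_trans -> //.
rewrite -addn1 natrD lerD2r natrB ?jmin// le_max; apply/orP; right.
have /andP[aj _] := sP _ js; have /andP[_ kb] := sP _ ks.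
by rewrite lerB// ltW.
Qed.

(** Continuity of a product in all its factors at once; it provides the room both
    for enlarging a half-open box to an open one and for the rounding errors in
    counting grid points. *)
Lemma near_prod_shift I (s : seq I) (w : I -> R) (e : R) : 0 < e ->
  exists2 t : R, 0 < t & \prod_(i <- s) (w i + t) <= \prod_(i <- s) w i + e.
Proof.
move=> e0.
have : \prod_(i <- s) (w i + t) @[t --> 0^'+] --> \prod_(i <- s) (w i + 0).
  apply: cvg_big => [|i _]; first exact: mul_continuous.
  apply: cvgD; first exact: cvg_cst.
  by apply: cvg_at_right_filter; exact: cvg_id.
under [X in _ --> X]eq_bigr do rewrite addr0.
move/cvgrPdist_le => /(_ e e0) h.
have : \forall t \near (0:R)^'+, 0 < t /\ \prod_(i <- s) (w i + t) <= \prod_(i <- s) w i + e.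
  near=> t; split; first by near: t; exact: nbhs_right_gt.
  have : `|\prod_(i <- s) w i - \prod_(i <- s) (w i + t)| <= e by near: t.
  by rewrite ler_norml => /andP[]; lra.
by move=> /filter_ex[t []]; exists t.
Unshelve. all: by end_near. Qed.

(** In direction [k] an interval of length [w] contains at most [n_k w + 1] of
    the [n_k] grid coordinates, that is a proportion [w + 1 / n_k]; for large
    indices the product of these proportions is close to the volume. *)
Lemma box_cover_open (ab : 'rV[R]_d * 'rV[R]_d) (e : R) : 0 < e ->
  exists O, [/\ open O, rV_box ab `<=` O &
    \forall n \near within J \oo,
      (grid_count (nn n) O)%:R <= (rV_box_volume ab + e) * (msize (nn n))%:R].
Proof.
move=> e0; pose w k := Num.max 0 (ab.2 ord0 k - ab.1 ord0 k).
have w0 k : 0 <= w k by rewrite le_max lexx.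
(* Half of [t] pays for the enlargement by [q] on both sides, half for rounding. *)
have [t t0 te] := near_prod_shift (index_enum 'I_d) w e0.
pose q := t / 4; have q0 : 0 < q by rewrite divr_gt0.
exists [set x : 'rV[R]_d | forall k, ab.1 ord0 k - q < x ord0 k < ab.2 ord0 k + q]; split.
- rewrite openE => x xO; apply/nbhs_ballP.
  pose m := \big[Num.min/1]_k Num.min (x ord0 k - (ab.1 ord0 k - q))
    (ab.2 ord0 k + q - x ord0 k).
  exists m => /=.
    apply: lt_bigmin => // k _; rewrite lt_min !subr_gt0.
    by have /andP[-> ->] := xO k.
  move=> y [_ xy] k; have := xy ord0 k; rewrite /ball /= => h.
  have : m <= Num.min (x ord0 k - (ab.1 ord0 k - q)) (ab.2 ord0 k + q - x ord0 k).
    exact: bigmin_le_cond.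
  rewrite le_min => /andP[h1 h2]; move: h; rewrite ltr_norml => /andP[h3 h4].
  by apply/andP; split; lra.
- move=> x h k; have /andP[h1 h2] := h k.
  by apply/andP; split; lra.
have t2 : 0 < t / 2 by rewrite divr_gt0.
apply: filterS (near_nn_inv t2) => n hn.
pose P k i :=
  ((nn n k)%:R * (ab.1 ord0 k - q) < (i%:R : R) < (nn n k)%:R * (ab.2 ord0 k + q))%R.
have -> : grid_count (nn n) [set x : 'rV[R]_d | forall k, ab.1 ord0 k - q < x ord0 k < ab.2 ord0 k + q] =
  #|[pred r : 'I_(msize (nn n)) | [forall k, P k (mindex r k)]]|.
  apply: eq_card => r; rewrite !inE; apply/idP/forallP.
    rewrite inE /= => h k; have := h k; rewrite /P mxE.
    by rewrite ltr_pdivlMr ?ltr_pdivrMr ?ltr0n ?(hn k).1// ![_ * (nn n k)%:R]mulrC.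
  move=> h; rewrite inE => k; have := h k; rewrite /P mxE.
  by rewrite ltr_pdivlMr ?ltr_pdivrMr ?ltr0n ?(hn k).1// ![_ * (nn n k)%:R]mulrC.
apply: (@le_trans _ _ (\prod_k (count (P k) (iota 1 (nn n k)))%:R)).
  by rewrite -natr_prod ler_nat; exact: card_mindex_le.
apply: (@le_trans _ _ ((\prod_k (w k + t)) * (msize (nn n))%:R)); last first.
  by rewrite ler_wpM2r.
rewrite /msize natr_prod -big_split /=; apply: ler_prod => k _; rewrite ler0n /=.
apply: (le_trans (count_itv_le _ _ _)).
have [n0 nt] := hn k; have n0' : 0 < (nn n k)%:R :> R by rewrite ltr0n.
rewrite -[X in _ + X](@mulVf _ (nn n k)%:R) ?gt_eqF// -mulrBr.
have -> : Num.max 0 ((nn n k)%:R * (ab.2 ord0 k + q - (ab.1 ord0 k - q))) =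
   (Num.max 0 (ab.2 ord0 k + q - (ab.1 ord0 k - q))) * (nn n k)%:R.
  by rewrite [RHS]mulrC maxr_pMr ?ltW// mulr0.
rewrite -mulrDl ler_pM2r//.
have : Num.max 0 (ab.2 ord0 k + q - (ab.1 ord0 k - q)) <= w k + 2 * q.
  rewrite ge_max; apply/andP; split.
    by rewrite addr_ge0// mulr_ge0// ltW.
  have : ab.2 ord0 k - ab.1 ord0 k <= w k by rewrite le_max lexx orbT.
  by lra.
by rewrite /q in q0 *; lra.
Qed.

(** Only finitely many of the open boxes around a cover of small total volume are
    needed, and each of them contains eventually at most its share of grid points. *)
Lemma null_cover_open (K : set 'rV[R]_d) : compact K -> lebesgue_outer K = 0%E ->
  forall e : R, 0 < e -> exists U, [/\ open U, K `<=` U &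
    \forall n \near within J \oo,
      (grid_count (nn n) U)%:R <= e * (msize (nn n))%:R].
Proof.
move=> cK K0 e e0; have e2 : 0 < e / 2 by rewrite divr_gt0.
have [|_ [[D F] /= KF <-]] := @lb_ereal_inf_adherent _
  [set \esum_(k in DF.1) (rV_box_volume (DF.2 k))%:E | DF in rV_box_cover K] _ e2.
  by rewrite [ereal_inf _]K0.
rewrite [ereal_inf _]K0 add0e => Fe.
(* The share of the [k]-th box, enlarged so that the total grows by [e / 2]. *)
pose v k := rV_box_volume (F k) + (e / 2) / (2 ^ k.+1)%:R.
have ek0 k : 0 < (e / 2) / (2 ^ k.+1)%:R by rewrite divr_gt0// ltr0n expn_gt0.
pose good k V := [/\ open V, rV_box (F k) `<=` V &
  \forall n \near within J \oo,
    (grid_count (nn n) V)%:R <= v k * (msize (nn n))%:R].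
have [V VP] : {V & forall k, good k (V k)}.
  by apply: (@choice _ _ good) => k; exact: box_cover_open.
have [s [s_uniq sD Ks]] : exists s : seq nat,
    [/\ uniq s, [set` s] `<=` D & K `<=` \bigcup_(k in [set` s]) V k].
  have := cK; rewrite compact_cover => /(_ nat D V)[].
  - by move=> k _; have [] := VP k.
  - by move=> x /KF[k Dk Fx]; exists k => //; have [_ /(_ x Fx)] := VP k.
  move=> D' D'D KD'; exists (finmap.enum_fset D').
  split; [exact: finmap.fset_uniq| |exact: KD'].
  by move=> k /= /D'D; rewrite inE.
exists (\bigcup_(k in [set` s]) V k); split => //.
  by apply: bigcup_open => k _; have [] := VP k.
have sumv : \sum_(k <- s) v k <= e.
  have vE k : (v k)%:E = ((rV_box_volume (F k))%:E + ((e / 2) / (2 ^ k.+1)%:R)%:E)%E by [].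
  have v0 k : (0 <= (v k)%:E)%E.
    by rewrite lee_fin addr_ge0 ?rV_box_volume_ge0// ltW.
  have vol0 k : (0 <= (rV_box_volume (F k))%:E)%E by rewrite lee_fin rV_box_volume_ge0.
  have DE : D = [set x | x \in D] by apply/seteqP; split => x /=; rewrite inE.
  rewrite -lee_fin -sumEFin; apply: (@le_trans _ _ (\esum_(k in D) (v k)%:E)).
    apply: esum_ge; exists [set` s]; first by split => //; exact: finite_seq.
    by rewrite -fsbig_seq.
  rewrite {1}DE -nneseries_esum => [|k _]; last exact: v0.
  under eq_eseriesr do rewrite vE.
  apply: (le_trans (epsilon_trick (mem D) vol0 (ltW e2))).
  rewrite nneseries_esum => [|k _]; last exact: vol0.
  by rewrite -DE [e in leRHS]splitr EFinD leeD2r// ltW.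
have : \forall n \near within J \oo, forall k, k \in s ->
    (grid_count (nn n) (V k))%:R <= v k * (msize (nn n))%:R.
  elim: (s) => [|k s' IH]; first by near=> n => k.
  have [_ _ Vk] := VP k.
  near=> n => j; rewrite inE => /orP[/eqP ->|]; first by near: n; exact: Vk.
  by move: j; near: n; exact: IH.
apply: filterS => n hn.
apply: (@le_trans _ _ (\sum_(k <- s) grid_count (nn n) (V k))%:R).
  rewrite ler_nat; apply: grid_count_cover => x [k ks Vx]; exists k => //.
rewrite natr_sum.
apply: (@le_trans _ _ (\sum_(k <- s) v k * (msize (nn n))%:R)).
  by rewrite !big_seq; exact: ler_sum.
by rewrite -mulr_suml ler_wpM2r.
Unshelve. all: by end_near. Qed.

Lemma unit_cube_compact : compact (unit_cube d : set 'rV[R]_d).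
Proof.
have -> : unit_cube d = [set x : 'rV[R]_d | forall k, `[0, 1]%classic (x ord0 k)].
  by apply/seteqP; split => x /= h k; have := h k; rewrite /= in_itv.
by apply: (@rV_compact R d (fun=> `[0, 1]%classic)) => k; exact: segment_compact.
Qed.

(** The points without a good neighbourhood form a compact null set, and outside
    an open set around it compactness makes the property hold simultaneously.
    Used with a bound tending to infinity (for local boundedness) and with a
    radius tending to 0 (for the distance to the boundary of a set). *)
Lemma near_sparse_bad (I : Type) (F : set_system I) (P : I -> 'rV[R]_d -> Prop) :
  Filter F ->
  {ae @lebesgue_mu R d, forall x : 'rV[R]_d, unit_cube d x ->
    \forall x' \near x & i \near F, unit_cube d x' -> P i x'} ->
  forall e : R, 0 < e -> \forall i \near F, \forall n \near within J \oo,
    (grid_count (nn n) [set x | ~ P i x])%:R <= e * (msize (nn n))%:R.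
Proof.
move=> FF aeP e e0.
pose N : set 'rV[R]_d :=
  [set x | \forall x' \near x & i \near F, unit_cube d x' -> P i x'].
have oN : open N.
  rewrite openE => x [[A B] /= [xA FB] AB].
  apply: filterS (nbhs_interior xA) => y yA.
  by exists (A, B).
pose S : set 'rV[R]_d := unit_cube d `&` ~` N.
have cS : compact S.
  have -> : S = unit_cube d `&` ~` N by [].
  apply: compact_closedI; first exact: unit_cube_compact.
  exact: open_closedC.
have S0 : lebesgue_outer S = 0%E.
  apply/negligible_outer0; apply: negligibleS aeP => x [cx Nx] /= h.
  exact/Nx/h.
have [U [oU SU hU]] := null_cover_open cS S0 e0.
have cK : compact ((unit_cube d : set 'rV[R]_d) `\` U).
  rewrite setDE; apply: compact_closedI; first exact: unit_cube_compact.
  exact: open_closedC.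
move/compact_near_coveringP : cK.
move=> /(_ I F (fun i x => unit_cube d x -> P i x) FF) h.
have : \near F, ((unit_cube d : set 'rV[R]_d) `\` U) `<=` (fun x => unit_cube d x -> P F x).
  apply: h => x [cx Ux]; apply: contrapT => Nx; apply: Ux; apply: SU.
  by split.
apply: filterS => i hi; apply: filterS hU => n; apply: le_trans.
rewrite ler_nat; apply: le_grid_count => x /= [Px cx].
by apply: contrapT => Ux; apply: Px; exact: hi.
Qed.

End grid.

Section boundary_crossing.
Context {R : realType} {d : nat}.
Variables (J : set nat) (nn : nat -> 'I_d -> nat).
Hypothesis nn_infty : mindex_to_infty J nn.

Lemma near_not_boundary (Om : set 'rV[R]_d) x :
  ~ (closure Om `\` Om°) x -> \forall y \near x, Om y <-> Om x.
Proof.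
move=> nb; have [xi|xi] := pselect (Om° x).
  have Ox : Om x by exact: interior_subset.
  by apply: filterS xi => y Oy; split.
have nc : ~ closure Om x by move=> c; apply: nb.
have : (~` closure Om) x by [].
rewrite -interiorC => h.
have nOx : ~ Om x by exact: (interior_subset h).
by apply: filterS h => y Oy; split.
Qed.

(** If a shift of length less than [h] carries a point across the boundary, then
    membership in the set is not constant on the ball of radius [h] around it.
    Off the boundary every point has a neighbourhood of points for which small
    balls do not meet both sides, so that [near_sparse_bad] applies. *)
Lemma near_shift_crossing (Om : set 'rV[R]_d) (k : 'I_d -> int) (e : R) :
  lebesgue_outer (closure Om `\` Om°) = 0%E -> 0 < e ->
  \forall n \near within J \oo,
   #|[pred r : 'I_(msize (nn n)) | [exists r' : 'I_(msize (nn n)),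
       [forall l, (mindex r l)%:Z - (mindex r' l)%:Z == k l] &&
       ((grid_point r \in Om) != (grid_point r' \in Om))]]|%:R <=
   e * (msize (nn n))%:R.
Proof.
move=> Om0 e0.
(* Membership in [Om] does not change within distance [h] of [x]. *)
pose P (h : R) (x : 'rV[R]_d) := forall y : 'rV[R]_d, ball x h y -> (Om y <-> Om x).
have aeP : {ae @lebesgue_mu R d, forall x : 'rV[R]_d, unit_cube d x ->
    \forall x' \near x & h \near 0^'+, unit_cube d x' -> P h x'}.
  move/negligible_outer0: Om0; apply: negligibleS => x /= h.
  apply: contrapT => /near_not_boundary/nbhs_ballP[t /= t0 xt]; apply: h => _.
  exists (ball x (t / 2), [set h : R | h < t / 2]).
    split => /=; first by apply: nbhsx_ballx; rewrite divr_gt0.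
    by apply: nbhs_right_lt; rewrite divr_gt0.
  move=> [x' h] /= [xx' ht] _ y x'y.
  have xt' : ball x t x' by apply: le_ball xx'; lra.
  rewrite (xt _ xt'); apply: xt; rewrite [t]splitr.
  by apply: (ball_triangle xx'); apply: le_ball x'y; exact: ltW.
have := near_sparse_bad nn_infty _ aeP e0.
move=> nPh.
have [h [h0 hP]] : exists h : R, 0 < h /\ \forall n \near within J \oo,
    (grid_count (nn n) [set x | ~ P h x])%:R <= e * (msize (nn n))%:R.
  apply: (@filter_ex _ (0:R)^'+); near=> h; split.
    by near: h; exact: nbhs_right_gt.
  by near: h; exact: nPh.
pose M := \sum_l `|(k l)%:~R : R|.
have M0 : 0 <= M by apply: sumr_ge0.
have hM : 0 < h / (M + 1) by rewrite divr_gt0// ltr_wpDl.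
apply: filterS2 hP (near_nn_inv nn_infty hM) => n hP hn.
apply: le_trans hP; rewrite ler_nat.
apply: subset_leq_card; apply/fintype.subsetP => r; rewrite !inE.
move=> /existsP[r' /andP[/forallP rr' cross]] /= Pr.
have /Pr Orr' : ball (grid_point r : 'rV[R]_d) h (grid_point r').
  split => // i l; rewrite /ball /= !mxE -mulrBl normrM.
  have [n0 nh] := hn l; have n0' : 0 < (nn n l)%:R :> R by rewrite ltr0n.
  rewrite [`|_^-1|]gtr0_norm ?invr_gt0//.
  have -> : (mindex r l)%:R - (mindex r' l)%:R = (k l)%:~R :> R.
    by rewrite -(eqP (rr' l)) intrB.
  have kM : `|(k l)%:~R : R| <= M.
    by rewrite /M (bigD1 l)//= lerDl sumr_ge0.
  apply: (@le_lt_trans _ _ (M * (h / (M + 1)))).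
    by apply: ler_pM => //; rewrite invr_ge0 ltW.
  by rewrite mulrCA gtr_pMr// ltr_pdivrMr ?mul1r ?ltrDl// ltr_wpDl.
by move: cross; rewrite (_ : (grid_point r \in Om) = (grid_point r' \in Om)) ?eqxx//;
  apply/idP/idP; rewrite !inE; apply Orr'.
Unshelve. all: by end_near. Qed.

End boundary_crossing.

(** * Fourier analysis on the frequency cube *)

Section cintegral.
Context {R : realType} {d : nat}.
Local Notation C := R[i].
Local Notation mu := (@lebesgue_mu R d).
Local Notation Q := (freq_cube d : set 'rV[R]_d).
Local Notation CI := (cintegral Q).
Implicit Types (f g : 'rV[R]_d -> C) (k : 'I_d -> int).

Lemma freq_cube_sub_box :
  Q `<=` rV_box (const_mx (- pi - 1), const_mx pi).
Proof.
move=> x xQ k; rewrite !mxE; have /andP[h1 ->] := xQ k; rewrite andbT.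
by apply: lt_le_trans h1; rewrite ltrBlDr ltrDl.
Qed.

Lemma measurable_freq_cube : measurable (Q : set (lebesgue_rV R d)).
Proof.
have -> : Q = \bigcap_(l in [set: 'I_d])
   ((fun x : lebesgue_rV R d => (x : 'rV[R]_d) ord0 l) @^-1` `[- pi, pi]%classic).
  apply/seteqP; split => x /= h l; first by move=> _ /=; rewrite in_itv /=; exact: h.
  by have := h l I; rewrite /= in_itv.
apply: fin_bigcap_measurable => [|l _]; first exact: finite_finset.
by rewrite -[X in measurable X]setTI; exact: measurable_coord.
Qed.

Lemma freq_cube_lty : (mu Q < +oo)%E.
Proof.
apply: (@le_lt_trans _ _ (lebesgue_outer (rV_box (const_mx (- pi - 1) : 'rV[R]_d, const_mx pi)))).
  exact/le_outer_measure/freq_cube_sub_box.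
by rewrite (le_lt_trans (lebesgue_outer_rV_box _))// ltry.
Qed.

Let mQ := measurable_freq_cube.

Lemma cintegrableD f g : cintegrable Q f -> cintegrable Q g ->
  cintegrable Q (fun x => f x + g x).
Proof.
move=> [f1 f2] [g1 g2]; split.
  apply: eq_integrable (integrableD mQ f1 g1) => // x _ /=.
  by case: (f x) => ? ?; case: (g x).
apply: eq_integrable (integrableD mQ f2 g2) => // x _ /=.
by case: (f x) => ? ?; case: (g x).
Qed.

Lemma cintegralD f g : cintegrable Q f -> cintegrable Q g ->
  CI (fun x => f x + g x) = CI f + CI g.
Proof.
move=> [f1 f2] [g1 g2]; rewrite /cintegral.
rewrite [RHS](_ : _ = Complex
  (Rintegral mu Q (fun x => complex.Re (f x)) + Rintegral mu Q (fun x => complex.Re (g x)))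
  (Rintegral mu Q (fun x => complex.Im (f x)) + Rintegral mu Q (fun x => complex.Im (g x))))//.
rewrite -!RintegralD//; congr Complex; apply: eq_Rintegral => x _;
  by case: (f x) => ? ?; case: (g x).
Qed.

Lemma cintegrableZ (a : C) f : cintegrable Q f -> cintegrable Q (fun x => a * f x).
Proof.
case: a => a b [f1 f2]; split.
  apply: eq_integrable (integrableB mQ (integrableZl mQ a f1) (integrableZl mQ b f2)) => // x _ /=.
  by case: (f x) => ? ?.
apply: eq_integrable (integrableD mQ (integrableZl mQ a f2) (integrableZl mQ b f1)) => // x _ /=.
by case: (f x) => ? ?.
Qed.

Lemma cintegralZ (a : C) f : cintegrable Q f -> CI (fun x => a * f x) = a * CI f.
Proof.
case: a => a b [f1 f2]; rewrite /cintegral.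
rewrite [RHS](_ : _ = Complex
  (a * Rintegral mu Q (fun x => complex.Re (f x)) - b * Rintegral mu Q (fun x => complex.Im (f x)))
  (a * Rintegral mu Q (fun x => complex.Im (f x)) + b * Rintegral mu Q (fun x => complex.Re (f x))))//.
have Z (c : R) (h : 'rV[R]_d -> R) : mu.-integrable Q (EFin \o h) ->
    mu.-integrable Q (EFin \o (fun x => c * h x)).
  move=> hi; apply: eq_integrable (integrableZl mQ c hi) => // x _ /=.
rewrite -!RintegralZl// -RintegralB//; [|exact: Z|exact: Z].
rewrite -RintegralD//; [|exact: Z|exact: Z].
by congr Complex; apply: eq_Rintegral => x _; case: (f x).
Qed.

Lemma cintegrable0 : cintegrable Q (fun=> 0).
Proof. by split; exact: integrable0. Qed.

Lemma cintegral0 : CI (fun=> 0) = 0.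
Proof.
by have := cintegralZ 0 cintegrable0; rewrite !mul0r.
Qed.

Lemma cintegrable_sum I (s : seq I) (F : I -> 'rV[R]_d -> C) :
  (forall i, cintegrable Q (F i)) -> cintegrable Q (fun x => \sum_(i <- s) F i x).
Proof.
move=> Fi; elim: s => [|i s IH].
  by under eq_fun do rewrite big_nil; exact: cintegrable0.
under eq_fun do rewrite big_cons; exact: cintegrableD.
Qed.

Lemma cintegral_sum I (s : seq I) (F : I -> 'rV[R]_d -> C) :
  (forall i, cintegrable Q (F i)) ->
  CI (fun x => \sum_(i <- s) F i x) = \sum_(i <- s) CI (F i).
Proof.
move=> Fi; elim: s => [|i s IH].
  by under eq_fun do rewrite big_nil; rewrite big_nil cintegral0.
under eq_fun do rewrite big_cons; rewrite big_cons cintegralD ?IH//.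
exact: cintegrable_sum.
Qed.

Lemma cintegral_conj f : cintegrable Q f -> CI (fun x => (f x)^*%C) = (CI f)^*%C.
Proof.
move=> [f1 f2]; rewrite /cintegral /=; congr Complex.
  by apply: eq_Rintegral => x _; case: (f x).
rewrite -mulN1r -RintegralZl//; apply: eq_Rintegral => x _.
by rewrite mulN1r; case: (f x).
Qed.

Lemma cintegral_ge0 f : (forall x, 0 <= f x) -> 0 <= CI f.
Proof.
move=> f0; rewrite lecE /=; apply/andP; split.
  rewrite (_ : Rintegral _ _ _ = Rintegral mu Q (fun=> 0)); last first.
    by apply: eq_Rintegral => x _; have := f0 x; rewrite lecE => /andP[/eqP ->].
  by rewrite /Rintegral integral0.
by apply: Rintegral_ge0 => x _; have := f0 x; rewrite lecE => /andP[].
Qed.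

(** The characters of the torus, as functions on the whole space. *)
Definition character k (x : 'rV[R]_d) : C := expi (\sum_l (k l)%:~R * x ord0 l).

Lemma expiD (x y : R) : expi (x + y) = expi x * expi y.
Proof. by rewrite /expi cosD sinD; apply/eqP; rewrite eq_complex /= !eqxx /= addrC. Qed.

Lemma expiN (x : R) : expi (- x) = (expi x)^*%C.
Proof. by rewrite /expi cosN sinN. Qed.

Lemma expi0 : expi (0 : R) = 1.
Proof. by rewrite /expi cos0 sin0. Qed.

Lemma measurable_phase k : measurable_fun setT
  (fun x : lebesgue_rV R d => \sum_l (k l)%:~R * (x : 'rV[R]_d) ord0 l).
Proof.
apply: measurable_sum => l; apply: measurable_funM; first exact: measurable_cst.
exact: measurable_coord.
Qed.

Lemma measurable_cos_phase k : measurable_fun setT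
  (fun x : lebesgue_rV R d => complex.Re (character k x)).
Proof.
apply: (@measurableT_comp _ _ _ _ _ _ (@cos R)); last exact: measurable_phase.
by apply: continuous_measurable_fun; exact: continuous_cos.
Qed.

Lemma measurable_sin_phase k : measurable_fun setT
  (fun x : lebesgue_rV R d => complex.Im (character k x)).
Proof.
apply: (@measurableT_comp _ _ _ _ _ _ (@sin R)); last exact: measurable_phase.
by apply: continuous_measurable_fun; exact: continuous_sin.
Qed.

Lemma normr_cos_le1 (x : R) : `|cos x| <= 1.
Proof. by rewrite ler_norml cos_geN1 cos_le1. Qed.

Lemma normr_sin_le1 (x : R) : `|sin x| <= 1.
Proof. by rewrite ler_norml sin_geN1 sin_le1. Qed.

Lemma integrable_bounded_mul (h b : 'rV[R]_d -> R) (M : R) :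
  mu.-integrable Q (EFin \o h) ->
  measurable_fun setT (b : lebesgue_rV R d -> R) -> (forall x, `|b x| <= M) ->
  mu.-integrable Q (fun x => (h x * b x)%:E).
Proof.
move=> hi mb bM.
have bb : [bounded b x | x in Q].
  exists M; split; first exact: num_real.
  by move=> N MN x _ /=; rewrite (le_trans (bM x))// ltW.
by apply: eq_integrable (integrableMl mQ hi (measurable_funTS mb) bb).
Qed.

Lemma cintegrable_character f k : cintegrable Q f ->
  cintegrable Q (fun x => f x * character k x).
Proof.
move=> [f1 f2].
have c1 x : `|complex.Re (character k x)| <= 1 by exact: normr_cos_le1.
have s1 x : `|complex.Im (character k x)| <= 1 by exact: normr_sin_le1.
split.
  apply: eq_integrable (integrableB mQ
     (integrable_bounded_mul f1 (measurable_cos_phase k) c1)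
     (integrable_bounded_mul f2 (measurable_sin_phase k) s1)) => // x _ /=.
  by case: (f x) => a b.
apply: eq_integrable (integrableD mQ
   (integrable_bounded_mul f1 (measurable_sin_phase k) s1)
   (integrable_bounded_mul f2 (measurable_cos_phase k) c1)) => // x _ /=.
by case: (f x) => a b.
Qed.

Lemma cintegrable1 : cintegrable Q (fun=> 1).
Proof.
split; apply: (measurable_bounded_integrable (f := cst _)) => //.
- exact: freq_cube_lty.
- by exists 1; split => // N N1 x _ /=; rewrite normr1 ltW.
- exact: freq_cube_lty.
- by exists 0; split => // N N1 x _ /=; rewrite normr0 ltW.
Qed.

End cintegral.

Section orthogonality.
Context {R : realType} {d : nat}.
Local Notation C := R[i].
Local Notation mu := (@lebesgue_mu R d).
Local Notation Q := (freq_cube d : set 'rV[R]_d).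
Local Notation CI := (cintegral Q).

(** Fixing all coordinates but one to the closed frequency interval and cutting
    the remaining one by a half-open interval lets a period be split and
    reassembled after a translation. *)
Definition strip (l : 'I_d) (a b : R) : set 'rV[R]_d :=
  [set x | (forall j, j != l -> - pi <= x ord0 j <= pi) /\ a < x ord0 l <= b].

Lemma measurable_strip l a b : measurable (strip l a b : set (lebesgue_rV R d)).
Proof.
have -> : strip l a b = (\bigcap_(j in [set j : 'I_d | j != l])
   ((fun x : lebesgue_rV R d => (x : 'rV[R]_d) ord0 j) @^-1` `[- pi, pi]%classic)) `&`
   ((fun x : lebesgue_rV R d => (x : 'rV[R]_d) ord0 l) @^-1` `]a, b]%classic).
  apply/seteqP; split => x /= [h1 h2]; split => [j jl|].
  - by rewrite /= in_itv /=; exact: h1.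
  - by rewrite /= in_itv.
  - by have := h1 j jl; rewrite /= in_itv.
  - by move: h2; rewrite in_itv.
apply: measurableI; last first.
  by rewrite -[X in measurable X]setTI; exact: measurable_coord.
apply: fin_bigcap_measurable => [|j _]; first exact: finite_finset.
by rewrite -[X in measurable X]setTI; exact: measurable_coord.
Qed.

Lemma strip_translate l a b c : (fun x => x + c *: delta_mx 0 l) @^-1` strip l a b =
  strip l (a - c) (b - c).
Proof.
apply/seteqP; split => x /= [h1 h2]; split => [j jl|].
- by have := h1 j jl; rewrite !mxE (negPf jl) andbF mulr0 addr0.
- by move: h2; rewrite !mxE !eqxx mulr1 ltrBlDr lerBrDr.
- by rewrite !mxE (negPf jl) andbF mulr0 addr0; exact: h1.
- by rewrite !mxE !eqxx mulr1 -ltrBlDr -lerBrDr.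
Qed.

Lemma stripU l a b c : a <= b -> b <= c -> strip l a b `|` strip l b c = strip l a c.
Proof.
move=> ab bc; apply/seteqP; split=> x /=.
  by move=> [[h1 /andP[h2 h3]]|[h1 /andP[h2 h3]]]; split => //; apply/andP; split => //;
    [exact: le_trans h3 bc|exact: le_lt_trans h2].
move=> [h1 /andP[h2 h3]]; have [xb|bx] := leP (x ord0 l) b; [left|right]; split => //.
  by rewrite h2.
by rewrite bx.
Qed.

Lemma strip_disj l a b c : [disjoint strip l a b & strip l b c].
Proof.
apply/disj_setPS => x [[_ /andP[_ h1]] [_ /andP[h2 _]]].
by have := le_lt_trans h1 h2; rewrite ltxx.
Qed.

Lemma strip_sub_box l a b : strip l a b `<=`
  rV_box (\row_k (if k == l then a else - pi - 1), \row_k (if k == l then b else pi)).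
Proof.
move=> x [h1 h2] k; rewrite !mxE; case: eqP => [->//|/eqP kl].
have /andP[h3 ->] := h1 k kl; rewrite andbT.
by apply: lt_le_trans h3; rewrite ltrBlDr ltrDl.
Qed.

Lemma strip_lty l a b : (mu (strip l a b) < +oo)%E.
Proof.
apply: (le_lt_trans (le_outer_measure _ _ _ (@strip_sub_box l a b))).
by rewrite (le_lt_trans (lebesgue_outer_rV_box _))// ltry.
Qed.

Lemma integrable_strip l a b (G : 'rV[R]_d -> R) :
  measurable_fun setT (G : lebesgue_rV R d -> R) -> (forall x, `|G x| <= 1) ->
  mu.-integrable (strip l a b) (EFin \o G).
Proof.
move=> mG G1; apply: measurable_bounded_integrable.
- exact: measurable_strip.
- exact: strip_lty.
- exact: measurable_funTS.
- by exists 1; split => // N N1 x _ /=; rewrite (le_trans (G1 x))// ltW.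
Qed.

Lemma Rintegral_strip_shift l a b c (G : 'rV[R]_d -> R) :
  measurable_fun setT (G : lebesgue_rV R d -> R) -> (forall x, `|G x| <= 1) ->
  (forall x, G (x + c *: delta_mx 0 l) = - G x) ->
  Rintegral mu (strip l a b) G = - Rintegral mu (strip l (a - c) (b - c)) G.
Proof.
move=> mG G1 Gc; rewrite /Rintegral (integral_translate (h := c *: delta_mx 0 l)).
- rewrite strip_translate -fineN -integralN.
    by congr fine; apply: eq_integral => x _ /=; rewrite Gc EFinN.
  by apply: integrable_add_def; [exact: measurable_strip|exact: integrable_strip].
- exact: measurable_strip.
- exact/measurable_EFinP.
- rewrite strip_translate; have mS := measurable_strip l (a - c) (b - c).
  apply: eq_integrable (integrableN (integrable_strip l (a - c) (b - c) mG G1)) => //.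
  by move=> x _ /=; rewrite Gc.
Qed.

Lemma Rintegral_strip_split l a b c (G : 'rV[R]_d -> R) : a <= b -> b <= c ->
  measurable_fun setT (G : lebesgue_rV R d -> R) -> (forall x, `|G x| <= 1) ->
  Rintegral mu (strip l a c) G =
  Rintegral mu (strip l a b) G + Rintegral mu (strip l b c) G.
Proof.
move=> ab bc mG G1; rewrite -(stripU l ab bc) Rintegral_setU//.
- exact: measurable_strip.
- exact: measurable_strip.
- by rewrite stripU//; exact: integrable_strip.
- exact: strip_disj.
Qed.

(** The closed cube and the half-open strip differ by a face of the cube. *)
Lemma Rintegral_freq_cube_strip l (G : 'rV[R]_d -> R) :
  measurable_fun setT (G : lebesgue_rV R d -> R) -> (forall x, `|G x| <= 1) ->
  Rintegral mu Q G = Rintegral mu (strip l (- pi) pi) G.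
Proof.
move=> mG G1; pose N : set 'rV[R]_d := Q `&` [set x | x ord0 l = - pi].
have N0 : lebesgue_outer N = 0%E.
  apply: (@outer_hyperplane0 _ _ l (- pi) (const_mx (- pi - 1), const_mx pi)).
    by move=> x [/freq_cube_sub_box].
  by move=> x [].
have -> : strip l (- pi) pi = Q `\` N.
  apply/seteqP; split => x /=.
    move=> [h1 /andP[h2 h3]]; split.
      by move=> j; have [->|/h1//] := eqVneq j l; rewrite ltW.
    by move=> [_ xl]; rewrite xl ltxx in h2.
  move=> [h1 h2]; split=> [j _|]; first exact: h1.
  have /andP[h3 ->] := h1 l; rewrite andbT lt_neqAle h3 andbT eq_sym.
  by apply/eqP => xl; apply: h2.
rewrite /Rintegral; congr fine; apply: negligible_integral => //.
- exact: outer0_measurable.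
- exact: measurable_freq_cube.
- apply: measurable_bounded_integrable.
  + exact: measurable_freq_cube.
  + exact: freq_cube_lty.
  + exact: measurable_funTS.
  + by exists 1; split => // M M1 x _ /=; rewrite (le_trans (G1 x))// ltW.
Qed.

(** A translation by [h] maps the strip to itself modulo the period [2 pi], the
    part that leaves on one side coming back on the other by a translation by
    [h - 2 pi].  Since both change the sign of [G], the integral is its own
    opposite. *)
Lemma Rintegral_antiperiodic0 l (h : R) (G : 'rV[R]_d -> R) : 0 <= h <= pi ->
  measurable_fun setT (G : lebesgue_rV R d -> R) -> (forall x, `|G x| <= 1) ->
  (forall x, G (x + h *: delta_mx 0 l) = - G x) ->
  (forall x, G (x + (h - pi *+ 2) *: delta_mx 0 l) = - G x) ->
  Rintegral mu Q G = 0.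
Proof.
move=> /andP[h0 hpi] mG G1 Gh Gh'.
rewrite (Rintegral_freq_cube_strip l)//.
have pi0 := @pi_ge0 R.
have E1 : Rintegral mu (strip l (- pi) pi) G =
   Rintegral mu (strip l (- pi) (- pi + h)) G + Rintegral mu (strip l (- pi + h) pi) G.
  by apply: Rintegral_strip_split => //; lra.
have E2 : Rintegral mu (strip l (- pi) pi) G =
   Rintegral mu (strip l (- pi) (pi - h)) G + Rintegral mu (strip l (pi - h) pi) G.
  by apply: Rintegral_strip_split => //; lra.
have := Rintegral_strip_shift (- pi + h) pi mG G1 Gh.
rewrite addrK => E3.
have := Rintegral_strip_shift (- pi) (- pi + h) mG G1 Gh'.
rewrite (_ : - pi - _ = pi - h); last by rewrite mulr2n; lra.
rewrite (_ : - pi + h - _ = pi); last by rewrite mulr2n; lra.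
by lra.
Qed.

Lemma expiDpi (x : R) : expi (x + pi) = - expi x.
Proof. by rewrite /expi cosDpi sinDpi. Qed.

Lemma expiD_signpi (s : bool) (x : R) : expi (x + (-1) ^+ s * pi) = - expi x.
Proof.
case: s; last by rewrite expr0 mul1r expiDpi.
by rewrite expr1 mulN1r -{2}(subrK pi x) expiDpi opprK.
Qed.

Lemma expi_2pi (z : int) : expi (z%:~R * (pi *+ 2) : R) = 1.
Proof.
have nat_2pi (n : nat) : expi (n%:R * (pi *+ 2) : R) = 1.
  elim: n => [|n IH]; first by rewrite mul0r expi0.
  rewrite -natr1 mulrDl mul1r expiD IH mul1r mulr2n !expiDpi -[pi]add0r.
  by rewrite expiDpi expi0 opprK.
case: z => n; first exact: nat_2pi.
by rewrite NegzE intrN mulNr expiN nat_2pi conjc1.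
Qed.

(** If [k l != 0], then translating coordinate [l] by [pi / `|k l|] multiplies the
    character by -1. *)
Lemma cintegral_character k : CI (character k) =
  (if [forall l, k l == 0] then CI (fun=> 1) else 0).
Proof.
case: ifPn => [/forallP k0|].
  congr (CI _); apply/funext => x; rewrite /character big1 ?expi0// => l _.
  by rewrite (eqP (k0 l)) mul0r.
rewrite negb_forall => /existsP[l kl].
pose h : R := pi / `|(k l)%:~R|.
have kl0 : (k l)%:~R != 0 :> R by rewrite intr_eq0.
have nkl0 : 0 < `|(k l)%:~R : R| by rewrite normr_gt0.
have kl1 : 1 <= `|(k l)%:~R : R|.
  by rewrite -intr_norm -[1]/(1%:~R) ler_int -gtz0_ge1 normr_gt0.
have phase c x : \sum_j (k j)%:~R * (x + c *: delta_mx 0 l : 'rV[R]_d) ord0 j =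
    \sum_j (k j)%:~R * x ord0 j + (k l)%:~R * c.
  rewrite [LHS](bigD1 l)//= [in RHS](bigD1 l)//= !mxE !eqxx mulr1 mulrDr.
  rewrite -!addrA; congr (_ + _); rewrite addrC; congr (_ + _).
  by apply: eq_bigr => j jl; rewrite !mxE (negPf jl) andbF mulr0 addr0.
have h0 : 0 <= h by rewrite divr_ge0// pi_ge0.
have hpi : h <= pi by rewrite ler_pdivrMr// ler_peMr// pi_ge0.
have klh : exists s : bool, (k l)%:~R * h = (-1) ^+ s * pi :> R.
  exists ((k l)%:~R < 0 :> R); rewrite /h mulrCA mulrC; congr (_ * _).
  by rewrite {1}[(k l)%:~R]numEsg mulfK ?gt_eqF// sgr_def kl0 mulr1n.
have shift1 x : character k (x + h *: delta_mx 0 l) = - character k x.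
  by have [s E] := klh; rewrite /character phase E expiD_signpi.
have shift2 x : character k (x + (h - pi *+ 2) *: delta_mx 0 l) = - character k x.
  rewrite -shift1 /character !phase mulrBr addrA expiD -mulNr -intrN.
  by rewrite expi_2pi mulr1.
rewrite /cintegral (@Rintegral_antiperiodic0 l h); last 5 first.
- by rewrite h0.
- exact: measurable_cos_phase.
- by move=> x; exact: normr_cos_le1.
- by move=> x; rewrite shift1; case: (character k x).
- by move=> x; rewrite shift2; case: (character k x).
rewrite (@Rintegral_antiperiodic0 l h)//.
- by rewrite h0.
- exact: measurable_sin_phase.
- by move=> x; exact: normr_sin_le1.
- by move=> x; rewrite shift1; case: (character k x).
- by move=> x; rewrite shift2; case: (character k x).
Qed.

End orthogonality.

(** * Scalar Toeplitz matrices *)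

#[local] Arguments cintegral : simpl never.
#[local] Arguments character : simpl never.
#[local] Arguments conjc : simpl never.

Section toeplitz.
Local Open Scope sesquilinear_scope.
Context {R : realType} {d : nat}.
Local Notation C := R[i].
Local Notation mu := (@lebesgue_mu R d).
Local Notation Q := (freq_cube d : set 'rV[R]_d).
Local Notation CI := (cintegral Q).
Implicit Types (f g : 'rV[R]_d -> C) (k : 'I_d -> int) (r : 'rV[R]_d -> R).

Let norm_cst : R := (2 * pi) ^- d.

Let norm_cst_ge0 : 0 <= norm_cst.
Proof. by rewrite invr_ge0 exprn_ge0// mulr_ge0// pi_ge0. Qed.

(** The Fourier coefficients of a scalar symbol, normalised as those of a
    matrix-valued one so that they are its entries. *)
Definition tcoef g k : C := real_complex R ((2 * pi) ^- d) *
  CI (fun theta => g theta * expi (- \sum_l (k l)%:~R * theta ord0 l)).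

Lemma tcoefE g k : tcoef g k =
  norm_cst%:C%C * CI (fun x => g x * character (fun l => - k l) x).
Proof.
rewrite /tcoef; congr (_ * CI _); apply/funext => x; congr (_ * expi _).
by rewrite -sumrN; apply: eq_bigr => l _; rewrite intrN mulNr.
Qed.

Lemma character_opp k x : character (fun l => - k l) x = (character k x : C)^*%C.
Proof.
rewrite /character -expiN -sumrN; congr expi.
by apply: eq_bigr => l _; rewrite intrN mulNr.
Qed.

Lemma character_add k k' x :
  character (fun l => k l + k' l) x = character k x * character k' x :> C.
Proof.
rewrite /character -expiD -big_split; congr expi.
by apply: eq_bigr => l _; rewrite intrD mulrDl.
Qed.

Lemma tcoefD f g k : cintegrable Q f -> cintegrable Q g ->
  tcoef (fun x => f x + g x) k = tcoef f k + tcoef g k.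
Proof.
move=> fi gi; rewrite !tcoefE -mulrDr -cintegralD; try exact: cintegrable_character.
by congr (_ * CI _); apply/funext => x; rewrite mulrDl.
Qed.

Lemma tcoefZ a g k : cintegrable Q g -> tcoef (fun x => a * g x) k = a * tcoef g k.
Proof.
move=> gi; rewrite !tcoefE mulrCA; congr (_ * _).
rewrite -cintegralZ; last exact: cintegrable_character.
by congr CI; apply/funext => x; rewrite mulrA.
Qed.

Definition stoeplitz n g : 'M[C]_(msize n) :=
  \matrix_(i, j) tcoef g (fun l => (mindex i l)%:Z - (mindex j l)%:Z).

Lemma stoeplitzD n f g : cintegrable Q f -> cintegrable Q g ->
  stoeplitz n (fun x => f x + g x) = stoeplitz n f + stoeplitz n g.
Proof. by move=> fi gi; apply/matrixP => i j; rewrite !mxE tcoefD. Qed.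

Lemma stoeplitzZ n a g : cintegrable Q g ->
  stoeplitz n (fun x => a * g x) = a *: stoeplitz n g.
Proof. by move=> gi; apply/matrixP => i j; rewrite !mxE tcoefZ. Qed.

Lemma cintegrable_real r : mu.-integrable Q (EFin \o r) ->
  cintegrable Q (fun x => (r x)%:C%C).
Proof. by move=> ri; split => //=; exact: integrable0. Qed.

Lemma cintegral_real r : CI (fun x => (r x)%:C%C) = (Rintegral mu Q r)%:C%C.
Proof. by rewrite /cintegral /=; congr Complex; rewrite /Rintegral integral0. Qed.

Lemma conjcM (x y : C) : (x * y)^*%C = x^*%C * y^*%C.
Proof. exact: rmorphM. Qed.

Lemma conjcB (x y : C) : (x - y)^*%C = x^*%C - y^*%C.
Proof. exact: rmorphB. Qed.

Lemma conjc_sum I (s : seq I) (F : I -> C) :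
  (\sum_(i <- s) F i)^*%C = \sum_(i <- s) (F i)^*%C.
Proof. exact: raddf_sum. Qed.

Lemma tcoef_real_conj r k : mu.-integrable Q (EFin \o r) ->
  (tcoef (fun x => (r x)%:C%C) k)^*%C = tcoef (fun x => (r x)%:C%C) (fun l => - k l).
Proof.
move=> ri; have rc := cintegrable_real ri.
rewrite !tcoefE conjcM -cintegral_conj; last exact: cintegrable_character.
rewrite conjc_real; congr (_ * CI _); apply/funext => x.
by rewrite conjcM conjc_real -character_opp.
Qed.

Lemma stoeplitz_hermitian n r : mu.-integrable Q (EFin \o r) ->
  (stoeplitz n (fun x => (r x)%:C%C))^t* = stoeplitz n (fun x => (r x)%:C%C).
Proof.
move=> ri; apply/matrixP => i j; rewrite !mxE.
rewrite [LHS](tcoef_real_conj _ ri); congr (tcoef _ _).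
by apply/funext => l; rewrite opprB.
Qed.

(** The quadratic form at [x] is the integral of [r] times the squared modulus of
    the trigonometric polynomial with coefficients [x]. *)
Lemma stoeplitz_psd n r (x : 'cV[C]_(msize n)) : (forall y, 0 <= r y) ->
  mu.-integrable Q (EFin \o r) ->
  0 <= (x^t* *m stoeplitz n (fun x => (r x)%:C%C) *m x) 0 0.
Proof.
move=> r0 ri; have rc := cintegrable_real ri.
pose e (i : 'I_(msize n)) (y : 'rV[R]_d) : C := character (fun l => (mindex i l)%:Z) y.
pose p y := \sum_j x j 0 * e j y.
suff -> : (x^t* *m stoeplitz n (fun x => (r x)%:C%C) *m x) 0 0 =
    norm_cst%:C%C * CI (fun y => (r y)%:C%C * ((p y)^*%C * p y)).
  apply: mulr_ge0; first by rewrite ler0c.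
  apply: cintegral_ge0 => y; apply: mulr_ge0; first by rewrite ler0c.
  by rewrite mulrC mulcJ_ge0.
have -> : (fun y => (r y)%:C%C * ((p y)^*%C * p y)) = (fun y => \sum_j \sum_i
    ((x i 0)^*%C * x j 0) * ((r y)%:C%C * character
       (fun l => - ((mindex i l)%:Z - (mindex j l)%:Z)) y)).
  apply/funext => y; rewrite mulrCA mulrA {2}/p mulr_sumr; apply: eq_bigr => j _.
  rewrite /p conjc_sum mulr_suml mulr_suml; apply: eq_bigr => i _.
  have -> : (fun l => - ((mindex i l)%:Z - (mindex j l)%:Z)) =
    (fun l => - (mindex i l)%:Z + (mindex j l)%:Z) by apply/funext => l; rewrite opprB addrC.
  rewrite (character_add (fun l => - (mindex i l)%:Z)) character_opp -/(e i y) -/(e j y).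
  by rewrite conjcM; ring.
have ci i j : cintegrable Q (fun y => (x i 0)^*%C * x j 0 * ((r y)%:C%C * character
       (fun l => - ((mindex i l)%:Z - (mindex j l)%:Z)) y)).
  exact/cintegrableZ/cintegrable_character.
rewrite cintegral_sum => [|j]; last by apply: cintegrable_sum.
rewrite mulr_sumr mxE; apply: eq_bigr => j _.
rewrite cintegral_sum// mulr_sumr mxE mulr_suml; apply: eq_bigr => i _.
rewrite cintegralZ; last exact: cintegrable_character.
by rewrite !mxE tcoefE; ring.
Qed.

Lemma stoeplitz_trace n r : \tr (stoeplitz n (fun x => (r x)%:C%C)) =
  ((norm_cst * Rintegral mu Q r) *+ msize n)%:C%C.
Proof.
rewrite /mxtrace (eq_bigr (fun=> (norm_cst * Rintegral mu Q r)%:C%C)).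
  by rewrite sumr_const card_ord rmorphMn.
move=> i _; rewrite mxE tcoefE rmorphM /= -cintegral_real.
congr (_ * CI _); apply/funext => x; rewrite /character big1 ?expi0 ?mulr1// => l _.
by rewrite subrr oppr0 mul0r.
Qed.

(** The trace is the number of grid points times the mean of [r], so that the
    proportion of eigenvalues above [e] is at most that mean divided by [e]. *)
Lemma stoeplitz_lowrank_split n r (e : R) : 0 < e -> (forall y, 0 <= r y) ->
  mu.-integrable Q (EFin \o r) ->
  lowrank_split ((norm_cst * Rintegral mu Q r / e) * (msize n)%:R) e
    (stoeplitz n (fun x => (r x)%:C%C)).
Proof.
move=> e0 r0 ri.
have := psd_lowrank_split e0 (stoeplitz_hermitian n ri) (fun x => stoeplitz_psd x r0 ri).
apply: lowrank_split_le => //.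
rewrite stoeplitz_trace normc_real ger0_norm -mulr_natr ?mulrA.
  by rewrite [leRHS]mulrAC.
by rewrite mulr_ge0// mulr_ge0// Rintegral_ge0.
Qed.

(** Integrate the squared modulus of [r - t p], where [p] is the sum of the
    [c_k] times the characters: with [S] the sum of the squared moduli of the
    [c_k] and [V] the measure of the cube, the result
    [R2 - 2 t S + t ^ 2 S V] is nonnegative.  With [t = 1 / (V + 1)] one has
    [t V <= 1], so that [t S <= R2]. *)
Lemma bessel r : mu.-integrable Q (EFin \o r) ->
  mu.-integrable Q (EFin \o (fun x => r x ^+ 2)) ->
  exists B, forall s : seq {ffun 'I_d -> int}, uniq s ->
    \sum_(k <- s) normc (tcoef (fun x => (r x)%:C%C) k) ^+ 2 <= B.
Proof.
move=> ri r2i; have rc := cintegrable_real ri; have r2c := cintegrable_real r2i.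
pose V := Rintegral mu Q (fun=> 1).
have V0 : 0 <= V by exact: Rintegral_ge0.
have VE : CI (fun=> 1) = V%:C%C by rewrite -cintegral_real.
exists (norm_cst ^+ 2 * ((V + 1) * Rintegral mu Q (fun x => r x ^+ 2))) => s us.
pose c k := CI (fun x => (r x)%:C%C * (character k x)^*%C).
have cE k : CI (fun x => (r x)%:C%C * character k x) = (c k)^*%C.
  rewrite /c -cintegral_conj; last first.
    by under eq_fun do rewrite -character_opp; exact: cintegrable_character.
  by congr CI; apply/funext => x; rewrite conjcM conjc_real conjcK.
have tc k : normc (tcoef (fun x => (r x)%:C%C) k) ^+ 2 = norm_cst ^+ 2 * normc (c k) ^+ 2.
  rewrite tcoefE normcM exprMn normc_real ger0_norm//; congr (_ * normc _ ^+ 2).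
  by congr CI; apply/funext => x; rewrite character_opp.
under eq_bigr do rewrite tc.
rewrite -mulr_sumr ler_wpM2l ?sqr_ge0//.
set S := \sum_(k <- s) _; set R2 := Rintegral _ _ _.
have S0 : 0 <= S by apply: sumr_ge0 => k _; exact: sqr_ge0.
have SC : S%:C%C = \sum_(k <- s) (c k)^*%C * c k.
  by rewrite /S raddf_sum; apply: eq_bigr => k _; exact: sqr_normcC.
(* Small enough for [t * V <= 1]. *)
pose t := (V + 1)^-1.
pose p x := \sum_(k <- s) c k * character k x.
have chi k : cintegrable Q (fun x => character k x).
  under eq_fun do rewrite -[character _ _]mul1r.
  exact: cintegrable_character cintegrable1.
have rchi k : cintegrable Q (fun x => (r x)%:C%C * character k x).
  exact: cintegrable_character.
have rchi' k : cintegrable Q (fun x => (r x)%:C%C * (character k x)^*%C).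
  by under eq_fun do rewrite -character_opp; exact: cintegrable_character.
have chichi (k k' : {ffun 'I_d -> int}) :
    cintegrable Q (fun x => (character k x)^*%C * character k' x).
  under eq_fun do rewrite -character_opp -character_add; exact: chi.
pose F1 x := (r x ^+ 2)%:C%C.
pose F2 x := \sum_(k <- s) c k * ((r x)%:C%C * character k x).
pose F3 x := \sum_(k <- s) (c k)^*%C * ((r x)%:C%C * (character k x)^*%C).
pose F4 x := \sum_(k <- s) \sum_(k' <- s) ((c k)^*%C * c k') *
   ((character k x)^*%C * character k' x).
have i2 : cintegrable Q F2 by apply: cintegrable_sum => k; exact: cintegrableZ.
have i3 : cintegrable Q F3 by apply: cintegrable_sum => k; exact: cintegrableZ.
have i4 : cintegrable Q F4.
  by do 2 (apply: cintegrable_sum => ?); exact: cintegrableZ.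
have : 0 <= CI (fun x => ((r x)%:C%C - t%:C%C * p x)^*%C * ((r x)%:C%C - t%:C%C * p x)).
  by apply: cintegral_ge0 => x; rewrite mulrC mulcJ_ge0.
have -> : (fun x => ((r x)%:C%C - t%:C%C * p x)^*%C * ((r x)%:C%C - t%:C%C * p x)) =
   (fun x => (F1 x + (- t%:C%C) * F2 x) + ((- t%:C%C) * F3 x + (t ^+ 2)%:C%C * F4 x)).
  apply/funext => x.
  have -> : F1 x = (r x)%:C%C * (r x)%:C%C by rewrite /F1 expr2 rmorphM.
  have -> : F2 x = (r x)%:C%C * p x.
    by rewrite /F2 /p mulr_sumr; apply: eq_bigr => k _; rewrite mulrCA.
  have -> : F3 x = (r x)%:C%C * (p x)^*%C.
    rewrite /F3 /p conjc_sum mulr_sumr; apply: eq_bigr => k _.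
    by rewrite conjcM mulrCA.
  have -> : F4 x = (p x)^*%C * p x.
    rewrite /F4 /p conjc_sum mulr_suml; apply: eq_bigr => k _.
    rewrite mulr_sumr; apply: eq_bigr => k' _.
    by rewrite conjcM; ring.
  rewrite conjcB conjcM !conjc_real (_ : (t ^+ 2)%:C%C = t%:C%C * t%:C%C); last first.
    by rewrite expr2 rmorphM.
  by ring.
have cD := cintegrableD; have cZ := cintegrableZ.
rewrite cintegralD; [|by apply: cD => //; exact: cZ|by apply: cD; exact: cZ].
rewrite cintegralD//; [|exact: cZ].
rewrite cintegralD; [|exact: cZ|exact: cZ].
rewrite !cintegralZ//.
have -> : CI F1 = R2%:C%C by rewrite -cintegral_real.
have -> : CI F2 = S%:C%C.
  rewrite cintegral_sum => [|k]; last exact: cZ.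
  rewrite SC; apply: eq_bigr => k _; rewrite cintegralZ// cE mulrC.
  by [].
have -> : CI F3 = S%:C%C.
  rewrite cintegral_sum => [|k]; last exact: cZ.
  by rewrite SC; apply: eq_bigr => k _; rewrite cintegralZ //.
have -> : CI F4 = (S * V)%:C%C.
  rewrite cintegral_sum => [|k]; last by apply: cintegrable_sum => k'; exact: cZ.
  transitivity (S%:C%C * V%:C%C); last by rewrite rmorphM.
  rewrite SC mulr_suml !big_seq; apply: eq_bigr => k ks.
  rewrite cintegral_sum => [|k']; last exact: cZ.
  rewrite (bigD1_seq k)//= cintegralZ// big1_seq ?addr0.
    rewrite -VE; congr (_ * CI _); apply/funext => x.
    by rewrite -expiN -expiD addNr expi0.
  move=> k' /andP[kk' _]; rewrite cintegralZ//.
  have -> : (fun x => (character k x)^*%C * character k' x) =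
      character (fun l => - k l + k' l) :> ('rV[R]_d -> C).
    by apply/funext => x; rewrite character_add character_opp.
  rewrite cintegral_character; case: forallP => [h|_]; last by rewrite mulr0.
  case/eqP: kk'; apply/ffunP => l; have := eqP (h l).
  by move=> /eqP; rewrite addrC subr_eq0 => /eqP.
rewrite -!rmorphN -!rmorphM -!rmorphD ler0c.
have tV : t * (V + 1) = 1 by rewrite mulVf// gt_eqF// ltr_wpDl.
have t0 : 0 < t by rewrite invr_gt0 ltr_wpDl.
move=> h.
rewrite -(@ler_pM2l _ t)// mulrA tV mul1r.
have tSV : t ^+ 2 * (S * V) <= t * S.
  have -> : t ^+ 2 * (S * V) = t * S * (t * V) by ring.
  rewrite ler_piMr//; first by rewrite mulr_ge0// ltW.
  by rewrite -tV ler_pM2l// lerDl.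
by lra.
Qed.

End toeplitz.

#[local] Arguments tcoef : simpl never.

(** * Commutators of Toeplitz and sampling matrices *)

Section commutator.
Context {R : realType} {d : nat}.
Local Notation C := R[i].
Local Notation mu := (@lebesgue_mu R d).
Local Notation Q := (freq_cube d : set 'rV[R]_d).
Variables (J : set nat) (nn : nat -> 'I_d -> nat).
Hypothesis nn_infty : mindex_to_infty J nn.

Definition sdiag n (a : 'rV[R]_d -> C) : 'M[C]_(msize n) :=
  diag_mx (\row_r a (grid_point r)).

Definition toeplitz_comm n (g : 'rV[R]_d -> C) (Om : set 'rV[R]_d) : 'M[C]_(msize n) :=
  stoeplitz n g *m sdiag n \1_Om - sdiag n \1_Om *m stoeplitz n g.

Lemma commE n g Om (i j : 'I_(msize n)) : toeplitz_comm n g Om i j =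
  stoeplitz n g i j * (\1_Om (grid_point j) - \1_Om (grid_point i)).
Proof.
by rewrite /toeplitz_comm mxE [X in _ + X]mxE mul_mx_diag mul_diag_mx !mxE mulrBr [X in _ - X]mulrC.
Qed.

(** Entry (i, j) of the commutator survives only if exactly one of the two grid
    points lies in [Om]. *)
Lemma normc_comm n g Om (i j : 'I_(msize n)) : normc (toeplitz_comm n g Om i j) =
  normc (stoeplitz n g i j) *+ ((grid_point i \in Om) != (grid_point j \in Om)).
Proof.
rewrite commE normcM !indicE.
by do 2 case: (_ \in _); rewrite ?subrr ?subr0 ?sub0r ?normcN ?normc0 ?normc1 ?mulr0 ?mulr1.
Qed.

(** The index of the Fourier coefficient in entry (i, j), in a type with
    decidable equality. *)
Definition freq_diff n (i j : 'I_(msize n)) : {ffun 'I_d -> int} :=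
  [ffun l => (mindex i l)%:Z - (mindex j l)%:Z].

Lemma freq_diff_inj n (i : 'I_(msize n)) : injective (freq_diff i).
Proof.
move=> j j' /ffunP h; apply: mindex_inj => l; have := h l.
by rewrite !ffunE => /addrI/oppr_inj/eqP; rewrite eqz_nat => /eqP.
Qed.

(** Choose a finite set [s] of frequencies outside of which the squared
    coefficients add up to at most [e / 2].  Entries with other frequencies
    contribute at most [e / 2] to each row, the coefficients in a row having
    distinct indices.  A frequency in [s] contributes to as many rows as there
    are grid points which the shift moves across the boundary, a vanishing
    proportion. *)
Lemma near_frob2_comm (g : 'rV[R]_d -> C) (Om : set 'rV[R]_d) (B e : R) :
  lebesgue_outer (closure Om `\` Om°) = 0%E ->
  (forall s : seq {ffun 'I_d -> int}, uniq s ->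
    \sum_(k <- s) normc (tcoef g k) ^+ 2 <= B) ->
  0 < e ->
  \forall n \near within J \oo,
    frob2 (toeplitz_comm (nn n) g Om) <= e * (msize (nn n))%:R.
Proof.
move=> Om0 gB e0; pose w (k : {ffun 'I_d -> int}) := normc (tcoef g k) ^+ 2.
have w0 k : 0 <= w k by exact: sqr_ge0.
have B0 : 0 <= B by have := gB [::] isT; rewrite big_nil.
have wB k : w k <= B by have := gB [:: k] isT; rewrite big_seq1.
pose sums : set R := [set \sum_(k <- s) w k | s in [set s | uniq s]].
have sums_sup : has_sup sums.
  split; first by exists 0; exists [::]; rewrite ?big_nil.
  by exists B => _ [s us <-]; exact: gB.
have e2 : 0 < e / 2 by rewrite divr_gt0.
have [_ [s us <-] hs] := sup_adherent e2 sums_sup.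
(* Beyond [s] only [e / 2] is left, since [s] is within [e / 2] of the supremum. *)
have tail s' : uniq s' -> {in s', forall k, k \notin s} -> \sum_(k <- s') w k <= e / 2.
  move=> us' ss'; have : \sum_(k <- s ++ s') w k <= sup sums.
    apply: ub_le_sup; first exact: sums_sup.2.
    exists (s ++ s') => //=; rewrite cat_uniq us us' andbT /=.
    by apply/hasPn => k /ss'.
  by rewrite big_cat /=; lra.
pose M := B * (size s)%:R; have M0 : 0 <= M by rewrite mulr_ge0.
have eM : 0 < e / 2 / (M + 1) by rewrite divr_gt0// ltr_wpDl.
(* Row [i] has an entry of frequency [k] that survives in the commutator. *)
pose cross n (k : {ffun 'I_d -> int}) (i : 'I_(msize (nn n))) :=
  [exists j : 'I_(msize (nn n)), (freq_diff i j == k) &&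
     ((grid_point i \in Om) != (grid_point j \in Om))].
have : \forall n \near within J \oo, forall k, k \in s ->
    #|[pred i | @cross n k i]|%:R <= e / 2 / (M + 1) * (msize (nn n))%:R.
  elim: (s) => [|k s' IH]; first by near=> n => k.
  have hk := near_shift_crossing nn_infty k Om0 eM.
  have {}hk : \forall n \near within J \oo,
      #|[pred i | @cross n k i]|%:R <= e / 2 / (M + 1) * (msize (nn n))%:R.
    apply: filterS hk => n; apply: le_trans; rewrite ler_nat subset_leq_card//.
    apply/fintype.subsetP => i; rewrite !inE => /existsP[j /andP[/eqP ij cij]].
    apply/existsP; exists j; rewrite cij andbT; apply/forallP => l.
    by rewrite -ij ffunE.
  near=> n => j; rewrite inE => /orP[/eqP ->|]; first by near: n; exact: hk.
  by move: j; near: n; exact: IH.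
apply: filterS => n hn.
have row i : \sum_j normc (toeplitz_comm (nn n) g Om i j) ^+ 2 <=
    e / 2 + \sum_(k <- s) B * (@cross n k i)%:R.
  rewrite (bigID (fun j => freq_diff i j \in s)) /= addrC; apply: lerD.
    apply: (@le_trans _ _ (\sum_(j | freq_diff i j \notin s) w (freq_diff i j))).
      apply: ler_sum => j _; rewrite normc_comm mxE /w.
      have -> : tcoef g (freq_diff i j) =
          tcoef g (fun l => (mindex i l)%:Z - (mindex j l)%:Z).
        by congr tcoef; apply/funext => l; rewrite ffunE.
      by case: (_ != _); rewrite ?mulr1n// mulr0n expr0n sqr_ge0.
    rewrite -big_filter -(big_map (freq_diff i) predT w).
    apply: tail => [|k /mapP[j + ->]]; last by rewrite mem_filter => /andP[].
    by rewrite map_inj_uniq ?filter_uniq ?index_enum_uniq//; exact: freq_diff_inj.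
  apply: (@le_trans _ _ (\sum_(k <- s) \sum_(j | freq_diff i j == k)
      normc (toeplitz_comm (nn n) g Om i j) ^+ 2)).
    rewrite (exchange_big_dep xpredT)//= [leRHS](bigID (fun j => freq_diff i j \in s)) /=.
    rewrite ler_wpDr//; first by apply: sumr_ge0 => j _; apply: sumr_ge0 => k _; exact: sqr_ge0.
    apply: ler_sum => j js; rewrite big_mkcond (bigD1_seq (freq_diff i j))//= eqxx lerDl.
    by rewrite sumr_ge0// => k _; case: ifP => // _; exact: sqr_ge0.
  apply: ler_sum => k _.
  have [/existsP[j /andP[/eqP ij cij]]|nc] := boolP (@cross n k i).
    rewrite mulr1 (big_pred1 j) => [|j' /=]; last first.
      by rewrite -ij (inj_eq (@freq_diff_inj _ i)).
    rewrite normc_comm cij mulr1n mxE; apply: le_trans (wB k); rewrite /w -ij.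
    rewrite (_ : tcoef g (freq_diff i j) =
          tcoef g (fun l => (mindex i l)%:Z - (mindex j l)%:Z))//.
    by congr tcoef; apply/funext => l; rewrite ffunE.
  rewrite mulr0 big1// => j /eqP ij; rewrite normc_comm.
  have -> : ((grid_point i \in Om) != (grid_point j \in Om)) = false.
    apply/negbTE; apply: contra nc => cij; apply/existsP; exists j.
    by rewrite ij eqxx.
  by rewrite mulr0n expr0n.
rewrite /frob2; apply: (@le_trans _ _ (\sum_(i < msize (nn n))
   (e / 2 + \sum_(k <- s) B * (@cross n k i)%:R))).
  by apply: ler_sum => i _; exact: row.
rewrite [leRHS](_ : _ = (e / 2) * (msize (nn n))%:R + (e / 2) * (msize (nn n))%:R);
  last by rewrite -mulrDl -splitr.
rewrite big_split /= sumr_const card_ord -[X in X + _]mulr_natr lerD2l.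
rewrite exchange_big /=.
apply: (@le_trans _ _ (\sum_(k <- s) B * (e / 2 / (M + 1) * (msize (nn n))%:R))).
  rewrite !big_seq; apply: ler_sum => k ks; rewrite -mulr_sumr ler_wpM2l//.
  apply: le_trans (hn k ks); rewrite -sum1_card natr_sum [leRHS]big_mkcond /=.
  by apply: ler_sum => i _; rewrite inE; case: (@cross n k i).
rewrite big_const_seq count_predT iter_addr_0 -[leLHS]mulr_natr.
have -> (y N : R) : B * (y * N) * (size s)%:R = (y * M) * N by rewrite /M; ring.
by rewrite ler_wpM2r// mulrAC ler_pdivrMr ?ltr_wpDl// ler_wpM2l ?lerDl// ltW.
Unshelve. all: by end_near. Qed.

End commutator.

Section truncation.
Context {R : realType} {d : nat}.
Local Notation C := R[i].
Local Notation mu := (@lebesgue_mu R d).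
Local Notation Q := (freq_cube d : set 'rV[R]_d).
Variable r : 'rV[R]_d -> R.
Hypothesis r0 : forall x, 0 <= r x.
Hypothesis ri : mu.-integrable Q (EFin \o r).

Let mQ := @measurable_freq_cube R d.

Definition truncated (M : nat) x : R := Num.min (r x) M%:R.
Definition excess (M : nat) x : R := r x - truncated M x.

Let measurable_r : measurable_fun (Q : set (lebesgue_rV R d)) (r : lebesgue_rV R d -> R).
Proof. exact/measurable_EFinP/(measurable_int mu). Qed.

Lemma truncated_ge0 M x : 0 <= truncated M x.
Proof. by rewrite le_min r0 ler0n. Qed.

Lemma excess_ge0 M x : 0 <= excess M x.
Proof. by rewrite subr_ge0 ge_min lexx. Qed.

Lemma measurable_truncated M :
  measurable_fun (Q : set (lebesgue_rV R d)) (truncated M : lebesgue_rV R d -> R).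
Proof. by apply: measurable_minr => //; exact: measurable_cst. Qed.

Lemma integrable_truncated M : mu.-integrable Q (EFin \o truncated M).
Proof.
apply: measurable_bounded_integrable => //; first exact: freq_cube_lty.
  exact: measurable_truncated.
exists M%:R; split => // N MN x _ /=; rewrite ger0_norm ?truncated_ge0//.
by rewrite (le_trans _ (ltW MN))// ge_min lexx orbT.
Qed.

Lemma integrable_truncated2 M :
  mu.-integrable Q (EFin \o (fun x => truncated M x ^+ 2)).
Proof.
apply: measurable_bounded_integrable; [exact: mQ|exact: freq_cube_lty| |].
  by apply: measurable_funX; exact: measurable_truncated.
exists (M%:R ^+ 2); split; [exact: num_real|] => N MN x _ /=.
rewrite ger0_norm ?exprn_ge0 ?truncated_ge0// (le_trans _ (ltW MN))//.
by rewrite ler_pXn2r ?nnegrE ?truncated_ge0// ge_min lexx orbT.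
Qed.

Lemma integrable_excess M : mu.-integrable Q (EFin \o excess M).
Proof.
by apply: eq_integrable (integrableB mQ ri (integrable_truncated M)) => // x _ /=.
Qed.

(** Dominated convergence: at each point the excess vanishes once [M] exceeds [r]. *)
Lemma excess_small (e : R) : 0 < e -> exists M, Rintegral mu Q (excess M) <= e.
Proof.
move=> e0.
have [||] := @dominated_convergence _ _ R mu Q mQ
  (fun M x => (excess M x)%:E) (cst 0%E) (fun x => (r x)%:E)
  (fun M => measurable_int mu (integrable_excess M)) (@measurable_cst _ _ _ _ _ _) _ ri.
- apply/aeW => x _; apply: cvg_near_cst; near=> M.
  rewrite /excess /truncated (_ : Num.min _ _ = r x) ?subrr//.
  apply/min_idPl; near: M; exact: nbhs_infty_ger.
- apply/aeW => x M _; rewrite lee_fin ger0_norm ?excess_ge0//.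
  by rewrite lerBlDr lerDl truncated_ge0.
move=> _ _; rewrite integral0 => /fine_cvgP[_] /cvgrPdist_le/(_ e e0)[M _ /(_ M)].
rewrite /= leqnn => /(_ isT); rewrite sub0r normrN => h; exists M.
by rewrite (le_trans (ler_norm _)).
Unshelve. all: by end_near. Qed.

End truncation.

Section commutator_split.
Context {R : realType} {d : nat}.
Local Notation C := R[i].
Local Notation mu := (@lebesgue_mu R d).
Local Notation Q := (freq_cube d : set 'rV[R]_d).
Variables (J : set nat) (nn : nat -> 'I_d -> nat).
Hypothesis nn_infty : mindex_to_infty J nn.
Implicit Types (f g : 'rV[R]_d -> C) (Om : set 'rV[R]_d).

Lemma commD n f g Om : cintegrable Q f -> cintegrable Q g ->
  toeplitz_comm n (fun x => f x + g x) Om = toeplitz_comm n f Om + toeplitz_comm n g Om.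
Proof.
by move=> fi gi; rewrite /toeplitz_comm stoeplitzD// mulmxDl mulmxDr opprD addrACA.
Qed.

Lemma commZ n a g Om : cintegrable Q g ->
  toeplitz_comm n (fun x => a * g x) Om = a *: toeplitz_comm n g Om.
Proof.
by move=> gi; rewrite /toeplitz_comm stoeplitzZ// -scalemxAl -scalemxAr scalerBr.
Qed.

Lemma opbound_sdiag1 n Om : opbound 1 (sdiag n (\1_Om : 'rV[R]_d -> C)).
Proof.
apply: opbound_diag => // k; rewrite mxE indicE.
by case: (_ \in _); rewrite ?normc0 ?normc1.
Qed.

(** The truncated part is square integrable and its commutator has small
    Frobenius norm; the Toeplitz matrix of the excess is itself a matrix of small
    rank plus one of small norm, and so are its products with a contraction. *)
Lemma near_comm_split_nneg (r : 'rV[R]_d -> R) Om (e : R) :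
  (forall x, 0 <= r x) -> mu.-integrable Q (EFin \o r) ->
  lebesgue_outer (closure Om `\` Om°) = 0%E -> 0 < e ->
  \forall n \near within J \oo,
    lowrank_split (e * (msize (nn n))%:R) e (toeplitz_comm (nn n) (fun x => (r x)%:C%C) Om).
Proof.
move=> r0 ri Om0 e0; pose e1 := e / 3; have e10 : 0 < e1 by rewrite divr_gt0.
pose norm_cst : R := (2 * pi) ^- d.
have norm_cst_gt0 : 0 < norm_cst by rewrite invr_gt0 exprn_gt0// mulr_gt0// pi_gt0.
have e20 : 0 < e1 ^+ 2 / norm_cst by rewrite divr_gt0// exprn_gt0.
have [M hM] := excess_small r0 ri e20.
have tr := integrable_truncated r0 ri M; have ex := integrable_excess r0 ri M.
have [B hB] := bessel tr (integrable_truncated2 r0 ri M).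
have e30 : 0 < e1 * e1 ^+ 2 by rewrite mulr_gt0// exprn_gt0.
apply: filterS (near_frob2_comm nn_infty Om0 hB e30) => n hn.
set N : R := (msize (nn n))%:R in hn *.
have -> : (fun x => (r x)%:C%C) =
    (fun x => (truncated r M x)%:C%C + (excess r M x)%:C%C) :> ('rV[R]_d -> C).
  by apply/funext => x; rewrite -rmorphD /= addrC subrK.
rewrite commD; [|exact: cintegrable_real|exact: cintegrable_real].
have -> : e = e1 + (e1 + e1) by rewrite /e1; field.
rewrite !mulrDl; apply: lowrank_splitD.
  apply: lowrank_split_le (frob2_lowrank_split _ e10) => //.
  by rewrite ler_pdivrMr ?exprn_gt0// (le_trans hn)// mulrAC.
have T : lowrank_split (e1 * N) e1 (stoeplitz (nn n) (fun x => (excess r M x)%:C%C)).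
  apply: lowrank_split_le (stoeplitz_lowrank_split (nn n) e10 (excess_ge0 r M) ex) => //.
  rewrite ler_wpM2r// -/norm_cst ler_pdivrMr// mulrC -ler_pdivlMr//.
rewrite /toeplitz_comm; apply: lowrank_splitD.
  have I1 : opbound 1 (1%:M : 'M[C]_(msize (nn n))) by move=> x; rewrite mul1mx mul1r.
  have := lowrank_splitM ler01 (ltW e10) I1 (@opbound_sdiag1 (nn n) Om) T.
  by rewrite mul1mx mul1r mulr1.
have := lowrank_splitZ (-1) (lowrank_splitMl ler01 (@opbound_sdiag1 (nn n) Om) T).
by rewrite normcN normc1 !mul1r scaleN1r.
Qed.

Lemma near_comm_split g Om (e : R) : cintegrable Q g ->
  lebesgue_outer (closure Om `\` Om°) = 0%E -> 0 < e ->
  \forall n \near within J \oo,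
    lowrank_split (e * (msize (nn n))%:R) e (toeplitz_comm (nn n) g Om).
Proof.
move=> [gre gim] Om0 e0; pose e1 := e / 4; have e10 : 0 < e1 by rewrite divr_gt0.
have posi (h : 'rV[R]_d -> R) : mu.-integrable Q (EFin \o h) ->
    mu.-integrable Q (EFin \o (fun x => Num.max (h x) 0)).
  by move=> hi; exact: (integrable_funrpos measurable_freq_cube hi).
have negi (h : 'rV[R]_d -> R) : mu.-integrable Q (EFin \o h) ->
    mu.-integrable Q (EFin \o (fun x => Num.max (- h x) 0)).
  by move=> hi; exact: (integrable_funrneg measurable_freq_cube hi).
have split_max (y : R) : y = Num.max y 0 - Num.max (- y) 0.
  case/orP: (le_total 0 y) => y0.
    have -> : Num.max y 0 = y by apply/max_idPl.
    have -> : Num.max (- y) 0 = 0 by apply/max_idPr; rewrite oppr_le0.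
    by rewrite subr0.
  have -> : Num.max y 0 = 0 by apply/max_idPr.
  have -> : Num.max (- y) 0 = - y by apply/max_idPl; rewrite oppr_ge0.
  by rewrite sub0r opprK.
pose r1 (x : 'rV[R]_d) : R := Num.max (complex.Re (g x)) 0; pose p1 x : C := (r1 x)%:C%C.
pose r2 (x : 'rV[R]_d) : R := Num.max (- complex.Re (g x)) 0; pose p2 x : C := (r2 x)%:C%C.
pose r3 (x : 'rV[R]_d) : R := Num.max (complex.Im (g x)) 0; pose p3 x : C := (r3 x)%:C%C.
pose r4 (x : 'rV[R]_d) : R := Num.max (- complex.Im (g x)) 0; pose p4 x : C := (r4 x)%:C%C.
have i1 : mu.-integrable Q (EFin \o r1) by exact: posi.
have i2 : mu.-integrable Q (EFin \o r2) by exact: negi.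
have i3 : mu.-integrable Q (EFin \o r3) by exact: posi.
have i4 : mu.-integrable Q (EFin \o r4) by exact: negi.
have nn1 x : 0 <= r1 x by rewrite le_max lexx orbT.
have nn2 x : 0 <= r2 x by rewrite le_max lexx orbT.
have nn3 x : 0 <= r3 x by rewrite le_max lexx orbT.
have nn4 x : 0 <= r4 x by rewrite le_max lexx orbT.
have h1 := near_comm_split_nneg nn1 i1 Om0 e10.
have h2 := near_comm_split_nneg nn2 i2 Om0 e10.
have h3 := near_comm_split_nneg nn3 i3 Om0 e10.
have h4 := near_comm_split_nneg nn4 i4 Om0 e10.
have c1 : cintegrable Q p1 by exact: cintegrable_real.
have c2 : cintegrable Q p2 by exact: cintegrable_real.
have c3 : cintegrable Q p3 by exact: cintegrable_real.
have c4 : cintegrable Q p4 by exact: cintegrable_real.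
apply: filterS (filterI (filterI h1 h2) (filterI h3 h4)) => n [[H1 H2] [H3 H4]].
have -> : g = (fun x => (p1 x + (- 1) * p2 x) + ('i%C * p3 x + (- 'i%C) * p4 x)).
  apply/funext => x; rewrite [LHS]complexE mulN1r mulNr -mulrBr.
  by congr (_ + _ * _); rewrite /p1 /p2 /p3 /p4 -rmorphB /= /r1 /r2 /r3 /r4 -split_max.
have Z := cintegrableZ.
rewrite commD; [|by apply: cintegrableD => //; exact: Z|by apply: cintegrableD; exact: Z].
rewrite commD; [|by []|exact: Z].
rewrite commD; [|exact: Z|exact: Z].
rewrite !commZ//.
have ni : normc ('i%C : C) = 1 by rewrite /= expr0n expr1n add0r sqrtr1.
have -> : e = (e1 + e1) + (e1 + e1) by rewrite /e1; field.
rewrite !mulrDl; apply: lowrank_splitD; apply: lowrank_splitD.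
- exact: H1.
- apply: lowrank_splitZ1; first by rewrite normcN normc1.
  exact: H2.
- apply: lowrank_splitZ1; first exact: ni.
  exact: H3.
- apply: lowrank_splitZ1; first by rewrite normcN.
  exact: H4.
Qed.

(** Where the modulus of [a] exceeds [M] the rows are put into the low-rank part;
    on the other rows multiplication by [a] multiplies the norm by at most [M],
    which is compensated by splitting the commutator with a precision proportional
    to [e / M]. *)
Lemma near_sdiag_comm_split a g Om (e : R) :
  continuous_ae (unit_cube d) a -> cintegrable Q g ->
  lebesgue_outer (closure Om `\` Om°) = 0%E -> 0 < e ->
  \forall n \near within J \oo,
    lowrank_split (e * (msize (nn n))%:R) e (sdiag (nn n) a *m toeplitz_comm (nn n) g Om).
Proof.
move=> ac gi Om0 e0; pose e1 := e / 2; have e10 : 0 < e1 by rewrite divr_gt0.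
have locb : {ae mu, forall x : 'rV[R]_d, unit_cube d x ->
   \forall x' \near x & M \near +oo%R, unit_cube d x' -> normc (a x') <= M}.
  apply: negligibleS ac => x /= nb ax; apply: nb => cx; have /cvgrPdist_lt/(_ 1 ltr01) h := ax cx.
  exists ([set y | unit_cube d y -> `|(a x : C) - a y| < 1], [set M | normc (a x) + 1 <= M]).
    split => /=; first exact: h.
    by apply: nbhs_pinfty_ge; exact: num_real.
  move=> [y M] [/= ay aM] cy; apply: le_trans aM.
  have {}ay : normc (a x - a y) < 1 by have := ay cy; rewrite -ltcR.
  have -> : a y = a x - (a x - a y) by rewrite subKr.
  by rewrite (le_trans (le_normcD _ _))// lerD2l normcN ltW.
have := near_sparse_bad nn_infty _ locb e10.
move=> hM.
have [M [M0 nM]] : exists M : R, 0 < M /\ \forall n \near within J \oo,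
    (grid_count (nn n) [set x | ~ (normc (a x) <= M)])%:R <= e1 * (msize (nn n))%:R.
  apply: (@filter_ex _ +oo%R); near=> M; split; first by near: M; apply: nbhs_pinfty_gt; exact: num_real.
  by near: M; exact: hM.
pose e2 := Num.min e1 (e1 / M).
have e20 : 0 < e2 by rewrite lt_min e10 divr_gt0.
apply: filterS2 nM (near_comm_split gi Om0 e20) => n hn hc.
(* [b] is the bounded part of [a]; [a - b] vanishes at most grid points. *)
pose b x := if normc (a x) <= M then a x else 0.
have -> : sdiag (nn n) a = sdiag (nn n) b + sdiag (nn n) (fun x => a x - b x).
  rewrite /sdiag -linearD; congr diag_mx; apply/rowP => i.
  by rewrite !mxE addrC subrK.
have -> : e = e1 + e1 by rewrite /e1; field.
rewrite mulmxDl mulrDl; apply: lowrank_splitD.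
  have bM : opbound M (sdiag (nn n) b).
    apply: opbound_diag => [|k]; first exact: ltW.
    by rewrite mxE /b; case: ifP => // _; rewrite normc0 ltW.
  apply: lowrank_split_le (lowrank_splitMl (ltW M0) bM hc).
    by rewrite ler_wpM2r// ge_min lexx.
  by rewrite mulrC -ler_pdivlMr// ge_min lexx orbT.
apply: lowrank_split_le (lowrank_split_rank _) => //; last exact: ltW.
apply: le_trans hn; rewrite ler_nat (leq_trans (mxrankM_maxl _ _))//.
rewrite (leq_trans (rank_diag_mx _))//.
apply: subset_leq_card; apply/fintype.subsetP => i; rewrite !inE mxE /b.
by case: ifP => [_|/negbT/negP //]; rewrite subrr eqxx.
Unshelve. all: by end_near. Qed.

End commutator_split.

(** * From scalar to block matrices *)

#[local] Arguments mxtens_unindex : simpl never.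
#[local] Arguments mxtens_index : simpl never.

Lemma lowrank_split_sum_ord {R : realType} (N : nat) (r e : R) m n
    (F : 'I_N -> 'M[R[i]]_(m, n)) :
  (forall i, lowrank_split r e (F i)) ->
  lowrank_split (r *+ N) (e *+ N) (\sum_(i < N) F i).
Proof.
move=> Fs.
have := @lowrank_split_sum _ _ (index_enum 'I_N) xpredT _ _ _ _ F (fun i _ => Fs i).
by rewrite -sum1_count big_const_ord iter_addn_0 mul1n.
Qed.

Section block_embedding.
Context {R : realType}.
Local Notation C := R[i].

(** With [embed_col], the inclusion of the scalar matrices as the (u, v) entries of
    all blocks: a block matrix is the sum over (u, v) of its scalar matrices
    between these two contractions. *)
Definition embed_row N s (u : 'I_s) : 'M[C]_(N * s, N) :=
  \matrix_(p, i) (mxtens_unindex p == (i, u))%:R.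

Definition embed_col N t (v : 'I_t) : 'M[C]_(N, N * t) :=
  \matrix_(j, q) (mxtens_unindex q == (j, v))%:R.

Lemma mul_embed_row N s (u : 'I_s) m (X : 'M[C]_(N, m)) p k :
  (embed_row N u *m X) p k =
  ((mxtens_unindex p).2 == u)%:R * X (mxtens_unindex p).1 k.
Proof.
rewrite mxE; under eq_bigr do rewrite mxE; case: (mxtens_unindex p) => a b.
rewrite (bigD1 a)//= big1 ?addr0 => [|i /negPf ia].
  by rewrite xpair_eqE eqxx.
by rewrite xpair_eqE eq_sym ia mul0r.
Qed.

Lemma mul_embed_col N t (v : 'I_t) m (X : 'M[C]_(m, N)) k q :
  (X *m embed_col N v) k q =
  X k (mxtens_unindex q).1 * ((mxtens_unindex q).2 == v)%:R.
Proof.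
rewrite mxE; under eq_bigr do rewrite mxE; case: (mxtens_unindex q) => a b.
rewrite (bigD1 a)//= big1 ?addr0 => [|i /negPf ia].
  by rewrite xpair_eqE eqxx.
by rewrite xpair_eqE eq_sym ia mulr0.
Qed.

Lemma block_matrixE N s t (B : 'I_N -> 'I_N -> 'M[C]_(s, t)) :
  block_matrix B = \sum_u \sum_v
    embed_row N u *m (\matrix_(i, j) B i j u v) *m embed_col N v.
Proof.
apply/matrixP => p q; rewrite mxE summxE.
under eq_bigr do rewrite summxE.
under eq_bigr do under eq_bigr do rewrite mul_embed_col mul_embed_row mxE.
case: (mxtens_unindex p) (mxtens_unindex q) => [i u] [j v] /=.
rewrite (bigD1 u)//= [X in _ + X]big1 ?addr0; last first.
  by move=> u' /negPf up; rewrite big1// => v' _; rewrite eq_sym up !mul0r.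
rewrite (bigD1 v)//= big1 ?addr0 => [|v' /negPf vq].
  by rewrite !eqxx mul1r mulr1.
by rewrite [v == v']eq_sym vq mulr0.
Qed.

Lemma sum_mxtens N s (F : 'I_N -> 'I_s -> R) :
  \sum_(p < N * s) F (mxtens_unindex p).1 (mxtens_unindex p).2 = \sum_i \sum_u F i u.
Proof.
rewrite (reindex (@mxtens_index N s)); last first.
  by apply: onW_bij; exists (@mxtens_unindex N s); [exact: mxtens_indexK|exact: mxtens_unindexK].
rewrite pair_big; apply: eq_bigr => -[i u] _.
by rewrite mxtens_indexK.
Qed.

Lemma opbound_embed_row N s (u : 'I_s) : opbound 1 (embed_row N u).
Proof.
move=> x; rewrite le_l2norm// expr1n mul1r /sqnorm.
rewrite (eq_bigr (fun p => (fun i u' => ((u' == u)%:R * normc (x i 0)) ^+ 2)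
  (mxtens_unindex p).1 (mxtens_unindex p).2)) => [|p _]; last first.
  by rewrite mul_embed_row normcM; case: eqP; rewrite ?normc1 ?normc0.
rewrite (sum_mxtens (fun i u' => ((u' == u)%:R * normc (x i 0)) ^+ 2)).
apply: ler_sum => i _; rewrite (bigD1 u)//= eqxx mul1r big1 ?addr0// => u' /negPf ->.
by rewrite mul0r expr0n.
Qed.

Lemma opbound_embed_col N t (v : 'I_t) : opbound 1 (embed_col N v).
Proof.
move=> x; rewrite le_l2norm// expr1n mul1r /sqnorm.
have xE j : (embed_col N v *m x) j 0 = x (mxtens_index (j, v)) 0.
  rewrite mxE (bigD1 (mxtens_index (j, v)))//= mxE mxtens_indexK eqxx mul1r.
  rewrite big1 ?addr0// => q qj; rewrite mxE; case: eqP => [qE|]; last by rewrite mul0r.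
  by case/eqP: qj; rewrite -qE mxtens_unindexK.
under eq_bigr do rewrite xE.
pose G i v' := normc (x (mxtens_index (i, v')) 0) ^+ 2.
rewrite [leRHS](eq_bigr (fun q => G (mxtens_unindex q).1 (mxtens_unindex q).2)) => [|q _].
  rewrite sum_mxtens; apply: ler_sum => j _; rewrite (bigD1 v)//= lerDl.
  by apply: sumr_ge0 => k _; exact: sqr_ge0.
by rewrite /G; congr (normc (x _ _) ^+ 2); rewrite -{1}[q]mxtens_unindexK; case: mxtens_unindex.
Qed.

End block_embedding.

Section block_commutator.
Context {R : realType} {d : nat}.
Local Notation C := R[i].
Local Notation Q := (freq_cube d : set 'rV[R]_d).

Definition bdiag n s (a : 'rV[R]_d -> C) : 'M[C]_(msize n * s) :=
  diag_mx (\row_p a (grid_point (mxtens_unindex p).1)).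

Lemma diag_samplingE n s (a : 'rV[R]_d -> C) :
  diag_sampling n (fun x => (a x)%:M : 'M[C]_s) = bdiag n s a.
Proof.
apply/matrixP => p q; rewrite !mxE.
rewrite -(inj_eq (can_inj (@mxtens_unindexK (msize n) s)) p q).
case: (mxtens_unindex p) (mxtens_unindex q) => [i u] [j v] /=.
by rewrite xpair_eqE; case: (i == j); rewrite /= !mxE.
Qed.

Lemma bdiag_embed_row n s (u : 'I_s) (a : 'rV[R]_d -> C) :
  bdiag n s a *m embed_row (msize n) u = embed_row (msize n) u *m sdiag n a.
Proof.
apply/matrixP => p i; rewrite mul_embed_row mul_diag_mx !mxE.
case: mxtens_unindex => k v /=; rewrite xpair_eqE /= andbC.
by case: (v == u); case: eqP => [->|] /=; rewrite ?mulr0 ?mulr1 ?mul1r ?mul0r ?mulr1n ?mulr0n.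
Qed.

Lemma bdiag_embed_col n t (v : 'I_t) (a : 'rV[R]_d -> C) :
  embed_col (msize n) v *m bdiag n t a = sdiag n a *m embed_col (msize n) v.
Proof.
apply/matrixP => i p; rewrite mul_embed_col mul_mx_diag !mxE.
case: mxtens_unindex => k u /=; rewrite xpair_eqE /= andbC.
by case: (u == v); rewrite eq_sym; case: eqP => [->|] /=; rewrite ?mulr0 ?mulr1 ?mul1r ?mul0r ?mulr1n ?mulr0n.
Qed.

Lemma bdiagM n s (a b : 'rV[R]_d -> C) :
  bdiag n s a *m bdiag n s b = bdiag n s (fun x => a x * b x).
Proof. by rewrite /bdiag mulmx_diag; congr diag_mx; apply/rowP => p; rewrite !mxE. Qed.

Lemma bdiagC n s (a b : 'rV[R]_d -> C) :
  bdiag n s a *m bdiag n s b = bdiag n s b *m bdiag n s a.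
Proof. by rewrite /bdiag diag_mxC. Qed.

Lemma toeplitzE n s t (f : 'rV[R]_d -> 'M[C]_(s, t)) :
  toeplitz n f = \sum_u \sum_v embed_row (msize n) u *m
    stoeplitz n (fun x => f x u v) *m embed_col (msize n) v.
Proof.
rewrite /toeplitz block_matrixE; apply: eq_bigr => u _; apply: eq_bigr => v _.
by congr (_ *m _ *m _); apply/matrixP => i j; rewrite !mxE.
Qed.

(** Sampling matrices act in the same way on all the components of a block, hence
    pass through the embeddings and leave scalar commutators. *)
Lemma bdiag_toeplitz_comm n s t (a : 'rV[R]_d -> C) (f : 'rV[R]_d -> 'M[C]_(s, t)) Om :
  bdiag n s a *m (toeplitz n f *m bdiag n t \1_Om - bdiag n s \1_Om *m toeplitz n f) =
  \sum_u \sum_v embed_row (msize n) u *m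
    (sdiag n a *m toeplitz_comm n (fun x => f x u v) Om) *m embed_col (msize n) v.
Proof.
rewrite toeplitzE mulmx_suml mulmx_sumr -sumrB mulmx_sumr; apply: eq_bigr => u _.
rewrite mulmx_suml mulmx_sumr -sumrB mulmx_sumr; apply: eq_bigr => v _.
set L := embed_row _ _; set S := stoeplitz _ _; set E := embed_col _ _.
have -> : L *m S *m E *m bdiag n t \1_Om = L *m (S *m sdiag n \1_Om) *m E.
  by rewrite -!mulmxA bdiag_embed_col.
have -> : bdiag n s \1_Om *m (L *m S *m E) = L *m (sdiag n \1_Om *m S) *m E.
  by rewrite !mulmxA bdiag_embed_row.
by rewrite -mulmxBl -mulmxBr !mulmxA bdiag_embed_row.
Qed.

Section near.
Variables (J : set nat) (nn : nat -> 'I_d -> nat).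
Hypothesis nn_infty : mindex_to_infty J nn.

Lemma near_bdiag_toeplitz_comm s t (a : 'rV[R]_d -> C) (f : 'rV[R]_d -> 'M[C]_(s, t)) Om (e : R) :
  continuous_ae (unit_cube d) a ->
  (forall u v, cintegrable Q (fun x => f x u v)) ->
  lebesgue_outer (closure Om `\` Om°) = 0%E -> 0 < e ->
  \forall n \near within J \oo, lowrank_split (e * (msize (nn n))%:R) e
    (bdiag (nn n) s a *m (toeplitz (nn n) f *m bdiag (nn n) t \1_Om -
       bdiag (nn n) s \1_Om *m toeplitz (nn n) f)).
Proof.
move=> ac fi Om0 e0; pose K : R := t%:R * s%:R.
have K0 : 0 <= K by rewrite mulr_ge0.
have e10 : 0 < e / (K + 1) by rewrite divr_gt0// ltr_wpDl.
have : \forall n \near within J \oo, forall u v,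
    lowrank_split (e / (K + 1) * (msize (nn n))%:R) (e / (K + 1))
      (sdiag (nn n) a *m toeplitz_comm (nn n) (fun x => f x u v) Om).
  apply: filter_forall => u; apply: filter_forall => v.
  exact: near_sdiag_comm_split.
apply: filterS => n hn; rewrite bdiag_toeplitz_comm.
have e1K : e / (K + 1) * K <= e.
  by rewrite mulrAC ler_pdivrMr ?ltr_wpDl// ler_wpM2l ?lerDl// ltW.
apply: (@lowrank_split_le _ ((e / (K + 1) * (msize (nn n))%:R) *+ t *+ s) _ (e / (K + 1) *+ t *+ s)).
- by rewrite -mulrnA -[leLHS]mulr_natr natrM -/K mulrAC ler_wpM2r.
- by rewrite -mulrnA -[leLHS]mulr_natr natrM -/K.
apply: lowrank_split_sum_ord => u; apply: lowrank_split_sum_ord => v.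
rewrite -[X in lowrank_split _ X]mulr1 -[X in lowrank_split _ (X * 1)]mul1r.
apply: lowrank_splitM => //; [exact: ltW|exact: opbound_embed_row|exact: opbound_embed_col].
Qed.

(** Diagonal matrices commute with each other, so that only the Toeplitz factors
    contribute to the commutator with a sampling matrix. *)
Lemma near_approximant_comm s t N (a : 'I_N -> 'rV[R]_d -> C)
    (f : 'I_N -> 'rV[R]_d -> 'M[C]_(s, t)) Om (e : R) :
  (forall i, continuous_ae (unit_cube d) (a i)) ->
  (forall i u v, cintegrable Q (fun x => f i x u v)) ->
  lebesgue_outer (closure Om `\` Om°) = 0%E -> 0 < e ->
  \forall n \near within J \oo,
    let B := \sum_i bdiag (nn n) s (a i) *m toeplitz (nn n) (f i) in
    lowrank_split (e * (msize (nn n))%:R) e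
      (B *m bdiag (nn n) t \1_Om - bdiag (nn n) s \1_Om *m B).
Proof.
move=> ac fi Om0 e0.
have e10 : 0 < e / (N%:R + 1) by rewrite divr_gt0// ltr_wpDl.
have : \forall n \near within J \oo, forall i,
    lowrank_split (e / (N%:R + 1) * (msize (nn n))%:R) (e / (N%:R + 1))
      (bdiag (nn n) s (a i) *m (toeplitz (nn n) (f i) *m bdiag (nn n) t \1_Om -
       bdiag (nn n) s \1_Om *m toeplitz (nn n) (f i))).
  by apply: filter_forall => i; exact: near_bdiag_toeplitz_comm.
apply: filterS => n hn /=; set B := \sum_i _.
have -> : B *m bdiag (nn n) t \1_Om - bdiag (nn n) s \1_Om *m B =
   \sum_i (bdiag (nn n) s (a i) *m (toeplitz (nn n) (f i) *m bdiag (nn n) t \1_Om -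
       bdiag (nn n) s \1_Om *m toeplitz (nn n) (f i))).
  rewrite /B mulmx_suml mulmx_sumr -sumrB; apply: eq_bigr => i _.
  by rewrite mulmxBr !mulmxA (bdiagC _ _ (a i)).
have e1K : e / (N%:R + 1) * N%:R <= e.
  by rewrite mulrAC ler_pdivrMr ?ltr_wpDl// ler_wpM2l ?lerDl// ltW.
apply: (@lowrank_split_le _ ((e / (N%:R + 1) * (msize (nn n))%:R) *+ N) _ (e / (N%:R + 1) *+ N)).
- by rewrite -[leLHS]mulr_natr mulrAC ler_wpM2r.
- by rewrite -[leLHS]mulr_natr.
by apply: lowrank_split_sum_ord => i.
Qed.

End near.
End block_commutator.

(** * Symbols cut by characteristic functions *)

Section overlap.
Context {R : realType} {d nu : nat}.
Variable Om : 'I_nu -> set 'rV[R]_d.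
Variable P : pred ('I_nu * 'I_nu).
Local Notation C := R[i].
Local Notation mu := (@lebesgue_mu R d).

(** The factor by which the symbol is multiplied: the diagonal pairs give the
    block diagonal case and the pairs [j <= i] the block triangular one. *)
Definition overlap (x : 'rV[R]_d) : R :=
  \sum_(ij | P ij) \1_(Om ij.1 `&` Om ij.2) x.

Hypothesis Om_null : forall i, lebesgue_outer (closure (Om i) `\` (Om i)°) = 0%E.

(** Off the boundaries of all the sets, membership in each of them is locally
    constant. *)
Lemma ae_overlap_locally_constant :
  {ae mu, forall x : 'rV[R]_d, \forall y \near x, overlap y = overlap x}.
Proof.
pose F (k : nat) : set 'rV[R]_d :=
  [set x | exists2 i : 'I_nu, val i = k & (closure (Om i) `\` (Om i)°) x].
have F0 k : mu.-negligible (F k).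
  have [[i ik]|nk] := pselect (exists i : 'I_nu, val i = k).
    have := Om_null i; move/negligible_outer0; apply: negligibleS => x [j jk].
    by rewrite (_ : j = i)//; apply: val_inj; rewrite ik jk.
  by apply: negligibleS (negligible_set0 mu) => x [j jk _]; apply: nk; exists j.
suff loc (x : 'rV[R]_d) : ~ (\bigcup_k F k) x -> \forall y \near x, overlap y = overlap x.
  by apply: negligibleS (negligible_bigcup F0) => x /= nx; apply: contrapT => /loc.
move=> nF.
have : \forall y \near x, forall i, Om i y <-> Om i x.
  have := @filter_forall _ 'I_nu (fun i => [set y | Om i y <-> Om i x]) (nbhs x) _.
  apply=> i.
  apply: near_not_boundary => bx.
  by apply: nF; exists (val i) => //; exists i.
apply: filterS => y yx; apply: eq_bigr => -[i j] _ /=; rewrite !indicE; congr (_%:R).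
congr nat_of_bool; apply/idP/idP; rewrite !inE /= => -[h1 h2].
  by split; [exact/(yx i).1|exact/(yx j).1].
by split; [exact/(yx i).2|exact/(yx j).2].
Qed.

Lemma continuous_ae_overlap (a : 'rV[R]_d -> C) : continuous_ae (unit_cube d) a ->
  continuous_ae (unit_cube d) (fun x => (overlap x)%:C%C * a x).
Proof.
move=> ac; suff loc (x : 'rV[R]_d) :
    ((a y : C^o) @[y --> within (unit_cube d) (nbhs x)] --> (a x : C^o)) ->
    (\forall y \near x, overlap y = overlap x) ->
    ((((overlap y)%:C%C * a y : C^o) @[y --> within (unit_cube d) (nbhs x)]) -->
      ((overlap x)%:C%C * a x : C^o)).
  have := negligibleU ac ae_overlap_locally_constant.
  apply: negligibleS => x /= nx; apply: contrapT => /not_orP[/contrapT ax /contrapT ox].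
  by apply: nx => cx; exact: loc (ax cx) ox.
move=> ax ox.
apply: (@cvg_trans _ (((overlap x)%:C%C : C) *: (a y : C^o) @[y --> within (unit_cube d) (nbhs x)])).
  apply: near_eq_cvg; rewrite near_withinE; apply: filterS ox => y + _ /=.
  by move=> ->.
exact: (cvgZl_tmp (V := C^o)) ax.
Qed.

End overlap.

Section lifted_indicator.
Context {R : realType} {d : nat}.
Local Notation mu2 := (@lebesgue_mu R (d + d)).

Lemma measurable_symbol_dom : measurable (symbol_dom d : set (lebesgue_rV R (d + d))).
Proof.
pose I (l : 'I_(d + d)) : set R :=
  match fintype.split l with inl _ => `[0, 1]%classic | inr _ => `[- pi, pi]%classic end.
have splitl (j : 'I_d) : fintype.split (lshift d j) = inl j by exact: (unsplitK (inl j)).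
have splitr (j : 'I_d) : fintype.split (rshift d j) = inr j by exact: (unsplitK (inr j)).
have -> : symbol_dom d = \bigcap_(l in [set: 'I_(d + d)])
   ((fun x : lebesgue_rV R (d + d) => (x : 'rV[R]_(d + d)) ord0 l) @^-1` I l).
  apply/seteqP; split => z /=.
    move=> [h1 h2] l _ /=; rewrite /I; case: (split_ordP l) => j ->.
      by rewrite /= in_itv /=; have := h1 j; rewrite mxE.
    by rewrite /= in_itv /=; have := h2 j; rewrite mxE.
  move=> h; split => j.
    by have := h (lshift d j) Logic.I; rewrite /I /= splitl /= in_itv /= mxE.
  by have := h (rshift d j) Logic.I; rewrite /I /= splitr /= in_itv /= mxE.
apply: fin_bigcap_measurable => [|l _]; first exact: finite_finset.
rewrite -[X in measurable X]setTI; apply: measurable_coord => //.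
by rewrite /I; case: fintype.split => _.
Qed.

(** A null set of space points gives a null set of pairs of a space point and a
    frequency, because the frequencies are bounded. *)
Lemma negligible_lift (A : set 'rV[R]_d) : lebesgue_outer A = 0%E ->
  lebesgue_outer [set z : 'rV[R]_(d + d) | A (lsubmx z) /\ freq_cube d (rsubmx z)] = 0%E.
Proof.
move=> A0; apply/eqP; rewrite eq_le outer_measure_ge0 andbT.
rewrite -(outer_prod0 (d2 := d) (const_mx (- pi - 1), const_mx pi) A0).
apply: le_outer_measure => z [Az fz]; split => //.
exact: freq_cube_sub_box.
Qed.

Lemma open_lsubmx (U : set 'rV[R]_d) : open U ->
  open [set z : 'rV[R]_(d + d) | U (lsubmx z)].
Proof.
rewrite !openE => oU z Uz; have /nbhs_ballP[e /= e0 eU] := oU _ Uz.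
apply/nbhs_ballP; exists e => //= y [_ zy]; apply: eU; split => // i j.
by rewrite !mxE; exact: zy.
Qed.

(** The lift of a set with null boundary is the lift of its interior, which is
    open, up to a null set. *)
Lemma measurable_lift_indic (Om : set 'rV[R]_d) :
  lebesgue_outer (closure Om `\` Om°) = 0%E ->
  measurable_fun (symbol_dom d : set (lebesgue_rV R (d + d)))
    (fun z : lebesgue_rV R (d + d) => \1_Om (lsubmx (z : 'rV[R]_(d + d))) : R).
Proof.
move=> Om0; pose S : set 'rV[R]_(d + d) := symbol_dom d `&` [set z | Om (lsubmx z)].
pose S1 : set 'rV[R]_(d + d) := symbol_dom d `&` [set z | Om° (lsubmx z)].
have mS : measurable (S : set (lebesgue_rV R (d + d))).
  have -> : S = S1 `|` (S `\` S1).
    by rewrite setDE setUIr setUv setIT setUidr// => z [cz /interior_subset oz].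
  apply: measurableU.
    apply: measurableI; first exact: measurable_symbol_dom.
    by apply: open_measurable_rV; apply: open_lsubmx; exact: open_interior.
  apply: outer0_measurable; apply/eqP; rewrite eq_le outer_measure_ge0 andbT.
  rewrite -(negligible_lift Om0); apply: le_outer_measure => z [[[cz fz] Oz] nz].
  split => //; split; first exact: subset_closure.
  by move=> iz; apply: nz; split.
apply: (eq_measurable_fun (\1_S : lebesgue_rV R (d + d) -> R)).
  move=> z; rewrite inE => dz; rewrite !indicE; congr (nat_of_bool _)%:R.
  by apply/idP/idP; rewrite !inE /=; [case|move=> h; split].
exact: measurable_indic.
Qed.

Lemma measurable_symbol_overlap s t nu (Om : 'I_nu -> set 'rV[R]_d)
    (P : pred ('I_nu * 'I_nu)) (kappa : 'rV[R]_d -> 'rV[R]_d -> 'M[R[i]]_(s, t)) :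
  (forall i, lebesgue_outer (closure (Om i) `\` (Om i)°) = 0%E) ->
  measurable_symbol kappa ->
  measurable_symbol (fun x theta => (overlap Om P x)%:C%C *: kappa x theta).
Proof.
move=> Om0 mk u v.
have mo : measurable_fun (symbol_dom d : set (lebesgue_rV R (d + d)))
    (fun z : lebesgue_rV R (d + d) => overlap Om P (lsubmx (z : 'rV[R]_(d + d)))).
  rewrite /overlap; under eq_fun do rewrite big_mkcond.
  apply: measurable_sum => -[i j]; case: (P (i, j)); last exact: measurable_cst.
  under eq_fun do rewrite /= indicI.
  by apply: measurable_funM; exact: measurable_lift_indic.
have [mRe mIm] := mk u v; split.
  apply: eq_measurable_fun (measurable_funM mo mRe) => z _ /=.
  by rewrite mxE; case: (kappa _ _ u v) => a b /=; rewrite mul0r subr0.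
apply: eq_measurable_fun (measurable_funM mo mIm) => z _ /=.
by rewrite mxE; case: (kappa _ _ u v) => a b /=; rewrite mul0r addr0.
Qed.

(** The symbol enters only through a convergence almost everywhere. *)
Lemma GLT_ae_eq s t J nn
    (A : forall n : nat, 'M[R[i]]_(@msize d (nn n) * s, msize (nn n) * t))
    (kappa kappa' : 'rV[R]_d -> 'rV[R]_d -> 'M[R[i]]_(s, t)) :
  measurable_symbol kappa' ->
  {ae @lebesgue_mu R d, forall x : 'rV[R]_d, unit_cube d x ->
    forall theta, kappa x theta = kappa' x theta} ->
  GLT J A kappa -> GLT J A kappa'.
Proof.
move=> mk' kk' [_ [N [a [f [ac fi akf acs]]]]]; split; first exact: mk'.
exists N, a, f; split; [exact: ac|exact: fi| |exact: acs].
have kk2 : mu2.-negligible [set z : 'rV[R]_(d + d) |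
   (~ forall theta, kappa (lsubmx z) theta = kappa' (lsubmx z) theta) /\ symbol_dom d z].
  apply/negligible_outer0; move/negligible_outer0/negligible_lift: kk' => kk'.
  apply/eqP; rewrite eq_le outer_measure_ge0 andbT -kk'.
  apply: le_outer_measure => z [nz [cz fz]]; split => //= h.
  by apply: nz; exact: h.
apply: negligibleS (negligibleU akf kk2) => z /= nz.
apply: contrapT => /not_orP[/contrapT h1 /not_andP[/contrapT h2|h2]]; apply: nz => dz.
  by move=> u v; rewrite -h2; exact: h1.
by [].
Qed.

End lifted_indicator.

(** * Zeroing operators on GLT sequences *)

Section zeroing.
Context {R : realType} {d : nat}.
Local Notation C := R[i].
Local Notation Q := (freq_cube d : set 'rV[R]_d).

Lemma zeroingE n s t (OmL OmR : set 'rV[R]_d) (A : 'M[C]_(msize n * s, msize n * t)) :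
  zeroing OmL OmR A = bdiag n s \1_OmL *m A *m bdiag n t \1_OmR.
Proof. by rewrite /zeroing !diag_samplingE. Qed.

Lemma opbound_bdiag1 n s (Om : set 'rV[R]_d) : opbound 1 (bdiag n s (\1_Om : 'rV[R]_d -> C)).
Proof.
apply: opbound_diag => // k; rewrite mxE indicE.
by case: (_ \in _); rewrite ?normc0 ?normc1.
Qed.

Lemma rank_bdiag_indicB n s (S T : set 'rV[R]_d) :
  (\rank (bdiag n s (\1_S : _ -> C) - bdiag n s \1_T))%:R <=
  (grid_count n (S `+` T))%:R * s%:R :> R.
Proof.
rewrite /bdiag -linearB /=.
pose F (i : 'I_(msize n)) (u : 'I_s) : R := ((grid_point i : 'rV[R]_d) \in S `+` T)%:R.
apply: (@le_trans _ _ (\sum_(p < msize n * s) F (mxtens_unindex p).1 (mxtens_unindex p).2)).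
  set v := (X in diag_mx X).
  apply: (@le_trans _ _ (#|[pred k | v 0 k != 0]|)%:R).
    by rewrite ler_nat; exact: rank_diag_mx.
  rewrite -sum1_card natr_sum [leLHS]big_mkcond /=; apply: ler_sum => p _.
  rewrite inE /v !mxE !indicE /F; set g := grid_point _.
  case: ifPn => // h; rewrite (_ : (g \in S `+` T) = true)//; apply/idP.
  rewrite inE; move: h; have [Sg|nSg] := pselect (S g); have [Tg|nTg] := pselect (T g).
  - by rewrite !mem_set// subrr eqxx.
  - by left.
  - by right.
  - by rewrite !memNset// subrr eqxx.
rewrite (sum_mxtens F) /F.
rewrite /grid_count -sum1_card natr_sum [X in _ <= X * _]big_mkcond mulr_suml; apply: ler_sum => i _.
rewrite sumr_const card_ord unfold_in /=.
by case: (_ \in _); rewrite ?mul1r// mul0rn mul0r.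
Qed.

Variables (J : set nat) (nn : nat -> 'I_d -> nat).
Hypothesis nn_infty : mindex_to_infty J nn.

Lemma near_msize_gt0 : \forall n \near within J \oo, (0 < msize (nn n))%N.
Proof.
apply: filterS (near_nn_ge nn_infty 1) => n h.
by rewrite prodn_gt0.
Qed.

Lemma near_grid_count_cvg (Sn : nat -> set 'rV[R]_d) S (e : R) : set_cvg J nn Sn S ->
  0 < e -> \forall n \near within J \oo,
    (grid_count (nn n) (Sn n `+` S))%:R <= e * (msize (nn n))%:R.
Proof.
move=> /cvgrPdist_le h e0; have {}h := h e e0.
apply: filterS2 h near_msize_gt0 => n; rewrite sub0r normrN => h N0.
rewrite -ler_pdivrMr ?ltr0n//; apply: le_trans h; exact: ler_norm.
Qed.

(** The difference telescopes into the error [X] between two contractions, the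
    effects of replacing each of the two sets by its limit, of rank at most the
    number of grid points in a symmetric difference times the block size, and the
    commutator of the approximant with the right-hand cut. *)
Lemma near_zeroing_split s t N (a : 'I_N -> 'rV[R]_d -> C)
    (f : 'I_N -> 'rV[R]_d -> 'M[C]_(s, t)) (SLn SRn : nat -> set 'rV[R]_d) SL SR (e : R) :
  (forall i, continuous_ae (unit_cube d) (a i)) ->
  (forall i u v, cintegrable Q (fun x => f i x u v)) ->
  set_cvg J nn SLn SL -> set_cvg J nn SRn SR ->
  lebesgue_outer (closure SR `\` SR°) = 0%E -> 0 < e ->
  \forall n \near within J \oo, forall r w (X : 'M[C]_(msize (nn n) * s, msize (nn n) * t)),
    0 <= w -> lowrank_split r w X ->
    let B := \sum_i bdiag (nn n) s (a i) *m toeplitz (nn n) (f i) in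
    lowrank_split (r + e * (msize (nn n))%:R) (w + e)
      (zeroing (SLn n) (SRn n) (B + X) - bdiag (nn n) s \1_(SL `&` SR) *m B).
Proof.
move=> ac fi cL cR SR0 e0; pose e1 := e / 2; have e10 : 0 < e1 by rewrite divr_gt0.
pose K : R := s%:R + t%:R; have K0 : 0 <= K by rewrite addr_ge0.
pose e2 := e1 / (K + 1); have e20 : 0 < e2 by rewrite divr_gt0// ltr_wpDl.
have e2K : e2 * K <= e1.
  by rewrite mulrAC ler_pdivrMr ?ltr_wpDl// ler_wpM2l ?lerDl// ltW.
apply: filterS (filterI (near_approximant_comm nn_infty ac fi SR0 e10)
  (filterI (near_grid_count_cvg cL e20) (near_grid_count_cvg cR e20))) => n [].
rewrite /=; set B := \sum_i _; set M : R := (msize (nn n))%:R.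
move=> hB [hL hR] r w X w0 Xs.
set EL := bdiag (nn n) s \1_(SLn n); set ER := bdiag (nn n) t \1_(SRn n).
set FL := bdiag (nn n) s \1_SL; set FR := bdiag (nn n) t \1_SR.
set FRs := bdiag (nn n) s \1_SR.
have -> : zeroing (SLn n) (SRn n) (B + X) - bdiag (nn n) s \1_(SL `&` SR) *m B =
   EL *m X *m ER + (((EL - FL) *m B *m ER + FL *m B *m (ER - FR)) +
   FL *m (B *m FR - FRs *m B)).
  have -> : bdiag (nn n) s \1_(SL `&` SR) = FL *m FRs.
    by rewrite bdiagM; congr bdiag; apply/funext => x; rewrite indicI.
  (* [p], [q], [y] are [B] between the cuts by the n-th sets, then with the left
     one, then with both replaced by limits; [z] has both cuts on the left. *)
  have telescope (U : zmodType) (x p q y z : U) :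
      p + x - z = x + (((p - q) + (q - y)) + (y - z)).
    by rewrite [p - q + _]addrA subrK [p - y + _]addrA subrK addrA [x + p]addrC.
  rewrite zeroingE -/EL -/ER [EL *m (B + X)]mulmxDr [(EL *m B + _) *m _]mulmxDl.
  rewrite !mulmxBl !mulmxBr !mulmxA.
  exact: telescope.
have -> : r + e * M = r + (e2 * K * M + e1 * M) + (e - e1 - e2 * K) * M by ring.
apply: (@lowrank_split_le _ (r + (e2 * K * M + e1 * M)) _ (w + (0 + e1))) => //.
- rewrite lerDl mulr_ge0//; move: e2K; rewrite /e1; lra.
- by rewrite add0r lerD2l /e1; lra.
apply: lowrank_splitD.
  have := lowrank_splitM ler01 w0 (@opbound_bdiag1 (nn n) s (SLn n)) (@opbound_bdiag1 (nn n) t (SRn n)) Xs.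
  by rewrite mul1r mulr1.
apply: lowrank_splitD; last first.
  have := lowrank_splitMl ler01 (@opbound_bdiag1 (nn n) s SL) hB.
  by rewrite mul1r.
apply: lowrank_split_le (lowrank_split_rank _) => //.
apply: (@le_trans _ _ ((\rank (EL - FL))%:R + (\rank (ER - FR))%:R)).
  rewrite -natrD ler_nat (leq_trans (mxrank_add _ _))// leq_add//.
    by rewrite -mulmxA mxrankM_maxl.
  exact: mxrankM_maxr.
rewrite /K mulrDr mulrDl; apply: lerD.
  apply: (le_trans (rank_bdiag_indicB _ _ _ _)); rewrite mulrAC ler_wpM2r//.
apply: (le_trans (rank_bdiag_indicB _ _ _ _)); rewrite mulrAC ler_wpM2r//.
Qed.

(** Common generalisation of the two claims.  The approximants of [A] are kept up
    to the factor [overlap Om P], and precision [1 / (m + 1)] is requested for the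
    [m]-th of them; the number of pairs multiplies both error bounds. *)
Lemma GLT_zeroing_sum s t nu (s_gt0 : (0 < s)%N) (t_gt0 : (0 < t)%N)
  (Omn : nat -> 'I_nu -> set 'rV[R]_d) (Om : 'I_nu -> set 'rV[R]_d)
  (P : pred ('I_nu * 'I_nu))
  (kappa : 'rV[R]_d -> 'rV[R]_d -> 'M[R[i]]_(s, t))
  (A : forall n, 'M[R[i]]_(msize (nn n) * s, msize (nn n) * t)) :
  (forall i, lebesgue_outer (closure (Om i) `\` (Om i)°) = 0%E) ->
  (forall i, set_cvg J nn (fun n => Omn n i) (Om i)) ->
  GLT J A kappa ->
  GLT J (fun n => \sum_(ij | P ij) zeroing (Omn n ij.1) (Omn n ij.2) (A n))
    (fun x theta => (overlap Om P x)%:C%C *: kappa x theta).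
Proof.
move=> Om0 Omc [mk [N [a [f [ac fi akf [n0 [c [w [c0 w0 hA]]]]]]]]].
split; first exact: measurable_symbol_overlap.
exists N, (fun m i x => (overlap Om P x)%:C%C * a m i x), f; split.
- by move=> m i; exact: continuous_ae_overlap.
- exact: fi.
- apply: negligibleS akf => z /= nz h; apply: nz => dz u v.
  have := h dz u v => huv.
  rewrite mxE.
  apply: cvg_trans (cvgZl_tmp (V := C^o) (k := (overlap Om P (lsubmx z))%:C%C) huv).
  apply: near_eq_cvg; near=> m; rewrite /= /GRing.scale /=.
  rewrite !summxE mulr_sumr; apply: eq_bigr => i _.
  by rewrite !mxE mulrA.
pose K := count P (index_enum ('I_nu * 'I_nu)%type).
pose e m : R := m.+1%:R^-1.
have e0 m : 0 < e m by rewrite invr_gt0.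
pose B m n := \sum_(i < N m) bdiag (nn n) s (a m i) *m toeplitz (nn n) (f m i).
have near_m m : exists n1, forall n, J n -> (n1 <= n)%N -> forall ij,
   forall r w' (X : 'M[C]_(msize (nn n) * s, msize (nn n) * t)),
    0 <= w' -> lowrank_split r w' X ->
    lowrank_split (r + e m * (msize (nn n))%:R) (w' + e m)
      (zeroing (Omn n ij.1) (Omn n ij.2) (B m n + X) -
       bdiag (nn n) s \1_(Om ij.1 `&` Om ij.2) *m B m n).
  have : \forall n \near within J \oo, forall ij : 'I_nu * 'I_nu,
   forall r w' (X : 'M[C]_(msize (nn n) * s, msize (nn n) * t)),
    0 <= w' -> lowrank_split r w' X ->
    lowrank_split (r + e m * (msize (nn n))%:R) (w' + e m)
      (zeroing (Omn n ij.1) (Omn n ij.2) (B m n + X) -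
       bdiag (nn n) s \1_(Om ij.1 `&` Om ij.2) *m B m n).
    apply: filter_forall => ij.
    exact: (near_zeroing_split (ac m) (fi m) (Omc ij.1) (Omc ij.2) (Om0 ij.2) (e0 m)).
  by move=> [n1 _ hn1]; exists n1 => n Jn n1n; exact: hn1.
have [n1 hn1] := choice near_m.
exists (fun m => maxn (n0 m) (n1 m)), (fun m => (c m + e m) *+ K), (fun m => (w m + e m) *+ K).
have ecvg : e m @[m --> \oo] --> (0 : R) by exact: cvg_harmonic.
split.
- by rewrite -(mul0rn _ K) -[X in X *+ K](addr0 0); apply: cvgMn; exact: cvgD.
- by rewrite -(mul0rn _ K) -[X in X *+ K](addr0 0); apply: cvgMn; exact: cvgD.
move=> m n Jn; rewrite geq_max => /andP[n0n n1n].
have [Rk [Nm [AE rR nN]]] := hA m n Jn n0n.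
have wm0 : 0 <= w m by apply: le_trans nN; exact: spectral_norm_ge0.
have BE : \sum_(i < N m) diag_sampling (nn n) (fun x => (a m i x)%:M : 'M[C]_s) *m
   toeplitz (nn n) (f m i) = B m n.
  by apply: eq_bigr => i _; rewrite diag_samplingE.
have Xs : lowrank_split (c m * (minn (msize (nn n) * s) (msize (nn n) * t))%:R) (w m) (Rk + Nm).
  exists Rk, Nm; split => //; exact: opbound_le nN (spectral_normP Nm).
have {}AE : A n = B m n + (Rk + Nm) by rewrite AE BE addrA.
have := @lowrank_split_sum _ _ (index_enum ('I_nu * 'I_nu)%type) P _ _ _ _ _
  (fun ij _ => hn1 m n Jn n1n ij _ _ _ wm0 Xs).
set S := \sum_(ij <- _ | _) _ => -[R' [N' [SE rR' nN']]].
exists R', N'; split.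
- have -> : \sum_(i < N m) diag_sampling (nn n)
      (fun x => ((overlap Om P x)%:C%C * a m i x)%:M : 'M[C]_s) *m toeplitz (nn n) (f m i) =
    \sum_(ij | P ij) bdiag (nn n) s \1_(Om ij.1 `&` Om ij.2) *m B m n.
    rewrite -mulmx_suml mulmx_sumr; apply: eq_bigr => i _.
    rewrite diag_samplingE -bdiagM mulmxA; congr (_ *m _ *m _).
    rewrite /bdiag -linear_sum /=; congr diag_mx; apply/rowP => p.
    rewrite mxE summxE /overlap rmorph_sum; apply: eq_bigr => ij _.
    by rewrite mxE !indicE rmorph_nat.
  by rewrite -addrA -SE /S sumrB addrC subrK AE.
- apply: (le_trans rR').
  rewrite mulrnAl mulrDl lerMn2r; apply/orP; right.
  rewrite lerD2l ler_wpM2l ?(ltW (e0 m))//.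
  by rewrite ler_nat leq_min !leq_pmulr.
- apply: opbound_spectral_norm => //.
  by rewrite mulrn_wge0// addr_ge0// (ltW (e0 m)).
Unshelve. all: by end_near. Qed.

End zeroing.

Section pair_sums.
Variables (V : nmodType) (nu : nat) (F : 'I_nu -> 'I_nu -> V).

Lemma sum_diagonal_pairs :
  \sum_(ij : 'I_nu * 'I_nu | ij.1 == ij.2) F ij.1 ij.2 = \sum_i F i i.
Proof.
rewrite -(pair_big_dep xpredT (fun i j => i == j)) /=; apply: eq_bigr => i _.
by rewrite (big_pred1 i) // => j; rewrite eq_sym.
Qed.

Lemma sum_lower_pairs :
  \sum_(ij : 'I_nu * 'I_nu | (ij.2 <= ij.1)%N) F ij.1 ij.2 =
  \sum_(i < nu) \sum_(j < nu | (j <= i)%N) F i j.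
Proof. by rewrite -(pair_big_dep xpredT (fun i j : 'I_nu => (j <= i)%N)). Qed.

End pair_sums.

Section overlap_values.
Context {R : realType} {d nu : nat}.
Variable Om : 'I_nu -> set 'rV[R]_d.

Lemma overlap_diagonal x :
  overlap Om (fun ij => ij.1 == ij.2) x = \sum_i \1_(Om i) x.
Proof.
rewrite /overlap (sum_diagonal_pairs (fun i j => \1_(Om i `&` Om j) x)).
by apply: eq_bigr => i _; rewrite setIid.
Qed.

(** Only one of the sets contains [x], so that only its diagonal pair contributes. *)
Lemma overlap_lower x : \sum_i \1_(Om i) x = 1 :> R ->
  overlap Om (fun ij => (ij.2 <= ij.1)%N) x = 1.
Proof.
move=> sum1.
have [i Oi] : exists i, Om i x.
  apply: contrapT => /forallNP nO; have := oner_neq0 R; rewrite -sum1 big1 ?eqxx// => i _.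
  by rewrite indicE memNset.
(* A second set containing [x] would make the sum at least 2. *)
have others j : j != i -> ~ Om j x.
  move=> ji Oj; have : (2 : R) <= 1.
    rewrite -[leRHS]sum1 (bigD1 i)//= (bigD1 j)//= !indicE !mem_set//.
    by rewrite addrA lerDl sumr_ge0.
  by rewrite (ler_nat R 2 1).
rewrite /overlap (bigD1 (i, i))//= indicE mem_set// big1 ?addr0// => -[j k] /andP[_ jk].
rewrite indicE memNset//= => -[Oj Ok]; move/negP: jk; apply.
rewrite xpair_eqE; apply/andP; split.
  by apply/negPn/negP => /others.
by apply/negPn/negP => /others.
Qed.

Lemma partition_sum1 (D : set 'rV[R]_d) : trivIset [set: 'I_nu] Om ->
  \bigcup_i Om i = D -> forall x, D x -> \sum_i \1_(Om i) x = 1 :> R.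
Proof.
move=> triv <- x [i _ Oi]; rewrite (bigD1 i)//= indicE mem_set// big1 ?addr0// => j ji.
rewrite indicE memNset// => Oj; move/eqP: ji; apply.
by apply: (triv j i) => //; exists x.
Qed.

End overlap_values.

Theorem theorem7p1 (R : realType) (d s t nu : nat)
  (d_gt0 : (0 < d)%N) (s_gt0 : (0 < s)%N) (t_gt0 : (0 < t)%N)
  (nu_gt0 : (0 < nu)%N)
  (J : set nat) (J_infinite : infinite_set J)
  (nn : nat -> 'I_d -> nat)
  (nn_gt0 : forall n, J n -> forall k, (0 < nn n k)%N)
  (nn_infty : mindex_to_infty J nn)
  (Omn : nat -> 'I_nu -> set 'rV[R]_d)
  (Omn_sub : forall n, J n -> forall i, Omn n i `<=` unit_cube d)
  (Om : 'I_nu -> set 'rV[R]_d)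
  (Om_sub : forall i, Om i `<=` unit_cube d)
  (Om_regular : forall i, regular_set (Om i))
  (Omn_cvg : forall i, set_cvg J nn (fun n => Omn n i) (Om i))
  (kappa : 'rV[R]_d -> 'rV[R]_d -> 'M[R[i]]_(s, t))
  (kappa_measurable : measurable_symbol kappa)
  (A : forall n, 'M[R[i]]_(msize (nn n) * s, msize (nn n) * t))
  (A_GLT : GLT J A kappa) :
  [/\ GLT J (fun n => blockdiag (Omn n) (A n))
        (fun x theta => (\sum_(i < nu) \1_(Om i) x) *: kappa x theta),
      GLT J (fun n => blocktril (Omn n) (A n))
        (fun x theta =>
          (\sum_(i < nu) \sum_(j < nu | (j <= i)%N) \1_(Om i `&` Om j) x)
            *: kappa x theta),
      {ae @lebesgue_mu R d, forall x : 'rV[R]_d, unit_cube d x ->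
          \sum_(i < nu) \1_(Om i) x = 1 :> R} ->
        GLT J (fun n => blockdiag (Omn n) (A n)) kappa /\
        GLT J (fun n => blocktril (Omn n) (A n)) kappa
    & trivIset [set: 'I_nu] Om -> \bigcup_i Om i = unit_cube d ->
        {ae @lebesgue_mu R d, forall x : 'rV[R]_d, unit_cube d x ->
          \sum_(i < nu) \1_(Om i) x = 1 :> R} ].
Proof.
have Om0 i : lebesgue_outer (closure (Om i) `\` (Om i)°) = 0%E by exact: (Om_regular i).2.
pose dg (ij : 'I_nu * 'I_nu) := ij.1 == ij.2.
pose lw (ij : 'I_nu * 'I_nu) := (ij.2 <= ij.1)%N.
have Gdiag : GLT J (fun n => blockdiag (Omn n) (A n))
    (fun x theta => (overlap Om dg x)%:C%C *: kappa x theta).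
  have -> : (fun n => blockdiag (Omn n) (A n)) =
      (fun n => \sum_(ij | dg ij) zeroing (Omn n ij.1) (Omn n ij.2) (A n)).
    apply: functional_extensionality_dep => n.
    by rewrite /blockdiag -(sum_diagonal_pairs (fun i j => zeroing (Omn n i) (Omn n j) (A n))).
  exact: GLT_zeroing_sum.
have Glow : GLT J (fun n => blocktril (Omn n) (A n))
    (fun x theta => (overlap Om lw x)%:C%C *: kappa x theta).
  have -> : (fun n => blocktril (Omn n) (A n)) =
      (fun n => \sum_(ij | lw ij) zeroing (Omn n ij.1) (Omn n ij.2) (A n)).
    apply: functional_extensionality_dep => n.
    by rewrite /blocktril -(sum_lower_pairs (fun i j => zeroing (Omn n i) (Omn n j) (A n))).
  exact: GLT_zeroing_sum.
split.
- have -> : (fun x theta => (\sum_(i < nu) \1_(Om i) x) *: kappa x theta) =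
      (fun x theta => (overlap Om dg x)%:C%C *: kappa x theta); last by [].
  apply/funext => x; apply/funext => theta; congr (_ *: _).
  by rewrite overlap_diagonal rmorph_sum; apply: eq_bigr => i _; rewrite !indicE rmorph_nat.
- have -> : (fun x theta => (\sum_(i < nu) \sum_(j < nu | (j <= i)%N) \1_(Om i `&` Om j) x)
        *: kappa x theta) =
      (fun x theta => (overlap Om lw x)%:C%C *: kappa x theta); last by [].
  apply/funext => x; apply/funext => theta; congr (_ *: _).
  rewrite /overlap (sum_lower_pairs (fun i j => \1_(Om i `&` Om j) x)) rmorph_sum.
  apply: eq_bigr => i _; rewrite rmorph_sum; apply: eq_bigr => j _.
  by rewrite !indicE rmorph_nat.
- move=> sum1; split.
    apply: GLT_ae_eq Gdiag; first exact: kappa_measurable.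
    apply: negligibleS sum1 => x /= nx h; apply: nx => cx theta.
    by rewrite overlap_diagonal h// scale1r.
  apply: GLT_ae_eq Glow; first exact: kappa_measurable.
  apply: negligibleS sum1 => x /= nx h; apply: nx => cx theta.
  by rewrite overlap_lower ?h// scale1r.
- by move=> triv cover; apply: aeW => x; exact: partition_sum1.
Qed.
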